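(* Let $M=\{M_\gamma\}_{\gamma\in\Gamma}$ and $N=\{N_\omega\}_{\omega\in\Omega}$ be defining families of functions on $\mathbb{R}^{k_1}$ and $\mathbb{R}^{k_2}$ respectively, each satisfying conditions (I) and (II) given in the context. Let the bilinear mapping $\Phi\colon \mathcal{K}(M)\times\mathcal{K}(N)\to\mathcal{K}(M\otimes N)$ be defined by $\Phi(f,g)(x,y)=f(x)g(y)$. Then $\Phi$ induces a topological isomorphism $\mathcal{K}(M)\widehat{\otimes}_\pi\mathcal{K}(N)\simeq\mathcal{K}(M\otimes N)$.
   Context: A defining family of functions on $\mathbb{R}^k$ is a family $M=\{M_\gamma\}_{\gamma\in\Gamma}$ of nonnegative measurable functions on $\mathbb{R}^k$ which are bounded on every bounded subset of $\mathbb{R}^k$ and satisfy: (a) for every $\gamma_1,\gamma_2\in\Gamma$, there are $\gamma\in\Gamma$ and $C>0$ such that $M_\gamma\ge C(M_{\gamma_1}+M_{\gamma_2})$; (b) there is a countable set $\Gamma'\subset\Gamma$ such that for every $\gamma\in\Gamma$ there are $\gamma'\in\Gamma'$ and $C>0$ with $CM_\gamma\le M_{\gamma'}$; (c) for every $x\in\mathbb{R}^k$, there are $\gamma\in\Gamma$, a neighborhood $O(x)$ of $x$, and $C>0$ such that $M_\gamma(x')\ge C$ for all $x'\in O(x)$. The space $\mathcal{K}(M)$ consists of all smooth complex-valued functions $f$ on $\mathbb{R}^k$ for which all the seminorms $$\|f\|_{\gamma,m}=\sup_{x\in\mathbb{R}^k,\ |\mu|\le m}M_\gamma(x)|\partial^\mu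 f(x)|,\qquad \gamma\in\Gamma,\ m\in\mathbb{Z}_+,$$ are finite, with the topology determined by these seminorms; here $\mu\in\mathbb{Z}_+^k$ is a multi-index and $|\mu|=\mu_1+\dots+\mu_k$. Conditions on a defining family $M$ on $\mathbb{R}^k$: (I) for every $\gamma\in\Gamma$, there are $\gamma'\in\Gamma$ and a summable (Lebesgue integrable) nonnegative function $L_{\gamma\gamma'}$ on $\mathbb{R}^k$ such that $M_\gamma\le L_{\gamma\gamma'}M_{\gamma'}$ and $L_{\gamma\gamma'}(x)\to0$ as $|x|\to\infty$; (II) for every $\gamma\in\Gamma$, there are $\gamma'\in\Gamma$, a neighborhood of the origin $B$ in $\mathbb{R}^k$, and $C>0$ such that $M_\gamma(x)\le CM_{\gamma'}(x+y)$ for any $x\in\mathbb{R}^k$ and $y\in B$. $M\otimes N$ is the family of functions on $\mathbb{R}^{k_1+k_2}$, indexed by $(\gamma,\omega)\in\Gamma\times\Omega$, given by $(M\otimes N)_{\gamma\omega}(x,y)=M_\gamma(x)N_\omega(y)$; it is a defining family on $\mathbb{R}^{k_1+k_2}$. $F\widehat{\otimes}_\pi G$ is the completion of $F\otimes G$ endowed with the projective topology, i.e. the strongest locally convex topology for which $(f,g)\mapsto f\otimes g$ is continuous. $\Phi\colon F\times G\to H$ induces a topological isomorphism $F\widehat{\otimes}_\pi G\simeq H$ if the linear mapping $F\otimes_\pi G\to H$, $f\otimes g\mapsto\Phi(f,g)$, is continuous and its continuous extension to $F\widehat{\otimes}_\pi G$ is a topological isomorphism onto $H$. *)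

(* Defs.v *)
From HB Require Import structures.
From mathcomp Require Import all_boot all_order all_algebra.
From mathcomp Require Import all_classical all_reals all_analysis.
From mathcomp Require Import complex lra.

Set Implicit Arguments.
Unset Strict Implicit.
Unset Printing Implicit Defensive.

Import Order.TTheory GRing.Theory Num.Theory.
Import numFieldNormedType.Exports.
Import ComplexField.Normc.

Local Open Scope classical_set_scope.
Local Open Scope ring_scope.
Local Open Scope complex_scope.

Section LebesgueMeasure.
Context (R : realType).

Definition tuple_cons n (p : measurableTypeR R * n.-tuple (measurableTypeR R))
  : n.+1.-tuple (measurableTypeR R) := [tuple of p.1 :: p.2].

Lemma measurable_tuple_cons n : measurable_fun [set: _] (@tuple_cons n).
Proof.
by apply: measurable_cons; [exact: measurable_fst|exact: measurable_snd].
Qed.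

Section step.
Variables (n : nat)
  (mu : {sigma_finite_measure set (n.-tuple (measurableTypeR R)) -> \bar R}).

Definition lebesgue_step : set (n.+1.-tuple (measurableTypeR R)) -> \bar R :=
  pushforward (@lebesgue_measure R \x mu)%E (@tuple_cons n).

Let step0 : lebesgue_step set0 = 0%E.
Proof. by rewrite /lebesgue_step /pushforward preimage_set0 measure0. Qed.

Let step_ge0 A : (0 <= lebesgue_step A)%E.
Proof. by rewrite /lebesgue_step /pushforward; exact: measure_ge0. Qed.

Let step_sigma_additive : semi_sigma_additive lebesgue_step.
Proof.
have mf := @measurable_tuple_cons n.
move=> F mF tF mUF; rewrite /lebesgue_step /pushforward preimage_bigcup.
apply: measure_semi_sigma_additive.
- by move=> i; rewrite -[X in measurable X]setTI; exact: mf.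
- apply/trivIsetP => /= i j _ _ ij; rewrite -preimage_setI.
  by move/trivIsetP : tF => /(_ _ _ _ _ ij) ->//; rewrite preimage_set0.
- by rewrite -preimage_bigcup -[X in measurable X]setTI; exact: mf.
Qed.

HB.instance Definition _ := isMeasure.Build _ _ _ lebesgue_step
  step0 step_ge0 step_sigma_additive.

Let step_sigma_finite : sigma_finite [set: _] lebesgue_step.
Proof.
have [H TH mH] : sigma_finite [set: _] (@lebesgue_measure R \x mu)%E.
  have /sigma_finiteP[F [TF ndF Foo]] := sigma_finiteT (@lebesgue_measure R).
  have /sigma_finiteP[G [TG ndG Goo]] := sigma_finiteT mu.
  exists (fun i => F i `*` G i).
    rewrite -setXTT TF TG predeqE => -[x y]; split.
      move=> [/= [i _ Fix] [j _ Gjy]]; exists (maxn i j) => //; split.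
      - by move: x Fix; exact/subsetPset/ndF/leq_maxl.
      - by move: y Gjy; exact/subsetPset/ndG/leq_maxr.
    by move=> [i _ []/= ? ?]; split; exists i.
  move=> i; have [? ?] := Foo i; have [? ?] := Goo i.
  split; first exact: measurableX.
  by rewrite product_measure1E// lte_mul_pinfty// ge0_fin_numE.
pose uncons (t : n.+1.-tuple (measurableTypeR R)) :
    measurableTypeR R * n.-tuple (measurableTypeR R) :=
  (tnth t ord0, [tuple of behead t]).
have consK : cancel (@tuple_cons n) uncons.
  by move=> [x t]; congr (_, _); apply: val_inj.
have unconsK : cancel uncons (@tuple_cons n).
  by move=> t; rewrite /tuple_cons /= -tuple_eta.
have muncons : measurable_fun [set: _] uncons.
  by apply: measurable_fun_pair; [exact: measurable_tnth|exact: measurable_behead].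
exists (fun i => uncons @^-1` H i).
  by rewrite -preimage_bigcup -TH.
move=> i; have [mHi Hoo] := mH i; split.
  by rewrite -[X in measurable X]setTI; exact: muncons.
rewrite /lebesgue_step /pushforward -comp_preimage (_ : uncons \o _ = id) //.
by apply/funext => p /=; rewrite consK.
Qed.

HB.instance Definition _ :=
  Measure_isSigmaFinite.Build _ _ _ lebesgue_step step_sigma_finite.

End step.

(* Lebesgue measure on the product Borel sigma-algebra of R^n; see
   [borel_lebesgue_box] for its value on boxes. *)
Fixpoint borel_lebesgue n :
    {sigma_finite_measure set (n.-tuple (measurableTypeR R)) -> \bar R} :=
  match n with
  | 0 => (\d_ ([tuple] : 0.-tuple (measurableTypeR R)))
  | n.+1 => lebesgue_step (borel_lebesgue n)
  end.

(* R^k with the sigma-algebra of Lebesgue-measurable (not only Borel) sets,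
   i.e. the Caratheodory-measurable sets of the outer measure induced by
   [borel_lebesgue k]. *)
Definition lebesgueType (k : nat) :=
  caratheodory_type ((borel_lebesgue k)^*)%mu.
HB.instance Definition _ k := Measurable.on (lebesgueType k).

Definition lebesgue_measureN (k : nat) : set (lebesgueType k) -> \bar R :=
  @completed_measure_extension _ _ _ (borel_lebesgue k).
HB.instance Definition _ k := Measure.on (@lebesgue_measureN k).

(* Analysis is done on row vectors and integration on tuples; this is the
   identification between the two. *)
Definition rV_of_tuple k (t : lebesgueType k) : 'rV[R]_k :=
  \row_i tnth (t : k.-tuple R) i.

Definition lebesgue_measurable k (f : 'rV[R]_k -> R) :=
  measurable_fun [set: lebesgueType k] (f \o @rV_of_tuple k).

Definition summable_fun k (f : 'rV[R]_k -> R) : Prop :=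
  (@lebesgue_measureN k).-integrable [set: lebesgueType k]
    (EFin \o f \o @rV_of_tuple k).

End LebesgueMeasure.

Lemma borel_lebesgue_box (R : realType) n (A : 'I_n -> set (measurableTypeR R)) :
  (forall i, measurable (A i)) ->
  measurable [set t : n.-tuple (measurableTypeR R) | forall i, A i (tnth t i)] /\
  borel_lebesgue R n [set t | forall i, A i (tnth t i)] =
    (\prod_(i < n) @lebesgue_measure R (A i))%E.
Proof.
elim: n A => [|n IH] A mA.
  have -> : [set t : 0.-tuple (measurableTypeR R) | forall i, A i (tnth t i)] = setT.
    by apply/seteqP; split=> // t _ [].
  by split; [exact: measurableT|rewrite big_ord0 /= diracT].
have [mB IHB] := IH (fun i => A (lift ord0 i)) (fun i => mA _).
split.
  rewrite (_ : [set _ | _] = \bigcap_(i in [set: 'I_n.+1])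
      ((fun t : n.+1.-tuple (measurableTypeR R) => tnth t i) @^-1` A i)).
    apply: fin_bigcap_measurable => // i _.
    by rewrite -[X in measurable X]setTI; exact: measurable_tnth.
  by apply/seteqP; split=> t /= tA i; [move=> _|]; exact: tA.
rewrite big_ord_recl -IHB -product_measure1E //=.
rewrite /lebesgue_step /pushforward; congr (_ _).
apply/seteqP; split=> [[x t] /= xtA|[x t] [/= xA tA] i].
  split=> [|i]; first exact: (xtA ord0).
  by have := xtA (lift ord0 i); rewrite tnthS.
by case: (unliftP ord0 i) => [j ->|-> //]; rewrite tnthS; exact: tA.
Qed.

Section SmoothFunctions.
Context (R : realType) (k : nat).
Implicit Types (f g : 'rV[R]_k -> R[i]) (i : 'I_k) (s : seq 'I_k).

(* There is no normed R-module structure on R[i] in the library, so continuity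
   and derivatives of complex-valued functions of a real vector variable are
   taken on the real and imaginary parts. *)
Definition partial i f : 'rV[R]_k -> R[i] := fun x =>
  'D_(delta_mx 0 i) (fun y => complex.Re (f y)) x +i*
  'D_(delta_mx 0 i) (fun y => complex.Im (f y)) x.

Definition ccontinuous f : Prop :=
  continuous (fun y => complex.Re (f y)) /\
  continuous (fun y => complex.Im (f y)).

Definition cderivable f x v : Prop :=
  derivable (fun y => complex.Re (f y)) x v /\
  derivable (fun y => complex.Im (f y)) x v.

Definition partials s f := foldr partial f s.

(* All iterated partial derivatives, in any order, exist and are continuous. *)
Definition smooth f : Prop := forall s,
  ccontinuous (partials s f) /\
  forall i x, cderivable (partials s f) x (delta_mx 0 i).

Definition multi_index := {ffun 'I_k -> nat}.

Definition multi_order (mu : multi_index) : nat := (\sum_i mu i)%N.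

Definition multi_partial (mu : multi_index) f :=
  foldr (fun i g => iter (mu i) (partial i) g) f (enum 'I_k).

Lemma multi_partialE mu : exists s, forall f, multi_partial mu f = partials s f.
Proof.
rewrite /multi_partial; elim: (enum 'I_k) => [|i e [s IH]]; first by exists [::].
exists (nseq (mu i) i ++ s) => f; rewrite /partials foldr_cat /= IH.
by elim: (mu i) => //= n ->.
Qed.

Lemma cderivable_smooth f s x i :
  smooth f -> cderivable (partials s f) x (delta_mx 0 i).
Proof. by move=> /(_ s) []. Qed.

Let Re_lin (a b : R) f g : (fun y => complex.Re (((a +i* b) *: f + g) y)) =
  (a *: (fun y => complex.Re (f y)) - b *: (fun y => complex.Im (f y)))
    + (fun y => complex.Re (g y)).
Proof.
apply/funext => y; rewrite [RHS]/=.
by change (complex.Re ((a +i* b) * f y + g y) =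
  a * complex.Re (f y) - b * complex.Im (f y) + complex.Re (g y));
  case: (f y) (g y) => ? ? [].
Qed.

Let Im_lin (a b : R) f g : (fun y => complex.Im (((a +i* b) *: f + g) y)) =
  (a *: (fun y => complex.Im (f y)) + b *: (fun y => complex.Re (f y)))
    + (fun y => complex.Im (g y)).
Proof.
apply/funext => y; rewrite [RHS]/=.
by change (complex.Im ((a +i* b) * f y + g y) =
  a * complex.Im (f y) + b * complex.Re (f y) + complex.Im (g y));
  case: (f y) (g y) => ? ? [].
Qed.

Lemma partial_lin i (a : R[i]) f g :
  (forall x, cderivable f x (delta_mx 0 i)) ->
  (forall x, cderivable g x (delta_mx 0 i)) ->
  partial i (a *: f + g) = a *: partial i f + partial i g.
Proof.
case: a => a b; move=> df dg; apply/funext => x.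
have [dfr dfi] := df x; have [dgr dgi] := dg x.
set v : 'rV[R]_k := delta_mx 0 i in dfr dfi dgr dgi *.
set fr := fun y => complex.Re (f y) in dfr *.
set fi := fun y => complex.Im (f y) in dfi *.
set gr := fun y => complex.Re (g y) in dgr *.
set gi := fun y => complex.Im (g y) in dgi *.
transitivity ('D_v (a *: fr - b *: fi + gr) x +i*
              'D_v (a *: fi + b *: fr + gi) x).
  by rewrite -Re_lin -Im_lin.
have -> : 'D_v (a *: fr - b *: fi + gr) x =
    a * 'D_v fr x - b * 'D_v fi x + 'D_v gr x.
  have da : derivable (a *: fr) x v by exact: derivableZ.
  have db : derivable (b *: fi) x v by exact: derivableZ.
  by rewrite (deriveD (derivableB da db) dgr) (deriveB da db) (deriveZ _ dfr) (deriveZ _ dfi).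
have -> : 'D_v (a *: fi + b *: fr + gi) x =
    a * 'D_v fi x + b * 'D_v fr x + 'D_v gi x.
  have da : derivable (a *: fi) x v by exact: derivableZ.
  have db : derivable (b *: fr) x v by exact: derivableZ.
  by rewrite (deriveD (derivableD da db) dgi) (deriveD da db) (deriveZ _ dfr) (deriveZ _ dfi).
by [].
Qed.

Lemma cderivable_lin v (a : R[i]) f g x :
  cderivable f x v -> cderivable g x v -> cderivable (a *: f + g) x v.
Proof.
case: a => a b; move=> [dfr dfi] [dgr dgi]; rewrite /cderivable Re_lin Im_lin.
split.
  have da := derivableZ (k:=a) dfr; have db := derivableZ (k:=b) dfi.
  exact (derivableD (derivableB da db) dgr).
have da := derivableZ (k:=a) dfi; have db := derivableZ (k:=b) dfr.
exact (derivableD (derivableD da db) dgi).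
Qed.

Lemma ccontinuous_lin (a : R[i]) f g :
  ccontinuous f -> ccontinuous g -> ccontinuous (a *: f + g).
Proof.
case: a => a b; move=> [cfr cfi] [cgr cgi].
rewrite /ccontinuous Re_lin Im_lin; split=> x.
  have ca := cvgZl_tmp (k:=a) (cfr x); have cb := cvgZl_tmp (k:=b) (cfi x).
  exact (cvgD (cvgB (ca _) (cb _)) (cgr x)).
have ca := cvgZl_tmp (k:=a) (cfi x); have cb := cvgZl_tmp (k:=b) (cfr x).
exact (cvgD (cvgD (ca _) (cb _)) (cgi x)).
Qed.

Lemma partials_lin s (a : R[i]) f g : smooth f -> smooth g ->
  partials s (a *: f + g) = a *: partials s f + partials s g.
Proof.
move=> sf sg; elim: s => //= i s ->; apply: partial_lin => x.
- by have [_ /(_ i x)] := sf s.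
- by have [_ /(_ i x)] := sg s.
Qed.

Lemma multi_partial_lin mu (a : R[i]) f g : smooth f -> smooth g ->
  multi_partial mu (a *: f + g) = a *: multi_partial mu f + multi_partial mu g.
Proof. by move=> sf sg; have [s E] := multi_partialE mu; rewrite !E partials_lin. Qed.

Lemma smooth_lin (a : R[i]) f g : smooth f -> smooth g -> smooth (a *: f + g).
Proof.
move=> sf sg s; rewrite partials_lin //; have [cf df] := sf s.
have [cg dg] := sg s; split; first exact: ccontinuous_lin.
by move=> i x; exact: cderivable_lin.
Qed.

Lemma partials0 s : partials s (0 : 'rV[R]_k -> R[i]) = 0.
Proof.
elim: s => //= i s ->; apply/funext => x; rewrite /partial.
transitivity ('D_(delta_mx 0 i) (cst (0 : R)) x +i*
              'D_(delta_mx 0 i) (cst (0 : R)) x); first by [].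
by rewrite !derive_cst.
Qed.

Lemma smooth0 : smooth (0 : 'rV[R]_k -> R[i]).
Proof.
move=> s; rewrite partials0; split.
  by split; exact: (@cst_continuous _ _ (0 : R)).
by move=> i x; split; exact: (derivable_cst (0 : R)).
Qed.

End SmoothFunctions.

Record seminorm (R : realType) (V : lmodType R[i]) := Seminorm {
  seminorm_fun :> V -> R;
  seminormD : forall x y,
    seminorm_fun (x + y) <= seminorm_fun x + seminorm_fun y;
  seminormZ : forall (a : R[i]) x,
    seminorm_fun (a *: x) = normc a * seminorm_fun x }.

Lemma normc_ge0 (R : realType) (z : R[i]) : 0 <= normc z.
Proof. by case: z => a b; exact: sqrtr_ge0. Qed.

Lemma normc_le (R : realType) (z w : R[i]) : normc z <= normc w + normc (z - w).
Proof. by rewrite -[in leLHS](subrK w z) addrC; exact: le_normcD. Qed.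

Lemma normc_real (R : realType) (r : R) : normc r%:C = `|r|.
Proof. by rewrite /normc /= expr0n /= addr0 sqrtr_sqr. Qed.

Section SeminormTheory.
Context (R : realType) (V : lmodType R[i]) (q : seminorm V).

Lemma seminorm0 : q 0 = 0.
Proof. by rewrite -(scale0r 0) seminormZ normc0 mul0r. Qed.

Lemma seminormN x : q (- x) = q x.
Proof.
by rewrite -scaleN1r seminormZ (_ : normc (-1) = 1) ?mul1r // normcN normc1.
Qed.

Lemma seminormB x y : q (x - y) = q (y - x).
Proof. by rewrite -seminormN opprB. Qed.

Lemma seminorm_ge0 x : 0 <= q x.
Proof.
have := seminormD q x (- x); rewrite subrr seminorm0 seminormN -mulr2n.
by rewrite pmulrn_lge0.
Qed.

End SeminormTheory.

(* [seminormed p] is V with the locally convex topology determined by the family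
   of seminorms p; its uniformity is the translation-invariant one. *)
Definition seminormed (R : realType) (V : lmodType R[i]) (I : Type)
  (p : I -> seminorm V) : Type := V.

Section SeminormedTvs.
Context (R : realType) (V : lmodType R[i]) (I : Type) (p : I -> seminorm V).
Local Notation T := (seminormed p).
Implicit Types (x y : T) (s : seq I) (e : R).

HB.instance Definition _ := GRing.Lmodule.copy T V.

Definition seminorm_ball s e x : set T := [set y | all (fun i => p i (x - y) < e) s].

Definition seminorm_entourage : set_system (T * T) :=
  [set A | exists s, exists2 e, 0 < e &
    forall x y, seminorm_ball s e x y -> A (x, y)].

Let ent_filter : Filter seminorm_entourage.
Proof.
split.
- by exists [::], 1.
- move=> A B [s [e e0 sA]] [t [d d0 tB]].
  exists (s ++ t); exists (Num.min e d); first by rewrite lt_min e0 d0.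
  move=> x y; rewrite /seminorm_ball /= all_cat => /andP[ps pt]; split.
    by apply: sA; apply: sub_all ps => i /lt_le_trans; apply; rewrite ge_min lexx.
  by apply: tB; apply: sub_all pt => i /lt_le_trans; apply; rewrite ge_min lexx orbT.
- by move=> A B AB [s [e e0 sA]]; exists s, e => // x y /sA /AB.
Qed.

Let ball_refl s e x : 0 < e -> seminorm_ball s e x x.
Proof.
by rewrite /seminorm_ball /= => e0; elim: s => //= i s ->; rewrite subrr seminorm0 e0.
Qed.

Let ent_refl A : seminorm_entourage A -> diagonal `<=` A.
Proof.
move=> [s [e e0 sA]] [x y] xy; have -> : x = y := xy.
by apply: sA; exact: ball_refl.
Qed.

Let ent_inv A : seminorm_entourage A -> seminorm_entourage (A^-1)%relation.
Proof.
move=> [s [e e0 sA]]; exists s, e => // x y xy; apply: sA.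
by apply: sub_all xy => i; rewrite seminormB.
Qed.

Let ent_split A : seminorm_entourage A ->
  exists2 B, seminorm_entourage B & (B \; B `<=` A)%relation.
Proof.
move=> [s [e e0 sA]].
exists [set xy | seminorm_ball s (e / 2) xy.1 xy.2].
  by exists s, (e / 2) => //; rewrite divr_gt0.
move=> [x y] [z /= xz zy]; apply: sA; rewrite /seminorm_ball /=.
elim: s xz zy => //= i s IH /andP[xz xzs] /andP[zy zys]; rewrite IH // andbT.
rewrite (splitr e) -(subrK z x) -addrA; apply: le_lt_trans (seminormD _ _ _) _.
exact: ltrD.
Qed.

HB.instance Definition _ := isUniform.Build T ent_filter ent_refl ent_inv ent_split.

Lemma seminorm_nbhsP x (A : set T) : nbhs x A <->
  exists s, exists2 e, 0 < e & seminorm_ball s e x `<=` A.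
Proof.
rewrite -nbhs_entourageE; split.
  move=> [B [s [e e0 sB]] BA]; exists s, e => // y /sB xyB.
  by apply: BA; rewrite /xsection /= inE.
move=> [s [e e0 sA]]; exists [set xy | seminorm_ball s e xy.1 xy.2].
  by exists s, e.
by move=> y; rewrite /xsection /= inE => /sA.
Qed.

Let add_cont : continuous (fun xy : T * T => xy.1 + xy.2).
Proof.
move=> [x y] A /seminorm_nbhsP[s [e e0 sA]].
exists (seminorm_ball s (e / 2) x, seminorm_ball s (e / 2) y).
  by split; apply/seminorm_nbhsP; exists s, (e / 2); rewrite ?divr_gt0.
move=> [x' y'] [/= xx' yy']; apply: sA; rewrite /seminorm_ball /=.
elim: s xx' yy' => //= i s IH /andP[xx xxs] /andP[yy yys].
rewrite IH // andbT (splitr e) opprD addrACA.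
by apply: le_lt_trans (seminormD _ _ _) _; exact: ltrD.
Qed.

Let scale_cont : continuous (fun z : R[i]^o * T => z.1 *: z.2).
Proof.
move=> [a x] A /seminorm_nbhsP[s [e e0 sA]].
pose m : R := 1 + \sum_(i <- s) p i x.
have m0 : 0 < m by rewrite ltr_pwDl // sumr_ge0 // => i _; exact: seminorm_ge0.
pose d := Num.min 1 (e / 2 / m).
have d0 : 0 < d by rewrite lt_min ltr01 !divr_gt0.
pose c := normc a + 1.
have c0 : 0 < c by rewrite ltr_wpDl // normc_ge0.
exists (ball (a : R[i]^o) d%:C, seminorm_ball s (e / 2 / c) x).
  split; first by apply: nbhsx_ballx; rewrite ltcR.
  by apply/seminorm_nbhsP; exists s, (e / 2 / c); rewrite ?divr_gt0.
move=> [b y] [/= ab xy]; apply: sA; rewrite /seminorm_ball /=.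
have {}ab : normc (a - b) < d by rewrite -ltcR.
have bc : normc b <= c.
  apply: le_trans (normc_le b a) _; rewrite lerD2l -normcN opprB.
  by apply: ltW; apply: lt_le_trans ab _; rewrite ge_min lexx.
have xm : all (fun i => p i x < m) s.
  rewrite /m; elim: (s) => //= i t IH; rewrite big_cons; apply/andP; split.
    by rewrite ltr_pwDl // lerDl sumr_ge0 // => j _; exact: seminorm_ge0.
  apply: sub_all IH => j /lt_le_trans; apply.
  by rewrite lerD2l lerDr seminorm_ge0.
have /andP := conj xm xy; rewrite -all_predI; apply: sub_all => i /andP[/= pm pd].
have -> : a *: x - b *: y = (a - b) *: x + b *: (x - y).
  by rewrite scalerBl scalerBr addrA subrK.
rewrite (splitr e); apply: le_lt_trans (seminormD _ _ _) _; rewrite !seminormZ.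
apply: ltr_leD.
  apply: (@le_lt_trans _ _ (d * p i x)).
    by rewrite ler_wpM2r ?seminorm_ge0 // ltW.
  apply: (@le_lt_trans _ _ (e / 2 / m * p i x)).
    by rewrite ler_wpM2r ?seminorm_ge0 // ge_min lexx orbT.
  by rewrite -[ltRHS](divfK (lt0r_neq0 m0)) ltr_pM2l ?divr_gt0.
apply: (@le_trans _ _ (c * (e / 2 / c))).
  by apply: ler_pM; rewrite ?normc_ge0 ?seminorm_ge0 // ltW.
by rewrite mulrC divfK ?lt0r_neq0.
Qed.

Let loc_convex : exists2 B : set_system T,
  (forall b, b \in B -> convex_set b) & basis B.
Proof.
exists [set U | exists s e x, U = seminorm_ball s e x].
  move=> _ /set_mem[s [e [x ->]]] y z a.
  rewrite !inE /seminorm_ball /= => sy sz.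
  have [r /andP[r0 r1] ar] : exists2 r : R, 0 <= r <= 1 & a%:num = r%:C.
    have a0 : 0 <= a%:num by exact: ge0.
    have a1 : a%:num <= 1 by exact: le1.
    move: a0 a1; case: (a%:num) => u v.
    rewrite !lecE /= => /andP[/eqP -> u0] /andP[_ u1].
    by exists u; rewrite ?u0.
  have /andP := conj sy sz; rewrite -all_predI; apply: sub_all => i /andP[/= py pz].
  have -> : x - conv a y z = a%:num *: (x - y) + (1 - a%:num) *: (x - z).
    rewrite !scalerBr addrACA -scalerDl [a%:num + _]addrC subrK scale1r.
    by rewrite -opprD.
  apply: le_lt_trans (seminormD _ _ _) _; rewrite !seminormZ ar.
  have -> : (1 - r%:C : R[i]) = (1 - r)%:C by rewrite rmorphB rmorph1.
  rewrite !normc_real !ger0_norm ?subr_ge0 //.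
  have le1 : r * p i (x - y) + (1 - r) * p i (x - z) <=
      Num.max (p i (x - y)) (p i (x - z)).
    set u := p i _; set v := p i _.
    have -> : Num.max u v = r * Num.max u v + (1 - r) * Num.max u v.
      by rewrite -mulrDl addrC subrK mul1r.
    by apply: lerD; apply: ler_wpM2l; rewrite ?subr_ge0 // le_max lexx ?orbT.
  by apply: le_lt_trans le1 _; rewrite gt_max py pz.
split.
  move=> _ [s [e [x ->]]]; rewrite openE => y xy.
  apply/seminorm_nbhsP.
  have [d d0 sd] : exists2 d, 0 < d & all (fun i => p i (x - y) + d <= e) s.
    elim: (s) xy => [|i t IH] /=; first by exists 1.
    move=> /andP[iy /IH[d d0 td]].
    exists (Num.min d (e - p i (x - y))); first by rewrite lt_min d0 subr_gt0.
    apply/andP; split; first by rewrite -lerBrDl ge_min lexx orbT.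
    by apply: sub_all td => j; apply: le_trans; rewrite lerD2l ge_min lexx.
  exists s, d => // z yz.
  have /andP := conj sd yz; rewrite -all_predI; apply: sub_all => i /andP[/= px pz].
  rewrite -(subrK y x) -addrA; apply: le_lt_trans (seminormD _ _ _) _.
  by apply: lt_le_trans px; rewrite ltrD2l.
move=> x A /seminorm_nbhsP[s [e e0 sA]].
exists (seminorm_ball s e x) => //; split; first by exists s, e, x.
exact: ball_refl.
Qed.

HB.instance Definition _ := PreTopologicalNmodule_isTopologicalNmodule.Build T add_cont.
HB.instance Definition _ := TopologicalNmodule_isTopologicalLmodule.Build R[i] T scale_cont.
HB.instance Definition _ := Uniform_isTvs.Build R[i] T loc_convex.

End SeminormedTvs.


Section DefiningFamily.
Context (R : realType) (k : nat) (Gamma : Type).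
Variable M : Gamma -> 'rV[R]_k -> {nonneg R}.

Record defining_family : Prop := DefiningFamily {
  df_measurable : forall g, lebesgue_measurable (fun x => (M g x)%:num);
  df_bounded : forall g (A : set 'rV[R]_k),
    bounded_set A -> [bounded (M g x)%:num : R | x in A];
  df_directed : forall g1 g2, exists g, exists2 C : R, 0 < C &
    forall x, C * ((M g1 x)%:num + (M g2 x)%:num) <= (M g x)%:num;
  df_countable : exists2 G' : set Gamma, countable G' &
    forall g, exists2 g', G' g' & exists2 C : R, 0 < C &
      forall x, C * (M g x)%:num <= (M g' x)%:num;
  df_positive : forall x : 'rV[R]_k, exists g, exists2 C : R, 0 < C &
    \forall x' \near x, C <= (M g x')%:num }.

(* `|x| is the sup norm, which gives the same meaning to |x| -> oo as the
   Euclidean norm. *)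
Definition condition_I : Prop := forall g, exists g' (L : 'rV[R]_k -> {nonneg R}),
  [/\ summable_fun (fun x => (L x)%:num),
      forall x, (M g x)%:num <= (L x)%:num * (M g' x)%:num &
      forall e : R, 0 < e -> exists r : R, forall x, r < `|x| -> (L x)%:num < e].

Definition condition_II : Prop := forall g, exists g' (B : set 'rV[R]_k),
  nbhs (0 : 'rV[R]_k) B /\ exists2 C : R, 0 < C &
    forall x y, B y -> (M g x)%:num <= C * (M g' (x + y))%:num.

(* [K_norm (g, m)] below, the supremum of [K_values g m f], is the seminorm
   ||f||_{g,m}; membership in [K_pred] asks for finiteness of all of them. *)
Definition K_values (g : Gamma) (m : nat) (f : 'rV[R]_k -> R[i]) : set R :=
  [set r | exists x (mu : multi_index k),
    (multi_order mu <= m)%N /\ r = (M g x)%:num * normc (multi_partial mu f x)].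

Definition K_pred : {pred 'rV[R]_k -> R[i]} := fun f =>
  `[< smooth f /\ forall g m, has_ubound (K_values g m f) >].

Lemma K_predP f : reflect
  (smooth f /\ forall g m, has_ubound (K_values g m f)) (f \in K_pred).
Proof. exact: asboolP. Qed.

Lemma K_pred_submod : GRing.submod_closed K_pred.
Proof.
split.
  apply/K_predP; split; first exact: smooth0.
  move=> g m; exists 0 => _ [x [mu [_ ->]]].
  by have [s ->] := multi_partialE R mu; rewrite partials0 normc0 mulr0.
move=> a f h /K_predP[sf bf] /K_predP[sh bh]; apply/K_predP; split.
  exact: smooth_lin.
move=> g m; have [u uf] := bf g m; have [v vh] := bh g m.
exists (normc a * u + v) => _ [x [mu [mum ->]]].
rewrite multi_partial_lin //.
apply: (@le_trans _ _ ((M g x)%:num *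
    (normc a * normc (multi_partial mu f x) + normc (multi_partial mu h x)))).
  by rewrite ler_wpM2l // -normcM; exact: le_normcD.
rewrite mulrDr mulrCA; apply: lerD.
  by rewrite ler_wpM2l ?normc_ge0 //; apply: uf; exists x, mu.
by apply: vh; exists x, mu.
Qed.

HB.instance Definition _ := GRing.isSubmodClosed.Build R[i] ('rV[R]_k -> R[i])
  K_pred K_pred_submod.

Record K_fun := KFun { K_val :> 'rV[R]_k -> R[i]; _ : K_val \in K_pred }.
HB.instance Definition _ := [isSub for K_val].
HB.instance Definition _ := [Choice of K_fun by <:].
HB.instance Definition _ := [SubChoice_isSubLmodule of K_fun by <:].

Lemma K_smooth (f : K_fun) : smooth f.
Proof. by have /K_predP[] := valP f. Qed.

Lemma K_bounded (f : K_fun) g m : has_ubound (K_values g m f).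
Proof. by have /K_predP[_] := valP f. Qed.

Definition K_norm (gm : Gamma * nat) (f : K_fun) : R :=
  sup (K_values gm.1 gm.2 f).

Lemma K_norm_ub g m (f : K_fun) x mu : (multi_order mu <= m)%N ->
  (M g x)%:num * normc (multi_partial mu f x) <= K_norm (g, m) f.
Proof.
move=> mum; apply: ub_le_sup; first exact: K_bounded.
by exists x, mu.
Qed.

Lemma K_values_neq0 g m f : K_values g m f !=set0.
Proof.
exists ((M g 0)%:num * normc (multi_partial [ffun=> 0%N] f 0)); exists 0, [ffun=> 0%N].
by split=> //; rewrite /multi_order big1 // => i _; rewrite ffunE.
Qed.

Lemma K_norm_le g m (f : K_fun) (u : R) :
  (forall x mu, (multi_order mu <= m)%N ->
    (M g x)%:num * normc (multi_partial mu f x) <= u) ->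
  K_norm (g, m) f <= u.
Proof.
move=> fu; apply: ge_sup; first exact: K_values_neq0.
by move=> _ [x [mu [mum ->]]]; exact: fu.
Qed.

Let K_norm_lin gm a f h : K_norm gm (a *: f + h) <= normc a * K_norm gm f + K_norm gm h.
Proof.
case: gm => g m; apply: K_norm_le => x mu mum.
have -> : multi_partial mu (a *: f + h : K_fun) =
    a *: multi_partial mu f + multi_partial mu h.
  by rewrite -multi_partial_lin //; exact: K_smooth.
apply: (@le_trans _ _ ((M g x)%:num *
    (normc a * normc (multi_partial mu f x) + normc (multi_partial mu h x)))).
  by rewrite ler_wpM2l // -normcM; exact: le_normcD.
rewrite mulrDr mulrCA; apply: lerD; last exact: K_norm_ub.
by rewrite ler_wpM2l ?normc_ge0 //; exact: K_norm_ub.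
Qed.

Let K_normD gm f h : K_norm gm (f + h) <= K_norm gm f + K_norm gm h.
Proof. by have := K_norm_lin gm 1 f h; rewrite scale1r normc1 mul1r. Qed.

Let K_norm0 gm : K_norm gm 0 <= 0.
Proof.
case: gm => g m; apply: K_norm_le => x mu _.
by have [s ->] := multi_partialE R mu; rewrite partials0 normc0 mulr0.
Qed.

Let K_norm_leZ gm a f : K_norm gm (a *: f) <= normc a * K_norm gm f.
Proof.
have := K_norm_lin gm a f 0; rewrite addr0 => /le_trans; apply.
by rewrite gerDl; exact: K_norm0.
Qed.

Let K_normZ gm a f : K_norm gm (a *: f) = normc a * K_norm gm f.
Proof.
apply/eqP; rewrite eq_le K_norm_leZ /=; have [->|a0] := eqVneq a 0.
  rewrite normc0 mul0r scale0r.
  have := K_normD gm 0 0; rewrite addr0; lra.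
have na0 : 0 < normc a.
  by rewrite lt_neqAle normc_ge0 andbT eq_sym; apply: contra_neq a0 => /eq0_normc.
rewrite -ler_pdivlMl // -normcV; apply: le_trans (K_norm_leZ _ _ _).
by rewrite scalerA mulVf // scale1r.
Qed.

Definition K_seminorm (gm : Gamma * nat) : seminorm K_fun :=
  Seminorm (K_normD gm) (K_normZ gm).

Definition K_space : tvsType R[i] := seminormed K_seminorm.

End DefiningFamily.

Section TensorProduct.
Context (K : fieldType) (F G : lmodType K).
Local Notation formal_sum := (seq (F * G)).
Implicit Types (s t : formal_sum) (f : F) (g : G) (a : K).

(* F (x) G is the set of finite formal sums of pairs (f, g), modulo the smallest
   additive congruence making the class of (f, g) bilinear in f and g. *)
Inductive tensor_rel : formal_sum -> formal_sum -> Prop :=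
| tensor_refl s : tensor_rel s s
| tensor_sym s t : tensor_rel s t -> tensor_rel t s
| tensor_trans s t u : tensor_rel s t -> tensor_rel t u -> tensor_rel s u
| tensor_cat s s' t t' :
    tensor_rel s s' -> tensor_rel t t' -> tensor_rel (s ++ t) (s' ++ t')
| tensor_catC s t : tensor_rel (s ++ t) (t ++ s)
| tensor_0l g : tensor_rel [:: (0, g)] [::]
| tensor_Dl f f' g : tensor_rel [:: (f + f', g)] [:: (f, g); (f', g)]
| tensor_Dr f g g' : tensor_rel [:: (f, g + g')] [:: (f, g); (f, g')]
| tensor_Z a f g : tensor_rel [:: (a *: f, g)] [:: (f, a *: g)].

Definition tensor_relb : rel formal_sum := fun s t => `[< tensor_rel s t >].

Let tensor_relb_equiv : equiv_class_of tensor_relb.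
Proof.
split=> [s|s t|t s u].
- by apply/asboolP; exact: tensor_refl.
- by apply/asboolP/asboolP; exact: tensor_sym.
- by move=> /asboolP st /asboolP tu; apply/asboolP; exact: tensor_trans tu.
Qed.

Canonical tensor_equiv := EquivRelPack tensor_relb_equiv.

Definition tensor : Type := {eq_quot tensor_equiv}%qT.
HB.instance Definition _ := Choice.on tensor.
HB.instance Definition _ := EqQuotient.on tensor.

Definition tensor_class s : tensor := (\pi_tensor s)%qT.

Lemma tensor_classP s t : tensor_class s = tensor_class t <-> tensor_rel s t.
Proof.
split=> [/eqquotP/asboolP//|st]; by apply/eqquotP/asboolP.
Qed.

Lemma tensor_classK (x : tensor) : tensor_class (repr x) = x.
Proof. exact: reprK. Qed.

Definition tscale a s : formal_sum := [seq (a *: p.1, p.2) | p <- s].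

Definition tensor_zero : tensor := tensor_class [::].
Definition tensor_add (x y : tensor) := tensor_class (repr x ++ repr y).
Definition tensor_scale a (x : tensor) := tensor_class (tscale a (repr x)).
Definition tensor_opp (x : tensor) := tensor_scale (-1) x.

Lemma tscale_rel a s t : tensor_rel s t -> tensor_rel (tscale a s) (tscale a t).
Proof.
elim=> {s t} [s|s t _|s t u _ st _|s s' t t' _ ss _ tt|s t|g|f f' g|f g g'|b f g].
- exact: tensor_refl.
- exact: tensor_sym.
- exact: tensor_trans.
- by rewrite /tscale !map_cat; exact: tensor_cat.
- by rewrite /tscale !map_cat; exact: tensor_catC.
- by rewrite /= scaler0; exact: tensor_0l.
- by rewrite /= scalerDr; exact: tensor_Dl.
- exact: tensor_Dr.
- by rewrite /= scalerA mulrC -scalerA; exact: tensor_Z.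
Qed.

Lemma repr_class s : tensor_rel (repr (tensor_class s)) s.
Proof. by apply/tensor_classP; exact: tensor_classK. Qed.

Lemma tensor_addE s t :
  tensor_add (tensor_class s) (tensor_class t) = tensor_class (s ++ t).
Proof. by apply/tensor_classP; apply: tensor_cat; exact: repr_class. Qed.

Lemma tensor_scaleE a s :
  tensor_scale a (tensor_class s) = tensor_class (tscale a s).
Proof. by apply/tensor_classP; apply: tscale_rel; exact: repr_class. Qed.

Lemma tensorP (P : tensor -> Prop) :
  (forall s, P (tensor_class s)) -> forall x, P x.
Proof. by move=> Ps x; rewrite -(tensor_classK x). Qed.

Lemma tscale0 s : tensor_rel (tscale 0 s) [::].
Proof.
elim: s => [|[f g] s IH] /=; first exact: tensor_refl.
rewrite scale0r; exact: (tensor_cat (tensor_0l g) IH).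
Qed.

Lemma tscaleD a b s : tensor_rel (tscale (a + b) s) (tscale a s ++ tscale b s).
Proof.
elim: s => [|[f g] s IH] /=; first exact: tensor_refl.
rewrite scalerDl.
apply: tensor_trans (tensor_cat (tensor_Dl _ _ _) IH) _.
rewrite -cat1s -[X in tensor_rel _ X]cat1s -!catA; apply: tensor_cat.
  exact: tensor_refl.
rewrite /= -[X in tensor_rel X _]cat1s catA -[X in tensor_rel _ (_ ++ X)]cat1s catA.
apply: tensor_cat; last exact: tensor_refl.
exact: tensor_catC.
Qed.

Let addA : associative tensor_add.
Proof.
by do 3!elim/tensorP => ?; rewrite !tensor_addE catA.
Qed.

Let addC : commutative tensor_add.
Proof.
do 2!elim/tensorP => ?; rewrite !tensor_addE.
by apply/tensor_classP; exact: tensor_catC.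
Qed.

Let add0 : left_id tensor_zero tensor_add.
Proof. by elim/tensorP => ?; rewrite tensor_addE. Qed.

Let addN : left_inverse tensor_zero tensor_opp tensor_add.
Proof.
elim/tensorP => s; rewrite /tensor_opp tensor_scaleE tensor_addE.
apply/tensor_classP; rewrite -[X in _ ++ X](_ : tscale 1 s = s).
  apply: tensor_trans (tensor_sym (tscaleD _ _ _)) _.
  by rewrite addNr; exact: tscale0.
by rewrite /tscale -[RHS]map_id; apply: eq_map => -[f g]; rewrite scale1r.
Qed.

HB.instance Definition _ := GRing.isZmodule.Build tensor addA addC add0 addN.

Let scaleA a b (x : tensor) :
  tensor_scale a (tensor_scale b x) = tensor_scale (a * b) x.
Proof.
elim/tensorP: x => s; rewrite !tensor_scaleE /tscale -map_comp; congr tensor_class.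
by apply: eq_map => -[f g] /=; rewrite scalerA.
Qed.

Let scale1 : left_id 1 tensor_scale.
Proof.
elim/tensorP => s; rewrite tensor_scaleE; congr tensor_class.
by rewrite /tscale -[RHS]map_id; apply: eq_map => -[f g]; rewrite scale1r.
Qed.

Let scaleDr : right_distributive tensor_scale +%R.
Proof.
move=> a; elim/tensorP => s; elim/tensorP => t.
rewrite -[_ + _]/(tensor_add (tensor_class s) (tensor_class t)).
rewrite -[RHS]/(tensor_add (tensor_scale a (tensor_class s))
  (tensor_scale a (tensor_class t))).
by rewrite [in LHS]tensor_addE !tensor_scaleE tensor_addE /tscale map_cat.
Qed.

Let scaleDl (x : tensor) : {morph tensor_scale^~ x : a b / a + b}.
Proof.
move=> a b /=; elim/tensorP: x => s.
rewrite -[RHS]/(tensor_add (tensor_scale a (tensor_class s))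
  (tensor_scale b (tensor_class s))).
rewrite !tensor_scaleE tensor_addE.
by apply/tensor_classP; exact: tscaleD.
Qed.

HB.instance Definition _ := GRing.Zmodule_isLmodule.Build K tensor
  scaleA scale1 scaleDr scaleDl.

Definition pure_tensor f g : tensor := tensor_class [:: (f, g)].

Lemma tensor_class_sum s :
  tensor_class s = \sum_(p <- s) pure_tensor p.1 p.2.
Proof.
elim: s => [|[f g] s IH]; first by rewrite big_nil.
by rewrite big_cons -IH [RHS]tensor_addE.
Qed.

Lemma pure_tensor_bilinear :
  bilinear_for (GRing.scale : GRing.Scale.law K tensor)
               (GRing.scale : GRing.Scale.law K tensor) pure_tensor.
Proof.
split=> [g a f f'|f a g g'] /=.
  rewrite [LHS](_ : _ = tensor_class ([:: (a *: f, g)] ++ [:: (f', g)])).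
    by rewrite -tensor_addE -[X in tensor_add X _](tensor_scaleE a [:: (f, g)]).
  by apply/tensor_classP; exact: tensor_Dl.
rewrite [LHS](_ : _ = tensor_class ([:: (a *: f, g)] ++ [:: (f, g')])).
  by rewrite -tensor_addE -[X in tensor_add X _](tensor_scaleE a [:: (f, g)]).
apply/tensor_classP; apply: tensor_trans (tensor_Dr _ _ _) _.
apply: (@tensor_cat [:: _] [:: _]); last exact: tensor_refl.
exact/tensor_sym/tensor_Z.
Qed.

HB.instance Definition _ := bilinear_isBilinear.Build K F G tensor _ _
  pure_tensor pure_tensor_bilinear.

Section Lift.
Context (H : lmodType K) (B : {bilinear F -> G -> H}).

Definition formal_lift s : H := \sum_(p <- s) B p.1 p.2.

Lemma formal_lift_rel s t : tensor_rel s t -> formal_lift s = formal_lift t.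
Proof.
rewrite /formal_lift.
elim=> {s t} [//|s t _ ->//|s t u _ -> _ ->//|s s' t t' _ E _ E'|s t|g|f f' g|f g g'|a f g].
- by rewrite !big_cat /= E E'.
- by rewrite !big_cat /= addrC.
- by rewrite big_nil big_seq1 linear0l.
- by rewrite !big_cons !big_nil !addr0 linearDl.
- by rewrite !big_cons !big_nil !addr0 linearDr.
- by rewrite !big_seq1 /= linearZl_LR linearZr_LR.
Qed.

Definition tensor_lift (x : tensor) : H := formal_lift (repr x).

Lemma tensor_lift_class s : tensor_lift (tensor_class s) = formal_lift s.
Proof. exact/formal_lift_rel/repr_class. Qed.

Lemma tensor_lift_linear : linear tensor_lift.
Proof.
move=> a; do 2!elim/tensorP => ?.
rewrite -[LHS]/(tensor_lift (tensor_add (tensor_scale a _) _)).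
rewrite tensor_scaleE tensor_addE !tensor_lift_class /formal_lift big_cat /=.
congr (_ + _); rewrite /tscale big_map scaler_sumr.
by apply: eq_bigr => p _; rewrite linearZl_LR.
Qed.

HB.instance Definition _ :=
  GRing.isLinear.Build K tensor H _ tensor_lift tensor_lift_linear.

Lemma tensor_lift_pure f g : tensor_lift (pure_tensor f g) = B f g.
Proof. by rewrite tensor_lift_class /formal_lift big_seq1. Qed.

End Lift.

End TensorProduct.

Section ProjectiveTensorProduct.
Context (R : realType) (F G : tvsType R[i]).

(* A locally convex topology on F (x) G makes (f, g) |-> f (x) g continuous iff
   each of its continuous seminorms belongs to [projective_seminorm]; hence the
   topology determined by all of these is the strongest such topology, see
   [pure_tensor_continuous] and [projective_tensor_strongest]. *)
Definition projective_seminorm := {q : seminorm (tensor F G) |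
  continuous (fun fg : F * G =>
    pure_tensor fg.1 fg.2 : seminormed (fun _ : unit => q))}.

Definition projective_tensor : tvsType R[i] :=
  seminormed (fun q : projective_seminorm => sval q).

Lemma pure_tensor_continuous :
  continuous (fun fg : F * G => pure_tensor fg.1 fg.2 : projective_tensor).
Proof.
move=> fg A /seminorm_nbhsP[s [e e0 sA]]; apply: filterS sA _.
elim: s => [|q s IH]; first exact: filterS filterT.
have qfg : nbhs fg [set x | sval q (pure_tensor fg.1 fg.2 - pure_tensor x.1 x.2) < e].
  have := svalP q fg [set t | sval q (pure_tensor fg.1 fg.2 - t) < e]; apply.
  apply/seminorm_nbhsP; exists [:: tt], e => // y.
  by rewrite /seminorm_ball /= andbT.
by apply: filterS2 qfg IH => x /= xq xs; rewrite /seminorm_ball /= xq.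
Qed.

Lemma projective_tensor_strongest (I : Type) (p : I -> seminorm (tensor F G)) :
  continuous (fun fg : F * G => pure_tensor fg.1 fg.2 : seminormed p) ->
  continuous (id : projective_tensor -> seminormed p).
Proof.
move=> pc x A /seminorm_nbhsP[s [e e0 sA]].
suff : nbhs (x : projective_tensor) (seminorm_ball (p := p) s e x).
  exact: filterS.
clear A sA; elim: s => [|i s IH]; first by apply/seminorm_nbhsP; exists [::], 1.
have ic : continuous (fun fg : F * G =>
    pure_tensor fg.1 fg.2 : seminormed (fun _ : unit => p i)).
  move=> fg B /seminorm_nbhsP[t [d d0 tB]]; apply: filterS tB _.
  have := pc fg (seminorm_ball (p := fun _ : unit => p i) t d (pure_tensor fg.1 fg.2)).
  apply; apply/seminorm_nbhsP; exists [:: i], d => // y.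
  rewrite /seminorm_ball /= andbT.
  by move=> pd; elim: (t) => //= _ t' ->; rewrite pd.
apply/seminorm_nbhsP; move/seminorm_nbhsP: IH => [t [d d0 td]].
exists (exist _ (p i) ic :: t), (Num.min e d); first by rewrite lt_min e0 d0.
move=> y; rewrite /seminorm_ball /= lt_min => /andP[/andP[-> _] ty] /=.
by apply: td; apply: sub_all ty => q /lt_le_trans; apply; rewrite ge_min lexx orbT.
Qed.

End ProjectiveTensorProduct.

Section Completion.
Context (R : realType).
Implicit Types X E H : tvsType R[i].

(* Cauchy filters are taken for the additive uniformity: the uniform structure
   carried by an abstract [tvsType] is only required to induce its topology, not
   to be translation-invariant, so the library's [cauchy] cannot be used. *)
Definition tvs_cauchy E (Fl : set_system E) : Prop :=
  forall U, nbhs (0 : E) U ->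
    exists2 A, Fl A & forall x y, A x -> A y -> U (x - y).

Definition tvs_complete E : Prop :=
  forall Fl : set_system E, ProperFilter Fl -> tvs_cauchy Fl ->
    exists x : E, Fl --> x.

Record is_completion X E (j : {linear X -> E}) : Prop := IsCompletion {
  completion_hausdorff : hausdorff_space E;
  completion_complete : tvs_complete E;
  completion_injective : injective j;
  completion_embedding : forall (x : X) (A : set X),
    nbhs x A <-> exists2 B, nbhs (j x) B & j @^-1` B `<=` A;
  completion_dense : dense (range j) }.

Definition topological_isomorphism E H (h : {linear E -> H}) : Prop :=
  continuous h /\
  exists h' : H -> E, [/\ cancel h h', cancel h' h & continuous h'].

(* The completion of F (x)_pi G is unique only up to isomorphism; the statement is
   made for every completion (E, j), together with the existence of one. The map h
   below is the (unique) continuous extension of T along j. *)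
Definition induces_topological_isomorphism (F G H : tvsType R[i])
    (Phi : {bilinear F -> G -> H}) : Prop :=
  let P := projective_tensor F G in
  let T : P -> H := tensor_lift Phi in
  [/\ continuous T,
      exists E (j : {linear P -> E}), is_completion j &
      forall E (j : {linear P -> E}), is_completion j ->
        exists h : {linear E -> H},
          (forall u : P, h (j u) = T u) /\ topological_isomorphism h].

End Completion.

Lemma enum_split_ord m n : enum 'I_(m + n) =
  [seq lshift n i | i <- enum 'I_m] ++ [seq rshift m i | i <- enum 'I_n].
Proof.
apply: (inj_map (@ord_inj (m + n))).
rewrite map_cat -(map_comp _ (lshift n)) -(map_comp _ (@rshift m n)).
rewrite [LHS]val_enum_ord iotaD; congr (_ ++ _).
  by rewrite -[LHS]val_enum_ord; apply: eq_map.
by rewrite add0n -[X in iota X]addn0 iotaDl -val_enum_ord -map_comp; apply: eq_map.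
Qed.

Section ProductFunction.
Context (R : realType) (k1 k2 : nat).
Implicit Types (f : 'rV[R]_k1 -> R[i]) (g : 'rV[R]_k2 -> R[i]).

Definition prod_fun f g : 'rV[R]_(k1 + k2) -> R[i] :=
  fun z => f (lsubmx z) * g (rsubmx z).

Lemma derive_transfer (k k' : nat) (h : 'rV[R]_k -> R) (h' : 'rV[R]_k' -> R)
    (x v : 'rV[R]_k) (x' v' : 'rV[R]_k') :
  (forall t : R, h (t *: v + x) = h' (t *: v' + x')) ->
  (derivable h x v <-> derivable h' x' v') /\ 'D_v h x = 'D_v' h' x'.
Proof.
move=> hh'; have h0 : h x = h' x' by have := hh' 0; rewrite !scale0r !add0r.
have E : (fun t : R => t^-1 *: ((h \o shift x) (t *: v) - h x)) =
    (fun t : R => t^-1 *: ((h' \o shift x') (t *: v') - h' x')).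
  by apply/funext => t; rewrite /= hh' h0.
by rewrite /derivable /derive E.
Qed.

Let lsub_l t i (z : 'rV[R]_(k1 + k2)) :
  lsubmx (t *: delta_mx 0 (lshift k2 i) + z) = t *: delta_mx 0 i + lsubmx z.
Proof.
apply/rowP => j; rewrite !mxE eqxx /=.
by rewrite (inj_eq (@lshift_inj _ _)).
Qed.

Let rsub_l t i (z : 'rV[R]_(k1 + k2)) :
  rsubmx (t *: delta_mx 0 (lshift k2 i) + z) = rsubmx z.
Proof. by apply/rowP => j; rewrite !mxE eqxx /= eq_rlshift mulr0 add0r. Qed.

Let lsub_r t i (z : 'rV[R]_(k1 + k2)) :
  lsubmx (t *: delta_mx 0 (rshift k1 i) + z) = lsubmx z.
Proof. by apply/rowP => j; rewrite !mxE eqxx /= eq_lrshift mulr0 add0r. Qed.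

Let rsub_r t i (z : 'rV[R]_(k1 + k2)) :
  rsubmx (t *: delta_mx 0 (rshift k1 i) + z) = t *: delta_mx 0 i + rsubmx z.
Proof.
apply/rowP => j; rewrite !mxE eqxx /=.
by rewrite (inj_eq (@rshift_inj _ _)).
Qed.

Let partial_scale k (f : 'rV[R]_k -> R[i]) (c : R[i]) v x :
  cderivable f x v ->
  cderivable (c *: f) x v.
Proof.
move=> df; have := @cderivable_lin R k v c f 0 x df.
by rewrite addr0; apply; split; exact: (derivable_cst (0 : R)).
Qed.

Let partialZ k (f : 'rV[R]_k -> R[i]) (c : R[i]) i :
  (forall x, cderivable f x (delta_mx 0 i)) ->
  partial i (c *: f) = c *: partial i f.
Proof.
move=> df; rewrite -[c *: f]addr0 partial_lin //; last first.
  by move=> x; split; exact: (derivable_cst (0 : R)).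
by rewrite -[partial i 0]/(partials [:: i] 0) partials0 addr0.
Qed.

Lemma partial_prod_l i f g :
  (forall x, cderivable f x (delta_mx 0 i)) ->
  partial (lshift k2 i) (prod_fun f g) = prod_fun (partial i f) g /\
  forall z, cderivable (prod_fun f g) z (delta_mx 0 (lshift k2 i)).
Proof.
move=> df.
have E z t : prod_fun f g (t *: delta_mx 0 (lshift k2 i) + z) =
    (g (rsubmx z) *: f) (t *: delta_mx 0 i + lsubmx z).
  by rewrite /prod_fun lsub_l rsub_l mulrC.
have Er z := @derive_transfer _ _ (fun y => complex.Re (prod_fun f g y))
  (fun y => complex.Re ((g (rsubmx z) *: f) y)) z (delta_mx 0 (lshift k2 i)) (lsubmx z)
  (delta_mx 0 i) (fun t => congr1 (@complex.Re R) (E z t)).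
have Ei z := @derive_transfer _ _ (fun y => complex.Im (prod_fun f g y))
  (fun y => complex.Im ((g (rsubmx z) *: f) y)) z (delta_mx 0 (lshift k2 i)) (lsubmx z)
  (delta_mx 0 i) (fun t => congr1 (@complex.Im R) (E z t)).
split.
  apply/funext => z.
  transitivity (partial i (g (rsubmx z) *: f) (lsubmx z)).
    by rewrite /partial (Er z).2 (Ei z).2.
  by rewrite partialZ //; exact: mulrC.
move=> z; have [dr di] := partial_scale (g (rsubmx z)) (df (lsubmx z)).
by split; [apply/(Er z).1|apply/(Ei z).1].
Qed.

Lemma partial_prod_r i f g :
  (forall x, cderivable g x (delta_mx 0 i)) ->
  partial (rshift k1 i) (prod_fun f g) = prod_fun f (partial i g) /\
  forall z, cderivable (prod_fun f g) z (delta_mx 0 (rshift k1 i)).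
Proof.
move=> dg.
have E z t : prod_fun f g (t *: delta_mx 0 (rshift k1 i) + z) =
    (f (lsubmx z) *: g) (t *: delta_mx 0 i + rsubmx z).
  by rewrite /prod_fun lsub_r rsub_r.
have Er z := @derive_transfer _ _ (fun y => complex.Re (prod_fun f g y))
  (fun y => complex.Re ((f (lsubmx z) *: g) y)) z (delta_mx 0 (rshift k1 i)) (rsubmx z)
  (delta_mx 0 i) (fun t => congr1 (@complex.Re R) (E z t)).
have Ei z := @derive_transfer _ _ (fun y => complex.Im (prod_fun f g y))
  (fun y => complex.Im ((f (lsubmx z) *: g) y)) z (delta_mx 0 (rshift k1 i)) (rsubmx z)
  (delta_mx 0 i) (fun t => congr1 (@complex.Im R) (E z t)).
split.
  apply/funext => z.
  transitivity (partial i (f (lsubmx z) *: g) (rsubmx z)).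
    by rewrite /partial (Er z).2 (Ei z).2.
  by rewrite partialZ.
move=> z; have [dr di] := partial_scale (f (lsubmx z)) (dg (rsubmx z)).
by split; [apply/(Er z).1|apply/(Ei z).1].
Qed.

Lemma partials_prod s f g : smooth f -> smooth g ->
  exists s1 s2, partials s (prod_fun f g) = prod_fun (partials s1 f) (partials s2 g).
Proof.
move=> sf sg; elim: s => [|i s [s1 [s2 IH]]]; first by exists [::], [::].
rewrite /= IH; case: (split_ordP i) => j ->.
  exists (j :: s1), s2; apply: (partial_prod_l _ _).1 => x.
  by have [_] := sf s1; apply.
exists s1, (j :: s2); apply: (partial_prod_r _ _).1 => x.
by have [_] := sg s2; apply.
Qed.

Lemma ccontinuous_prod f g :
  ccontinuous f -> ccontinuous g -> ccontinuous (prod_fun f g).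
Proof.
move=> [fr fi] [gr gi].
have l (z : 'rV[R]_(k1 + k2)) : lsubmx z' @[z' --> z] --> (lsubmx z : 'rV[R]_k1).
  exact: continuous_lsubmx.
have r (z : 'rV[R]_(k1 + k2)) : rsubmx z' @[z' --> z] --> (rsubmx z : 'rV[R]_k2).
  exact: continuous_rsubmx.
have fr' z := cvg_comp _ _ (l z) (fr (lsubmx z)).
have fi' z := cvg_comp _ _ (l z) (fi (lsubmx z)).
have gr' z := cvg_comp _ _ (r z) (gr (rsubmx z)).
have gi' z := cvg_comp _ _ (r z) (gi (rsubmx z)).
split=> z.
  have -> : (fun y => complex.Re (prod_fun f g y)) =
      (fun y => complex.Re (f (lsubmx y)) * complex.Re (g (rsubmx y))
              - complex.Im (f (lsubmx y)) * complex.Im (g (rsubmx y))).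
    by apply/funext => y; rewrite /prod_fun; case: (f _) (g _) => ? ? [].
  exact: (cvgB (cvgM (fr' z) (gr' z)) (cvgM (fi' z) (gi' z))).
have -> : (fun y => complex.Im (prod_fun f g y)) =
    (fun y => complex.Re (f (lsubmx y)) * complex.Im (g (rsubmx y))
            + complex.Im (f (lsubmx y)) * complex.Re (g (rsubmx y))).
  by apply/funext => y; rewrite /prod_fun; case: (f _) (g _) => ? ? [].
exact: (cvgD (cvgM (fr' z) (gi' z)) (cvgM (fi' z) (gr' z))).
Qed.

Lemma smooth_partials k (f : 'rV[R]_k -> R[i]) s : smooth f -> smooth (partials s f).
Proof. by move=> sf t; rewrite /partials -foldr_cat; exact: sf. Qed.

Lemma smooth_prod f g : smooth f -> smooth g -> smooth (prod_fun f g).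
Proof.
move=> sf sg s; have [s1 [s2 ->]] := partials_prod s sf sg.
have [[cf df] [cg dg]] := (sf s1, sg s2); split; first exact: ccontinuous_prod.
move=> i x; case: (split_ordP i) => j ->.
  by apply: (partial_prod_l _ _).2.
by apply: (partial_prod_r _ _).2.
Qed.

Lemma multi_partial_prod (mu : multi_index (k1 + k2)) f g : smooth f -> smooth g ->
  multi_partial mu (prod_fun f g) =
  prod_fun (multi_partial [ffun i => mu (lshift k2 i)] f)
           (multi_partial [ffun i => mu (rshift k1 i)] g).
Proof.
move=> sf sg; rewrite {1}/multi_partial enum_split_ord foldr_cat.
set mu1 := [ffun i => mu (lshift k2 i)]; set mu2 := [ffun i => mu (rshift k1 i)].
have [s2 E2] := multi_partialE R mu2.
transitivity (foldr (fun i h => iter (mu i) (partial i) h)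
    (prod_fun f (multi_partial mu2 g)) [seq lshift k2 i | i <- enum 'I_k1]).
  congr foldr; rewrite /multi_partial.
  suff [s] : exists s, foldr (fun i h => iter (mu i) (partial i) h) (prod_fun f g)
        [seq rshift k1 i | i <- enum 'I_k2] =
      prod_fun f (partials s g) /\
      foldr (fun i h => iter (mu2 i) (partial i) h) g (enum 'I_k2) = partials s g.
    by move=> [-> ->].
  elim: (enum 'I_k2) => [|i e [s [IH IH']]]; first by exists [::].
  rewrite /= IH IH' ffunE; elim: (mu _) => [|n [t [Et Et']]] /=; first by exists s.
  rewrite Et Et'.
  exists (i :: t); split=> //; apply: (partial_prod_r _ _).1 => x.
  by have [_] := sg t; apply.
set h := multi_partial mu2 g.
suff [s] : exists s, foldr (fun i h => iter (mu i) (partial i) h) (prod_fun f h)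
      [seq lshift k2 i | i <- enum 'I_k1] = prod_fun (partials s f) h /\
    foldr (fun i h => iter (mu1 i) (partial i) h) f (enum 'I_k1) = partials s f.
  by move=> [-> E]; rewrite [multi_partial mu1 f]E.
elim: (enum 'I_k1) => [|i e [s [IH IH']]]; first by exists [::].
rewrite /= IH IH' ffunE; elim: (mu _) => [|n [t [Et Et']]] /=; first by exists s.
  rewrite Et Et'.
exists (i :: t); split=> //; apply: (partial_prod_l _ _).1 => x.
by have [_] := sf t; apply.
Qed.

End ProductFunction.

Section KernelMap.
Context (R : realType) (k1 k2 : nat) (Gamma Omega : Type).
Variables (M : Gamma -> 'rV[R]_k1 -> {nonneg R})
          (N : Omega -> 'rV[R]_k2 -> {nonneg R}).

(* R^{k1 + k2} is the space of rows of length k1 + k2, a point (x, y) being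
   [row_mx x y]; [lsubmx] and [rsubmx] recover x and y. *)
Definition tensor_family (go : Gamma * Omega) (z : 'rV[R]_(k1 + k2)) :
  {nonneg R} := ((M go.1 (lsubmx z))%:num * (N go.2 (rsubmx z))%:num)%:nng.

Lemma prod_fun_K (f : K_fun M) (g : K_fun N) :
  prod_fun f g \in K_pred tensor_family.
Proof.
apply/K_predP; split; first by apply: smooth_prod; exact: K_smooth.
move=> [c o] m; exists (K_norm (c, m) f * K_norm (o, m) g).
move=> _ [z [mu [mum ->]]] /=.
rewrite multi_partial_prod; try exact: K_smooth.
set mu1 := [ffun i => _]; set mu2 := [ffun i => _].
have mu12 : (multi_order mu1 + multi_order mu2)%N = multi_order mu.
  rewrite /multi_order big_split_ord /=.
  by congr (_ + _)%N; apply: eq_bigr => i _; rewrite ffunE.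
rewrite /prod_fun normcM mulrACA; apply: ler_pM.
- by rewrite mulr_ge0 // normc_ge0.
- by rewrite mulr_ge0 // normc_ge0.
- by apply: K_norm_ub; apply: leq_trans mum; rewrite -mu12 leq_addr.
- by apply: K_norm_ub; apply: leq_trans mum; rewrite -mu12 leq_addl.
Qed.

Definition K_prod (f : K_space M) (g : K_space N) : K_space tensor_family :=
  KFun (prod_fun_K f g).

Lemma K_prod_bilinear : bilinear_for
  (GRing.scale : GRing.Scale.law R[i] (K_space tensor_family))
  (GRing.scale : GRing.Scale.law R[i] (K_space tensor_family)) K_prod.
Proof.
split=> [g a f f'|f a g g']; apply: val_inj; apply/funext => z.
  rewrite -[LHS]/((a * f (lsubmx z) + f' (lsubmx z)) * g (rsubmx z)).
  rewrite -[RHS]/(a * (f (lsubmx z) * g (rsubmx z)) + f' (lsubmx z) * g (rsubmx z)).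
  by rewrite mulrDl mulrA.
rewrite -[LHS]/(f (lsubmx z) * (a * g (rsubmx z) + g' (rsubmx z))).
rewrite -[RHS]/(a * (f (lsubmx z) * g (rsubmx z)) + f (lsubmx z) * g' (rsubmx z)).
by rewrite mulrDr mulrCA.
Qed.

HB.instance Definition _ := bilinear_isBilinear.Build R[i] (K_space M) (K_space N)
  (K_space tensor_family) _ _ K_prod K_prod_bilinear.

End KernelMap.

Arguments K_prod {R k1 k2 Gamma Omega} M N f g.

(* Main.v *)
(* The map T : K(M) (x)_pi K(N) -> K(M (x) N) is injective by linear algebra.
   Since K(M (x) N) is complete and Hausdorff and completions are unique, it
   remains to see that T is a homeomorphism onto a dense subspace. Both points
   come from one approximation of the identity of K(M): given a seminorm of
   K(M), for every eps there are finitely many multi-indices nu_A, points t_A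
   and functions e_A in K(M) such that
     ||f - \sum_A (d^nu_A f)(t_A) e_A|| <= eps ||f||',
     ||e_A|| <= kap_A M_g'(t_A),   \sum_A kap_A <= C,
   with g', ||.||' and C independent of eps. Applied to the first factors of
   u = \sum_p f_p (x) g_p it turns u into \sum_A e_A (x) G_A up to eps, where
   G_A is a derivative of the slice T u (t_A, .), whence q(u) <= C' ||T u|| for
   every projective seminorm q; applied to the slices h(., y) of h in
   K(M (x) N) it approximates h by elements of the range of T.
   The e_A are products of translates, to the points of a lattice, of a
   one-variable kernel E such that E^(m+1) is an approximate delta function up
   to a fixed smooth function; summation by parts and Riemann sums give the
   approximation property. *)
From HB Require Import structures.
Require Import Defs.
From mathcomp Require Import all_boot all_order all_algebra.
From mathcomp Require Import all_classical all_reals all_analysis.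
From mathcomp Require Import measurable_realfun complex ring lra zify.

Set Implicit Arguments.
Unset Strict Implicit.
Unset Printing Implicit Defensive.

Import Order.TTheory GRing.Theory Num.Theory.
Import numFieldNormedType.Exports.
Import ComplexField.Normc.

Local Open Scope classical_set_scope.
Local Open Scope ring_scope.
Local Open Scope complex_scope.

(** * One-variable kernels *)

(** What shapes the proof is that [C] may not depend on [eps]. For a given u the remainder of its
    decomposition is [eps] times a number that depends on the chosen representation of u. It
    disappears only as [eps] tends to 0, and during this limit the main term has to stay bounded.
    This rules out sampling f against translates of a mollifier: derivatives of order m of a
    mollifier grow like a negative power of its width, and so would the sum of the norms of the e_A.
    The remedy is to load derivatives on f. A smoothed fundamental solution of the operator of order
    m+1 has derivatives up to order m that are bounded uniformly in the width; the price is a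
    stronger seminorm of f, which is harmless. Condition (I) is used twice: the integral of L bounds
    the sum of the kap_A for every lattice, and the decay of L makes f and its approximant
    negligible outside a large cube, so that finitely many e_A suffice. Condition (II) compares the
    weights at a point, at a nearby node and in the lattice cell between them. Integrals of
    functions of x are avoided: they are replaced by increments of explicit primitives, compared
    with lattice sums by the mean value theorem. *)

Section Jets.
Context (R : realType).
Implicit Types (u v : nat -> R -> R) (f g : R -> R).

(* [u q] is the q-th derivative of [u 0]. *)
Definition jet u := forall q x, is_derive x (1 : R) (u q) (u q.+1 x).

Definition smooth1 f := exists2 u, jet u & u 0 = f.

Lemma is_derive1_ext f g (x d e : R) :
  f =1 g -> d = e -> is_derive x (1 : R) f d -> is_derive x (1 : R) g e.
Proof. by move=> /funext -> ->. Qed.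

Lemma is_derive1M f g (x df dg : R) :
  is_derive x (1 : R) f df -> is_derive x (1 : R) g dg ->
  is_derive x (1 : R) (fun y => f y * g y) (f x * dg + df * g x).
Proof.
move=> hf hg; apply: is_derive1_ext (is_deriveM hf hg) => //.
by rewrite /GRing.scale /= [df * _]mulrC.
Qed.

Lemma is_derive1X n f (x df : R) : is_derive x (1 : R) f df ->
  is_derive x (1 : R) (fun y => f y ^+ n) (n%:R * f x ^+ n.-1 * df).
Proof.
move=> hf; apply: is_derive1_ext (is_deriveX n hf) => // y.
by rewrite exprfctE.
Qed.

(** Choosing the derivative inside [S], as an element of the subtype, allows the choice to be
    iterated. Smoothness thus reduces to finding a class of explicit functions that is closed under
    differentiation. *)
Lemma smooth1_class (S : set (R -> R)) :
  (forall f, S f -> exists2 g, S g & forall x, is_derive x (1 : R) f (g x)) ->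
  forall f, S f -> smooth1 f.
Proof.
move=> H f Sf.
pose d (h : {h | S h}) : {h | S h} :=
  let e := cid2 (H _ (svalP h)) in exist _ (s2val e) (s2valP e).
exists (fun q => sval (iter q d (exist _ f Sf))) => // q x /=.
exact: (s2valP' (cid2 (H _ (svalP (iter q d (exist _ f Sf)))))).
Qed.

Lemma smooth1D f g : smooth1 f -> smooth1 g -> smooth1 (fun x => f x + g x).
Proof.
move=> [u ju <-] [v jv <-]; exists (fun q x => u q x + v q x) => // q x.
exact: is_deriveD.
Qed.

Lemma smooth1Z (c : R) f : smooth1 f -> smooth1 (fun x => c * f x).
Proof.
move=> [u ju <-]; exists (fun q x => c * u q x) => // q x.
exact: is_deriveZ.
Qed.

(** Finite sums of products of a derivative of f and a derivative of g form a closed class; binomial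
    coefficients never appear. *)
Lemma smooth1M f g : smooth1 f -> smooth1 g -> smooth1 (fun x => f x * g x).
Proof.
move=> [u ju <-] [v jv <-].
pose S := [set h | exists l : seq (nat * nat),
  h = fun x => \sum_(p <- l) u p.1 x * v p.2 x].
apply: (@smooth1_class S); last first.
  by exists [:: (0, 0)]%N; apply/funext => x; rewrite big_seq1.
move=> _ [l ->].
exists (fun x => \sum_(p <- l) (u p.1 x * v p.2.+1 x + v p.2 x * u p.1.+1 x)).
  exists (flatten [seq [:: (p.1, p.2.+1); (p.1.+1, p.2)] | p <- l]).
  apply/funext => x; rewrite big_flatten big_map; apply: eq_bigr => p _ /=.
  by rewrite big_cons big_seq1 /= [v _ _ * _]mulrC.
move=> x; elim: l => [|p l IH].
  under eq_fun do rewrite big_nil; rewrite big_nil; exact: is_derive_cst.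
under eq_fun do rewrite big_cons; rewrite big_cons.
apply: is_deriveD; have := @is_deriveM _ _ (u p.1) (v p.2) x 1 _ _ (ju _ _) (jv _ _).
by [].
Qed.

Lemma smooth1_affine (a b : R) f : smooth1 f -> smooth1 (fun x => f (a * x + b)).
Proof.
move=> [u ju <-]; exists (fun q x => a ^+ q * u q (a * x + b)); last first.
  by apply/funext => x; rewrite mul1r.
move=> q x.
have dl : is_derive x (1 : R) (fun x => a * x + b) a.
  have : is_derive x (1 : R) (fun x => a * x + b) (a * 1 + 0).
    exact: is_deriveD.
  by rewrite mulr1 addr0.
have dc := @is_derive1_comp _ (u q) _ x _ _ (ju q _) dl.
have : is_derive x (1 : R) (fun x => a ^+ q * u q (a * x + b)) _ :=
  is_deriveZ (a ^+ q) dc.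
move=> H; apply: (is_derive_eq H).
by rewrite /GRing.scale /= exprSr -mulrA; congr (_ * _); exact: mulrC.
Qed.

Lemma smooth1_cst (c : R) : smooth1 (fun=> c).
Proof.
exists (fun q x => if q is 0 then c else 0) => // -[|q] x; exact: is_derive_cst.
Qed.

Lemma jet_shift u : jet u -> jet (fun q => u q.+1).
Proof. by move=> ju q x; exact: ju. Qed.

(** The closed class consists of the quotients p / f^n with p smooth. *)
Lemma smooth1V f : smooth1 f -> (forall x, f x != 0) -> smooth1 (fun x => (f x)^-1).
Proof.
move=> sf f0; have [u ju uf] := sf.
pose S := [set h | exists n (p : R -> R), smooth1 p /\ h = fun x => p x * (f x)^-1 ^+ n].
apply: (@smooth1_class S); last first.
  exists 1%N, (fun=> 1); split; first exact: smooth1_cst.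
  by apply/funext => x; rewrite mul1r.
move=> _ [n [p [[v jv <-] ->]]].
exists (fun x => (v 1 x * f x + - n%:R * (v 0 x * u 1 x)) * (f x)^-1 ^+ n.+1).
  exists n.+1, (fun x => v 1 x * f x + - n%:R * (v 0 x * u 1 x)); split=> //.
  apply: smooth1D.
    by apply: smooth1M => //; exists (fun q => v q.+1) => //; exact: jet_shift.
  apply: smooth1Z; apply: smooth1M; first by exists v.
  by exists (fun q => u q.+1) => //; exact: jet_shift.
move=> x; have df : is_derive x (1 : R) f (u 1 x) by rewrite -uf; exact: ju.
have dV := @is_deriveV _ f x _ _ (f0 x) df.
apply: is_derive1_ext (is_derive1M (jv 0 x) (is_derive1X n dV)) => //.
rewrite /GRing.scale /= -exprVn; move: (f0 x).
move: (f x : R) (u 1 x : R) (v 0 x : R) (v 1 x : R) => F U V V' F0.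
case: n => [|n] /=; first by rewrite !expr0 !expr1; field.
by rewrite !exprS; move: (F^-1 ^+ n) => Z; field.
Qed.

End Jets.

(** * Flat functions and a smooth step *)

Section SmoothStep.
Context (R : realType).
Implicit Types (f g : R -> R).

(** This form has no quotient and includes h = 0; it serves for gluing at 0 and for passing to
    limits under a derivative. *)
Lemma is_derive1P f (x d : R) : is_derive x (1 : R) f d <->
  forall e : R, 0 < e -> exists2 r : R, 0 < r &
    forall h : R, `|h| < r -> `|f (x + h) - f x - d * h| <= e * `|h|.
Proof.
split=> [[df <-] e e0|H].
  move: df => /cvgrPdist_lt/(_ e e0); rewrite -/(derive f x 1).
  rewrite near_withinE => -[r /= r0 H]; exists r => // h hr.
  have [->|h0] := eqVneq h 0; first by rewrite addr0 subrr mulr0 subrr normr0 mulr0.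
  have /= := H h; rewrite sub0r normrN => /(_ hr h0) /ltW.
  rewrite -(ler_pM2r (_ : 0 < `|h|)) ?normr_gt0 // -normrM => K.
  rewrite distrC; move: K.
  congr (`|_| <= _); rewrite [h *: 1]mulr1 [h + x]addrC /GRing.scale /=.
  by rewrite mulrBl mulrAC mulVf // mul1r.
have : h^-1 *: ((f \o shift x) (h *: 1) - f x) @[h --> 0^'] --> d.
  apply/cvgrPdist_lt => e e0; have [r r0 Hr] := H _ (divr_gt0 e0 (ltr0n _ 2)).
  rewrite near_withinE; exists r => //= h /=; rewrite /ball_ /= sub0r normrN => hr h0.
  have := Hr h hr; rewrite [h *: 1]mulr1 [h + x]addrC /GRing.scale /= => K.
  have hp : 0 < `|h| by rewrite normr_gt0.
  rewrite -(ltr_pM2r hp) -normrM mulrBl mulrAC mulVf // mul1r -normrN opprB.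
  apply: le_lt_trans K _; rewrite ltr_pM2r //; lra.
move=> c; split; first by apply/cvg_ex; exists d.
exact: cvg_lim c.
Qed.

(** Raise z <= exp z to the N-th power at z = y / N. *)
Lemma expR_bound (N : nat) (y : R) : 0 <= y -> y ^+ N * expR (- y) <= N%:R ^+ N.
Proof.
move=> y0; case: N => [|N]; first by rewrite !expr0 mul1r expR_le1 oppr_le0.
rewrite expRN ler_pdivrMr ?expR_gt0 //.
have -> : y = N.+1%:R * (y / N.+1%:R) by rewrite mulrCA divff ?mulr1 // pnatr_eq0.
rewrite exprMn ler_pM2l ?exprn_gt0 ?ltr0n // expRM_natl lerXn2r // ?nnegrE.
- by rewrite divr_ge0.
- exact: expR_ge0.
by apply: le_trans (expR_ge1Dx _); rewrite lerDr.
Qed.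

Lemma near_eq_is_derive1 f g (x d : R) : (\forall y \near x, f y = g y) ->
  is_derive x (1 : R) f d -> is_derive x (1 : R) g d.
Proof. exact: near_eq_is_derive. Qed.

(** The polynomial is a parameter because differentiation only changes it, from P to X^2 (P - P'),
    so that these functions form a closed class. *)
Definition flat (P : {poly R}) (x : R) : R :=
  if 0 < x then P.[x^-1] * expR (- x^-1) else 0.

(** Using [expR_bound] with exponent i+2 on the term of degree i gains the factor x^2, which is what
    differentiability at 0 requires. *)
Lemma flat_bound P : exists2 C, 0 <= C & forall x, `|flat P x| <= C * x ^+ 2.
Proof.
exists (\sum_(i < size P) `|P`_i| * (i.+2)%:R ^+ i.+2).
  by apply: sumr_ge0 => i _; rewrite mulr_ge0 // exprn_ge0.
move=> x; rewrite /flat; case: ifP => x0; last first.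
  by rewrite normr0 mulr_ge0 ?sqr_ge0 // sumr_ge0 // => i _; rewrite mulr_ge0 // exprn_ge0.
rewrite horner_coef mulr_suml; apply: le_trans (ler_norm_sum _ _ _) _.
rewrite mulr_suml; apply: ler_sum => i _; rewrite !normrM -[leLHS]mulrA -[leRHS]mulrA ler_wpM2l //.
rewrite ger0_norm ?exprn_ge0 ?invr_ge0 ?(ltW x0) // ger0_norm ?expR_ge0 //.
have := @expR_bound i.+2 x^-1; rewrite invr_ge0 (ltW x0) // => /(_ isT).
move: (i.+2%:R ^+ _) => c.
move=> K; have := ler_wpM2r (exprn_ge0 2 (ltW x0)) K; apply: le_trans.
rewrite -addn2 exprD mulrAC -[x^-1 ^+ i * _ * _]mulrA -exprMn mulVf ?gt_eqF //.
by rewrite expr1n mulr1.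
Qed.

Lemma flat_derive P x : is_derive x (1 : R) (flat P) (flat ('X^2 * (P - P^`())) x).
Proof.
have [x0|x0|->] := ltgtP x 0.
- have -> : flat ('X^2 * (P - P^`())) x = 0 by rewrite /flat lt_gtF.
  apply: (@near_eq_is_derive1 (cst 0)).
  by near=> y; rewrite /flat lt_gtF //; near: y; exact: lt_nbhsl.
- rewrite {2}/flat x0.
  apply: (@near_eq_is_derive1 (fun y => P.[y^-1] * expR (- y^-1))).
    by near=> y; rewrite /flat ifT //; near: y; exact: lt_nbhsr.
  have xn : x != 0 by rewrite gt_eqF.
  have dV := @is_deriveV _ id x _ _ xn (is_derive_id x (1 : R)).
  have dP := @is_derive1_comp _ (horner P) _ x _ _ (is_derive_poly P x^-1) dV.
  have dE := @is_derive1_comp _ expR _ x _ _ (is_derive_expR _) (is_deriveN dV).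
  apply: is_derive1_ext (is_derive1M dP dE) => //=.
  rewrite !hornerE /GRing.scale /= -exprVn; ring.
- have [C C0 H] := flat_bound P.
  have -> : flat ('X^2 * (P - P^`())) 0 = 0 by rewrite /flat ltxx.
  apply/is_derive1P => e e0; exists (e / (C + 1)); first by rewrite divr_gt0 // ltr_wpDl.
  move=> h hr; rewrite add0r {2}/flat ltxx subr0 mul0r subr0.
  apply: le_trans (H h) _; rewrite -real_normK ?num_real // expr2 mulrA ler_wpM2r //.
  move: hr; rewrite ltr_pdivlMr ?ltr_wpDl // => hr.
  by have := normr_ge0 h; nra.
Unshelve. all: by end_near. Qed.

Lemma smooth1_flat : smooth1 (flat 1).
Proof.
apply: (@smooth1_class _ [set flat P | P in setT]); last by exists 1.
move=> _ [P _ <-]; exists (flat ('X^2 * (P - P^`()))) => //.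
exact: flat_derive.
Qed.

(** The usual quotient f1(x) / (f1(x) + f1(1 - x)) with f1(x) = exp(-1/x) for x > 0; the two terms
    of the denominator never vanish together. *)
Lemma smooth_step : exists s : R -> R, [/\ smooth1 s,
  forall x, x <= 0 -> s x = 0 & forall x, 1 <= x -> s x = 1].
Proof.
pose f1 := flat 1.
have f1p x : 0 < x -> 0 < f1 x by move=> x0; rewrite /f1 /flat x0 hornerE mul1r expR_gt0.
have f1n x : x <= 0 -> f1 x = 0 by move=> x0; rewrite /f1 /flat ltNge x0.
have f1g x : 0 <= f1 x by have [/f1p/ltW//|/f1n ->] := ltP 0 x.
pose g x := f1 x + f1 (- 1 * x + 1).
have g0 x : g x != 0.
  apply/lt0r_neq0; rewrite /g; have [x0|x0] := ltP 0 x.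
    by rewrite ltr_pwDl // f1p.
  by rewrite ltr_wpDl // f1p //; lra.
exists (fun x => f1 x * (g x)^-1); split.
- apply: smooth1M smooth1_flat _; apply: smooth1V => //.
  by apply: smooth1D smooth1_flat _; apply: smooth1_affine smooth1_flat.
- by move=> x /f1n ->; rewrite mul0r.
- move=> x x1; have -> : g x = f1 x by rewrite /g [f1 (_ + _)]f1n ?addr0 //; lra.
  by rewrite divff // gt_eqF // f1p //; lra.
Qed.

End SmoothStep.

(** * Smoothed fundamental solutions of the operator of order m+1 *)

Section Kernels.
Context (R : realType).
Implicit Types (f g : R -> R) (u v K : nat -> R -> R).

(** One-sided increments already determine the derivative. This makes jets that agree on a half line
    agree there to all orders, end point included. *)
Lemma is_derive_left0 f (x d : R) :
  (forall y, y <= x -> f y = 0) -> is_derive x (1 : R) f d -> d = 0.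
Proof.
move=> f0 /is_derive1P H; apply/eqP; rewrite -normr_le0; apply/ler_addgt0Pl => e e0.
rewrite addr0; have [r r0 Hr] := H e e0; have hr : `|- (r / 2)| < r.
  by rewrite normrN ger0_norm ?divr_ge0 ?(ltW r0) //; lra.
have := Hr _ hr.
rewrite !f0 ?lexx //; last by lra.
rewrite subrr sub0r normrN normrM normrN.
by rewrite ler_pM2r // normr_gt0 gt_eqF // divr_gt0.
Qed.

Lemma is_derive_right0 f (x d : R) :
  (forall y, x <= y -> f y = 0) -> is_derive x (1 : R) f d -> d = 0.
Proof.
move=> f0 /is_derive1P H; apply/eqP; rewrite -normr_le0; apply/ler_addgt0Pl => e e0.
rewrite addr0; have [r r0 Hr] := H e e0; have hr : `|r / 2| < r by rewrite ger0_norm ?divr_ge0 ?(ltW r0) //; lra.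
have := Hr _ hr.
rewrite !f0 ?lexx //; last by lra.
rewrite subrr sub0r normrN normrM.
by rewrite ler_pM2r // normr_gt0 gt_eqF // divr_gt0.
Qed.

Lemma jetB u v : jet u -> jet v -> jet (fun q x => u q x - v q x).
Proof. by move=> ju jv q x; exact: is_deriveB. Qed.

Lemma jet_eq_left u v (a : R) : jet u -> jet v ->
  (forall x, x <= a -> u 0 x = v 0 x) -> forall q x, x <= a -> u q x = v q x.
Proof.
move=> ju jv uv q; elim: q => // q IH x xa; apply/eqP; rewrite -subr_eq0; apply/eqP.
apply: (is_derive_left0 _ (jetB ju jv q x)) => y yx.
by rewrite IH ?subrr // (le_trans yx).
Qed.

Lemma jet_eq_right u v (a : R) : jet u -> jet v ->
  (forall x, a <= x -> u 0 x = v 0 x) -> forall q x, a <= x -> u q x = v q x.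
Proof.
move=> ju jv uv q; elim: q => // q IH x xa; apply/eqP; rewrite -subr_eq0; apply/eqP.
apply: (is_derive_right0 _ (jetB ju jv q x)) => y yx.
by rewrite IH ?subrr // (le_trans xa).
Qed.

Lemma jet0 : jet (fun _ (_ : R) => 0).
Proof. by move=> q x; exact: is_derive_cst. Qed.

(** The q-th derivative of x^m / m!, which cut off to x > 0 is the fundamental solution of the
    operator of order m+1. *)
Definition monomial m q (x : R) : R :=
  if (q <= m)%N then x ^+ (m - q) / (m - q)`!%:R else 0.

Lemma monomial_jet m : jet (monomial m).
Proof.
move=> q x; rewrite /monomial; have [qm|qm|->] := ltngtP q m.
- rewrite (_ : (fun x => _) = fun x => ((m - q)`!%:R)^-1 * x ^+ (m - q)); last first.
    by apply/funext => y; rewrite mulrC.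
  apply: is_derive1_ext (is_deriveZ _ (is_derive1X (m - q) (is_derive_id x _))) => //.
  rewrite /GRing.scale /= -subnSK //= mulr1 factS natrM invfM.
  have : (m - q.+1).+1%:R != 0 :> R by rewrite pnatr_eq0.
  move: ((m - q.+1).+1%:R : R) => c c0.
  by rewrite mulrACA mulVf // mul1r mulrC.
- exact: is_derive_cst.
- rewrite subnn (_ : (fun x => _) = cst 1); first exact: is_derive_cst.
  by apply/funext => y; rewrite expr0 divr1.
Qed.

Lemma monomial_le1 m q (x : R) : 0 <= x <= 1 -> `|monomial m q x| <= 1.
Proof.
move=> /andP[x0 x1]; rewrite /monomial; case: ifP => _; last by rewrite normr0.
rewrite normrM normfV !ger0_norm ?exprn_ge0 // ler_pdivrMr ?ltr0n ?fact_gt0 //.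
by rewrite mul1r (le_trans (exprn_ile1 _ x0 x1)) // ler1n fact_gt0.
Qed.

Lemma jet_continuous u q : jet u -> continuous (u q).
Proof.
move=> ju x; apply: differentiable_continuous; apply/derivable1_diffP.
by have [] := ju q x.
Qed.

Lemma jet_bounded u q (a b : R) : jet u ->
  exists2 B : R, 0 <= B & forall x, a <= x <= b -> `|u q x| <= B.
Proof.
move=> ju; have [ab|ba] := leP a b; last first.
  by exists 0 => // x /andP[ax xb]; have := le_trans ax xb; rewrite leNgt ba.
have c : {within `[a, b], continuous (fun x => `|u q x|)}.
  apply: continuous_subspaceT => x; apply: cvg_norm; exact: jet_continuous.
have [c0 c0ab H] := EVT_max ab c.
by exists (`|u q c0|) => // x xab; apply: H; rewrite in_itv.
Qed.

Lemma jets_bounded u n (a b : R) : jet u ->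
  exists2 B : R, 0 <= B & forall q x, (q < n)%N -> a <= x <= b -> `|u q x| <= B.
Proof.
move=> ju; elim: n => [|n [B B0 H]]; first by exists 0.
have [B' B'0 H'] := jet_bounded n a b ju.
exists (B + B'); first exact: addr_ge0.
move=> q x; rewrite ltnS leq_eqVlt => /orP[/eqP ->|qn] xab.
  by rewrite (le_trans (H' _ xab)) // lerDr.
by rewrite (le_trans (H _ _ qn xab)) // lerDl.
Qed.

(** The support lies to the right of 0, so K(x - t) only sees t between x - r and x. *)
Definition supported (r : R) K := forall q x, x <= 0 \/ r <= x -> K q x = 0.

Lemma supported_bounded K n (r : R) : jet K -> supported r K ->
  exists2 B : R, 0 <= B & forall q x, (q < n)%N -> `|K q x| <= B.
Proof.
move=> jK sK; have [B B0 H] := jets_bounded n 0 r jK; exists B => // q x qn.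
have [x0|x0] := leP x 0; first by rewrite sK ?normr0 //; left.
have [xr|xr] := leP r x; first by rewrite sK ?normr0 //; right.
by apply: H => //; rewrite !ltW.
Qed.

(** The derivatives of e^m u(x / e). This scaling fixes x^m / m!, hence all dilates of [Psi] below
    agree where they have reached the monomial. *)
Definition dilate m u (e : R) q x := e ^+ m * e^-1 ^+ q * u q (e^-1 * x).

Lemma dilate_jet m u e : jet u -> jet (dilate m u e).
Proof.
move=> ju q x; rewrite /dilate.
have dl : is_derive x (1 : R) (fun x => e^-1 * x) e^-1.
  by apply: is_derive1_ext (is_deriveZ e^-1 (is_derive_id x (1 : R))) => //; exact: mulr1.
have dc := @is_derive1_comp _ (u q) _ x _ _ (ju q _) dl.
apply: is_derive1_ext (is_deriveZ (e ^+ m * e^-1 ^+ q) dc) => //.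
by rewrite /GRing.scale /= exprSr; ring.
Qed.

Lemma monomial_step m : exists Psi, [/\ jet Psi,
  forall q x, x <= 0 -> Psi q x = 0 &
  forall q x, 1 <= x -> Psi q x = monomial m q x].
Proof.
have [s [ss s0 s1]] := smooth_step R.
have [Psi jP P0] : smooth1 (fun x => s x * monomial m 0 x).
  by apply: smooth1M => //; exists (monomial m) => //; exact: monomial_jet.
exists Psi; split=> //.
  by apply: jet_eq_left jP jet0 _ => x x0; rewrite P0 s0 // mul0r.
by apply: jet_eq_right jP (@monomial_jet m) _ => x x0; rewrite P0 s1 // mul1r.
Qed.

(* [E] is a parametrix of the m+1-st derivative: [E^(m+1)] is the approximate
   delta function [eta] minus the fixed smooth function [chi]. *)
Lemma kernels m (r : R) : 0 < r <= 1 ->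
  exists2 C : R, 0 <= C & exists chi, [/\ jet chi, supported r chi,
    forall p x, (p <= m)%N -> `|chi p x| <= C &
    forall e : R, 0 < e <= r -> exists E : nat -> R -> R, [/\ jet E, supported r E,
      forall p x, (p <= m)%N -> `|E p x| <= C &
      exists (eta : nat -> R -> R) (Theta : R -> R), [/\ jet eta /\ supported e eta,
        forall x, E m.+1 x = eta 0 x - chi 0 x, forall x, `|eta 0 x| <= C / e,
        forall x : R, is_derive x (1 : R) Theta (eta 0 x) &
        forall x : R, (x <= 0 -> Theta x = 0) /\ (e <= x -> Theta x = 1)]]].
Proof.
move=> /andP[r0 r1]; have [Psi [jP P0 P1]] := monomial_step m.
have pw (e : R) q : 0 < e -> (q <= m)%N -> e ^+ m * e^-1 ^+ q = e ^+ (m - q).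
  move=> e0 qm; rewrite -{1}(subnK qm) exprD -mulrA -exprMn.
  by rewrite divff ?gt_eqF // expr1n mulr1.
have D0 (e : R) q (x : R) : 0 < e -> x <= 0 -> dilate m Psi e q x = 0.
  by move=> e0 x0; rewrite /dilate P0 ?mulr0 // mulrC pmulr_lle0 // invr_gt0.
have D1 (e : R) q (x : R) : 0 < e -> e <= x -> dilate m Psi e q x = monomial m q x.
  move=> e0 ex; rewrite /dilate P1; last by rewrite mulrC ler_pdivlMr // mul1r.
  rewrite /monomial; case: ifP => qm; last by rewrite mulr0.
  by rewrite pw // mulrA -exprMn mulrA divff ?gt_eqF // mul1r.
(* Orders up to m+1 are covered: the last one bounds [eta]. *)
have [B B0 HB] := jets_bounded m.+2 0 1 jP.
(* The bound is uniform in e: the scaling factor is e^(m-p), at most 1 since p <= m, and beyond e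
   the function is a monomial bounded by 1 on the unit interval. *)
have bD (e : R) p (x : R) : 0 < e <= 1 -> (p <= m)%N -> x <= 1 -> `|dilate m Psi e p x| <= B + 1.
  move=> /andP[e0 e1] pm x1; have [x0|x0] := leP x 0.
    by rewrite D0 // normr0 addr_ge0.
  have [ex|xe] := leP e x.
    by rewrite D1 // (le_trans (monomial_le1 _ _ _)) ?lerDr // x1 ltW.
  rewrite /dilate pw // normrM.
  apply: (@le_trans _ _ (1 * B)); last by rewrite mul1r lerDl.
  apply: ler_pM => //; first by rewrite ger0_norm ?exprn_ge0 ?exprn_ile1 ?(ltW e0).
  apply: HB; first by rewrite ltnS leqW.
  by rewrite mulrC divr_ge0 ?(ltW e0) ?(ltW x0) //= ler_pdivrMr // mul1r ltW.
have sD (e : R) : 0 < e -> supported e (fun q => dilate m Psi e (m.+1 + q)).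
  move=> e0 q x [x0|ex]; first by rewrite D0.
  by rewrite D1 // /monomial ltnNge leq_addr.
have jD (e : R) : jet (fun q => dilate m Psi e (m.+1 + q)).
  by move=> q x; rewrite addnS; exact: dilate_jet.
have [B' B'0 HB'] := supported_bounded m.+1 (jD r) (sD _ r0).
(* [2 * (B + 1)] bounds the difference of two dilates and [B'] bounds [chi]; the sum also exceeds
   [B], the bound for e times [eta]. *)
exists (2 * (B + 1) + B'); first lra.
exists (fun q => dilate m Psi r (m.+1 + q)); split=> //.
- exact: sD.
- by move=> p x pm; rewrite (le_trans (HB' _ _ _)) // lerDr; lra.
(* Regularizations of the fundamental solution at the scales e and r coincide beyond r, so their
   difference has compact support. Its derivative of order m+1 is a bump of width e minus the bump
   [chi] of width r. *)
move=> e /andP[e0 er]; exists (fun q x => dilate m Psi e q x - dilate m Psi r q x); split.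
- by apply: jetB; exact: dilate_jet.
- move=> q x [x0|rx]; first by rewrite !D0 // subrr.
  by rewrite !D1 ?subrr // (le_trans er).
- move=> p x pm; apply: (@le_trans _ _ (2 * (B + 1))); last by rewrite lerDl.
  have [rx|xr] := leP r x.
    by rewrite !D1 ?(le_trans er) // subrr normr0; lra.
  rewrite mulr2n mulrDl mul1r (le_trans (ler_normB _ _)) // lerD // bD //; lra.
(* The m-th derivative of the dilate goes from 0 to 1: as a primitive of [eta] it records that [eta]
   has integral 1. *)
exists (fun q => dilate m Psi e (m.+1 + q)), (dilate m Psi e m); split.
- by split=> //; exact: sD.
- by move=> x; rewrite addn0.
- move=> x; rewrite addn0; have [x0|x0] := leP x 0.
    by rewrite D0 // normr0 divr_ge0 ?(ltW e0) //; lra.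
  have [ex|xe] := leP e x.
    rewrite D1 // /monomial ltnn normr0 divr_ge0 ?(ltW e0) //; lra.
  rewrite /dilate exprSr mulrA -exprMn divff ?gt_eqF // expr1n mul1r normrM mulrC.
  rewrite [`|e^-1|]ger0_norm ?invr_ge0 ?(ltW e0) // ler_pM2r ?invr_gt0 //.
  apply: (@le_trans _ _ B); last lra.
  apply: HB => //.
  by rewrite mulrC divr_ge0 ?(ltW e0) ?(ltW x0) //= ler_pdivrMr // mul1r ltW.
- by move=> x; rewrite addn0; exact: dilate_jet.
- move=> x; split=> [x0|ex]; first by rewrite D0.
  by rewrite D1 // /monomial leqnn subnn expr0 divr1.
Qed.

End Kernels.

(** * Lattice sums and the approximation formula in one variable *)

Section OneDim.
Context (R : realType).
Implicit Types (f g : R -> R) (u v K : nat -> R -> R).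

Lemma lattice_count (a d x y : R) N : 0 < d -> x <= y ->
  \sum_(j < N) (if x <= a + j%:R * d <= y then d else 0) <= y - x + d.
Proof.
move=> d0 xy.
(* For the induction the bound has to follow the last lattice point: it is the length of the part of
   [x, y + d] to the left of a + N d. *)
suff H : \sum_(j < N) (if x <= a + j%:R * d <= y then d else 0) <=
    Num.max 0 (Num.min (y + d) (a + N%:R * d) - x).
  apply: le_trans H _; rewrite ge_max lerBlDr; apply/andP; split; first lra.
  by rewrite ge_min; apply/orP; left; lra.
elim: N => [|N IH]; first by rewrite big_ord0 le_max lexx.
rewrite big_ord_recr /=; case: ifP => [/andP[xa ay]|_].
  have -> : Num.min (y + d) (a + N.+1%:R * d) = a + N.+1%:R * d.
    by apply: min_r; rewrite -natr1 mulrDl mul1r addrA lerD2r.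
  rewrite le_max; apply/orP; right.
  apply: (@le_trans _ _ (a + N%:R * d - x + d)); last first.
    by rewrite -natr1 mulrDl mul1r; lra.
  rewrite lerD2r; apply: le_trans IH _; rewrite ge_max subr_ge0 xa /=.
  by rewrite lerD2r ge_min lexx orbT.
rewrite addr0; apply: le_trans IH _; rewrite ge_max le_max lexx /= le_max.
apply/orP; right; rewrite lerD2r le_min !ge_min lexx /= orbC.
by rewrite lerD2l ler_pM2r // ler_nat leqnSn.
Qed.

Lemma lattice_sum_le (a d x y C : R) N (F : R -> R) : 0 < d -> x <= y -> 0 <= C ->
  (forall t, `|F t| <= C) -> (forall t, t < x \/ y < t -> F t = 0) ->
  \sum_(j < N) d * `|F (a + j%:R * d)| <= C * (y - x + d).
Proof.
move=> d0 xy C0 FC F0.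
apply: le_trans (ler_wpM2l C0 (lattice_count a N d0 xy)).
rewrite mulr_sumr; apply: ler_sum => j _; case: ifPn => [_|].
  by rewrite mulrC ler_wpM2r // ltW.
rewrite negb_and -!ltNge mulr0 => /orP H; rewrite F0 ?normr0 ?mulr0 //.
Qed.

Lemma MVT_global f (df : R -> R) (a b : R) : a <= b ->
  (forall x, is_derive x (1 : R) f (df x)) ->
  exists2 c, a <= c <= b & f b - f a = df c * (b - a).
Proof.
move=> ab H; have cf : {within `[a, b], continuous f}.
  apply: continuous_subspaceT => y; apply: differentiable_continuous.
  by apply/derivable1_diffP; have [] := H y.
have [c] := MVT_segment ab (fun x _ => H x) cf.
by rewrite in_itv /= => cab E; exists c.
Qed.

(** The integral of G is the increment of its primitive [H]. On each step two uses of the mean value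
    theorem give the error d * (d * B). *)
Lemma riemann_sum (H G G' : R -> R) (a d B : R) N : 0 < d ->
  (forall x, is_derive x (1 : R) H (G x)) ->
  (forall x, is_derive x (1 : R) G (G' x)) ->
  (forall x, `|G' x| <= B) ->
  `|\sum_(j < N) d * G (a + j%:R * d) - (H (a + N%:R * d) - H a)| <= N%:R * d * (d * B).
Proof.
move=> d0 dH dG GB; elim: N => [|N IH].
  by rewrite big_ord0 !mul0r addr0 !subrr normr0.
rewrite big_ord_recr /=; set t := a + N%:R * d.
have -> : a + N.+1%:R * d = t + d by rewrite -natr1 mulrDl mul1r addrA.
have -> : N.+1%:R * d * (d * B) = N%:R * d * (d * B) + d * (d * B).
  by rewrite -natr1 !mulrDl mul1r.
set s := \sum_(_ < _) _ in IH *.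
have -> : s + d * G t - (H (t + d) - H a) =
    (s - (H t - H a)) + (d * G t - (H (t + d) - H t)) by lra.
apply: le_trans (ler_normD _ _) _; apply: lerD => //.
have [c /andP[tc cd]] := MVT_global (ltac:(lra) : t <= t + d) dH.
rewrite [t + d]addrC addrK => ->.
have [c' _ E] := MVT_global tc dG.
have -> : d * G t - G c * d = - (d * (G c - G t)) by lra.
rewrite normrN E normrM (ger0_norm (ltW d0)) ler_wpM2l ?(ltW d0) //.
rewrite normrM mulrC; apply: ler_pM => //.
rewrite ger0_norm ?subr_ge0 //; lra.
Qed.

Lemma jet_reflect K x q t : jet K ->
  is_derive t (1 : R) (fun t => K q (x - t)) (- K q.+1 (x - t)).
Proof.
move=> jK; have dl : is_derive t (1 : R) (fun t => x - t) (-1).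
  apply: is_derive1_ext (is_deriveB (is_derive_cst x t 1) (is_derive_id t (1 : R))) => //.
  by rewrite sub0r.
apply: is_derive1_ext (@is_derive1_comp _ (K q) _ t _ _ (jK q _) dl) => //.
by rewrite mulrN1.
Qed.

Section SumByParts.
Variables (K u : nat -> R -> R) (r x a d B W : R) (N : nat).
Hypotheses (jK : jet K) (sK : supported r K) (ju : jet u).
Hypotheses (d0 : 0 < d) (B0 : 0 <= B) (W0 : 0 <= W).
Hypotheses (ax : a <= x - r) (xb : x <= a + N%:R * d).

Let supp q t : ~~ (x - r < t < x) -> K q (x - t) = 0.
Proof.
rewrite negb_and -!leNgt => /orP[h|h]; apply: sK; [right|left]; lra.
Qed.

Let KuB q p t : `|K q (x - t)| <= B -> (x - r <= t <= x -> `|u p t| <= W) ->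
  `|K q (x - t) * u p t| <= B * W.
Proof.
move=> KB uW; have [h|h] := boolP (x - r < t < x).
  by rewrite normrM ler_pM // uW //; move: h => /andP[h1 h2]; rewrite !ltW.
by rewrite supp // mul0r normr0 mulr_ge0.
Qed.

(** The summand is the derivative in t of K^(i)(x - t) u^(j)(t), which vanishes at both ends of the
    lattice; only the error of the Riemann sum remains. The second derivative of the product has
    four terms, each at most B * W, whence the 4. *)
Lemma sum_by_parts1 i j :
  (forall q t, (q <= i.+2)%N -> `|K q t| <= B) ->
  (forall q t, (q <= j.+2)%N -> x - r <= t <= x -> `|u q t| <= W) ->
  `|\sum_(l < N) d * (K i (x - (a + l%:R * d)) * u j.+1 (a + l%:R * d) -
     K i.+1 (x - (a + l%:R * d)) * u j (a + l%:R * d))| <= N%:R * d * (d * (4 * (B * W))).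
Proof.
move=> KB uW.
have dM i' j' t := is_derive1M (jet_reflect x i' t jK) (ju j' t).
have dH t : is_derive t (1 : R) (fun t => K i (x - t) * u j t)
    (K i (x - t) * u j.+1 t - K i.+1 (x - t) * u j t).
  by apply: is_derive1_ext (dM i j t) => //; rewrite mulNr.
have dG t : is_derive t (1 : R) (fun t => K i (x - t) * u j.+1 t - K i.+1 (x - t) * u j t)
   (K i (x - t) * u j.+2 t - K i.+1 (x - t) * u j.+1 t
     - (K i.+1 (x - t) * u j.+1 t - K i.+2 (x - t) * u j t)).
  apply: is_derive1_ext (is_deriveB (dM i j.+1 t) (dM i.+1 j t)) => //.
  by rewrite !mulNr.
have := riemann_sum (B := 4 * (B * W)) a N d0 dH dG.
have z b : b <= x - r \/ x <= b -> K i (x - b) = 0.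
  by move=> h; apply: supp; rewrite negb_and -!leNgt; apply/orP.
rewrite !z; try by [left|right].
rewrite !mul0r !subr0; apply=> t.
have k i' j' : (i' <= i.+2)%N -> (j' <= j.+2)%N -> `|K i' (x - t) * u j' t| <= B * W.
  by move=> ii jj; apply: KuB => [|xt]; [exact: KB|exact: uW].
have := k i j.+2 (leqW (leqnSn _)) (leqnn _).
have := k i.+1 j.+1 (leqnSn _) (leqnSn _).
have := k i.+2 j (leqnn _) (leqW (leqnSn _)).
rewrite !ler_norml; lra.
Qed.

Lemma sum_by_parts n i j :
  (forall q t, (q <= i + n.+1)%N -> `|K q t| <= B) ->
  (forall q t, (q <= j + n.+1)%N -> x - r <= t <= x -> `|u q t| <= W) ->
  `|\sum_(l < N) d * (K i (x - (a + l%:R * d)) * u (j + n)%N (a + l%:R * d) -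
     K (i + n)%N (x - (a + l%:R * d)) * u j (a + l%:R * d))| <=
  n%:R * (N%:R * d * (d * (4 * (B * W)))).
Proof.
elim: n i => [|n IH] i KB uW.
  by rewrite !addn0 mul0r big1 ?normr0 // => l _; rewrite subrr mulr0.
have := IH i.+1; have := @sum_by_parts1 i (j + n)%N; rewrite !addnS !addSn => H1 H2.
have {}H1 := H1 (fun q t qi => KB q t (leq_trans qi _)) (fun q t qi => uW q t (leq_trans qi _)).
rewrite -natr1 mulrDl mul1r.
under eq_bigr => l _.
  rewrite -(subrK (K i.+1 (x - (a + l%:R * d)) * u (j + n)%N (a + l%:R * d))
    (K i _ * _)) -[_ - _ + _ - _]addrA mulrDr; over.
rewrite big_split /= addrC; apply: le_trans (ler_normD _ _) _; apply: lerD.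
  by apply: H2 => q t qi; [apply: KB|apply: uW]; lia.
by apply: H1; lia.
Qed.

End SumByParts.

(** With [K true] = E and [K false] = chi: m+1-p summations by parts turn E^(p) u^(m+1) into E^(m+1)
    u^(p) = (eta - chi) u^(p), and p of them turn chi^(p) u into chi u^(p). The terms in chi cancel,
    and eta u^(p) sums to nearly u^(p)(x). [C] is fixed before [eps]; the mesh is chosen last. *)
Lemma one_dim m (r : R) : 0 < r <= 1 -> exists2 C : R, 0 <= C &
  forall eps : R, 0 < eps -> exists K : bool -> nat -> R -> R,
  [/\ forall b, jet (K b), forall b, supported r (K b),
      forall b p x, (p <= m)%N -> `|K b p x| <= C &
      forall L : R, 0 < L -> exists2 d0 : R, 0 < d0 &
        forall (d : R) N (a x W : R) u, 0 < d <= d0 -> N%:R * d = L -> jet u -> 0 <= W ->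
        a <= x - r -> x <= a + L ->
        (forall q t, (q <= m.+2)%N -> x - r <= t <= x -> `|u q t| <= W) ->
        forall p, (p <= m)%N ->
        `|\sum_(l < N) d * (K true p (x - (a + l%:R * d)) * u m.+1 (a + l%:R * d) +
            K false p (x - (a + l%:R * d)) * u 0 (a + l%:R * d)) - u p x| <= eps * W].
Proof.
move=> r01; have [C C0 [chi [jc sc cC HE]]] := kernels m r01.
exists C => // eps eps0; have /andP[r0 r1] := r01.
(* On the width e of [eta], u^(p) varies by at most W * e, against a kernel of size C / e. For d <=
   e the resulting error C * W * (e + d) uses half of [eps]. *)
pose e := Num.min r (eps / (4 * (C + 1))).
have e0 : 0 < e by rewrite lt_min r0 divr_gt0 // mulr_gt0 //; lra.
have er : e <= r by rewrite ge_min lexx.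
have eC : 4 * (C * e) <= eps.
  have : e <= eps / (4 * (C + 1)) by rewrite ge_min lexx orbT.
  rewrite ler_pdivlMr; [|lra] => h.
  by lra.
have er0 : 0 < e <= r by rewrite e0 er.
have [E [jE sE EC]] := HE e er0.
move=> [h [Th [[jeta seta] Eeta etaC dT T01]]].
have [B1 B10 HB1] := supported_bounded m.+3 jE sE.
have [B2 B20 HB2] := supported_bounded m.+3 jc sc.
have [B3 B30 HB3] := supported_bounded 2 jeta seta.
pose B := B1 + B2 + B3.
have [B0 B1B B2B B3B] : [/\ 0 <= B, B1 <= B, B2 <= B & B3 <= B].
  by rewrite /B; split; lra.
clearbody B.
exists (fun b => if b then E else chi); split; try by case.
(* The mesh errors: 4 (m+1) from each of the two summations by parts, and 1 from the mass of [eta].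
   They share the other half of [eps]. *)
move=> L L0; pose c := L * ((B + 1) * (8 * m.+1%:R + 1)).
have c0 : 0 < c by rewrite /c !mulr_gt0 // ?ltr_wpDl // mulr_ge0.
exists (Num.min e (eps / (2 * c))); first by rewrite lt_min e0 divr_gt0 // mulr_gt0.
move=> d N a x W u /andP[d0]; rewrite le_min => /andP[de dc] NL ju W0 ax xb uW p pm.
have pm2 : (p.+1 <= m.+2)%N by rewrite ltnS leqW.
set t := fun l : 'I_N => a + l%:R * d.
have xN : x <= a + N%:R * d by rewrite NL.
have S1 := @sum_by_parts E u r x a d B W N jE sE ju d0 B0 W0 ax xN (m.+1 - p) p p.
have S2 := @sum_by_parts chi u r x a d B W N jc sc ju d0 B0 W0 ax xN p 0 0.
have {}S1 : `|\sum_(l < N) d * (E p (x - t l) * u m.+1 (t l) -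
     E m.+1 (x - t l) * u p (t l))| <= m.+1%:R * (L * (d * (4 * (B * W)))).
  rewrite addnS subnKC ?(leqW pm) // NL in S1; apply: le_trans (S1 _ _) _.
  - by move=> q y qp; apply: le_trans B1B; exact: HB1.
  - by move=> q y qp; exact: uW.
  by rewrite ler_wpM2r ?ler_nat ?leq_subr // !mulr_ge0 // ltW.
have {}S2 : `|\sum_(l < N) d * (chi 0 (x - t l) * u p (t l) -
     chi p (x - t l) * u 0 (t l))| <= m.+1%:R * (L * (d * (4 * (B * W)))).
  rewrite !add0n NL in S2; apply: le_trans (S2 _ _) _.
  - by move=> q y qp; apply: le_trans B2B; apply: HB2; exact: leq_trans qp pm2.
  - by move=> q y qp; apply: uW; exact: leq_trans qp pm2.
  by rewrite ler_wpM2r ?ler_nat ?(leqW pm) // !mulr_ge0 // ltW.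
(* The discrete mass of [eta] is close to the increment of the primitive [Th], which is 1. *)
have S3 : `|\sum_(l < N) d * h 0 (x - t l) - 1| <= L * (d * B).
  have dH y : is_derive y (1 : R) (fun y => - Th (x - y)) (h 0 (x - y)).
    have dl : is_derive y (1 : R) (fun y => x - y) (-1).
      apply: is_derive1_ext (is_deriveB (is_derive_cst x y 1) (is_derive_id y (1 : R))) => //.
      by rewrite sub0r.
    apply: is_derive1_ext (is_deriveN (@is_derive1_comp _ Th _ y _ _ (dT _) dl)) => //.
    by rewrite mulrN1 opprK.
  have := riemann_sum (B := B) a N d0 dH (fun y => jet_reflect x 0 y jeta).
  rewrite NL (T01 _).1; last lra.
  rewrite (T01 _).2; last lra.
  rewrite opprK oppr0 add0r; apply=> y.
  by rewrite normrN; apply: le_trans B3B; exact: HB3.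
have S4 : \sum_(l < N) d * `|h 0 (x - t l) * (u p (t l) - u p x)| <= C * W * (e + d).
  have := @lattice_sum_le a d (x - e) x (C * W) N
    (fun y => h 0 (x - y) * (u p y - u p x)) d0.
  rewrite opprB [x + (e - x)]addrC subrK; apply; [lra|exact: mulr_ge0| |].
    move=> y; have [xy|xy] := leP x y.
      by rewrite seta ?mul0r ?normr0 ?mulr_ge0 //; left; lra.
    have [ye|ye] := leP y (x - e).
      by rewrite seta ?mul0r ?normr0 ?mulr_ge0 //; right; lra.
    rewrite normrM; apply: (@le_trans _ _ (C / e * (W * e))); last first.
      by rewrite mulrACA mulVf ?mulr1 // gt_eqF.
    apply: ler_pM => //; have [z /andP[z1 z2] E1] := MVT_global (ltW xy) (ju p).
    rewrite distrC E1 normrM; apply: ler_pM => //.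
      by apply: uW; [exact: leqW|clear -z1 z2 ye er; lra].
    by clear -z1 z2 xy ye; rewrite ger0_norm; lra.
  by move=> y yh; clear S1 S2 S3; rewrite seta ?mul0r //; case: yh => yh; [right|left]; lra.
(* The error splits into two summations by parts, the oscillation of u^(p) over the width of [eta],
   and the defect of its discrete mass. *)
have -> : \sum_(l < N) d * (E p (x - t l) * u m.+1 (t l) + chi p (x - t l) * u 0 (t l))
    - u p x =
  \sum_(l < N) d * (E p (x - t l) * u m.+1 (t l) - E m.+1 (x - t l) * u p (t l)) -
  \sum_(l < N) d * (chi 0 (x - t l) * u p (t l) - chi p (x - t l) * u 0 (t l)) +
  \sum_(l < N) d * (h 0 (x - t l) * (u p (t l) - u p x)) +
  u p x * (\sum_(l < N) d * h 0 (x - t l) - 1).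
  rewrite mulrBr mulr1 addrA; congr (_ - _).
  rewrite mulr_sumr -sumrB -!big_split /=; apply: eq_bigr => l _.
  by rewrite Eeta; ring.
have S5 : `|\sum_(l < N) d * (h 0 (x - t l) * (u p (t l) - u p x))| <= C * W * (e + d).
  apply: le_trans S4; apply: le_trans (ler_norm_sum _ _ _) _.
  by apply: ler_sum => l _; rewrite normrM gtr0_norm.
have S6 : `|u p x * (\sum_(l < N) d * h 0 (x - t l) - 1)| <= W * (L * (d * B)).
  rewrite normrM; apply: ler_pM => //; apply: uW; first exact: leqW (leqW _).
  by clear -r0; lra.
have dc' : 2 * (d * c) <= eps by move: dc; rewrite ler_pdivlMr ?mulr_gt0 //; lra.
have F1 : 4 * (C * W * (e + d)) <= 2 * (eps * W).
  have : C * W * (e + d) <= C * W * (2 * e) by rewrite ler_wpM2l ?mulr_ge0 //; lra.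
  by have := ler_wpM2r W0 eC; lra.
have F2 : 2 * (m.+1%:R * (L * (d * (4 * (B * W)))) * 2 + W * (L * (d * B))) <= eps * W.
  apply: le_trans (ler_wpM2r W0 dc').
  have -> : 2 * (m.+1%:R * (L * (d * (4 * (B * W)))) * 2 + W * (L * (d * B))) =
      2 * (d * (L * (B * (8 * m.+1%:R + 1)))) * W by ring.
  rewrite ler_wpM2r // ler_wpM2l // ler_wpM2l ?(ltW d0) // /c ler_wpM2l ?(ltW L0) //.
  by rewrite ler_wpM2r // ?lerDl // addr_ge0 // mulr_ge0.
move: F1 F2 S1 S2 S5 S6; clear.
move: (\sum_(l < N) _) (\sum_(l < N) _) (\sum_(l < N) _) (u p x * _) => s1 s2 s3 s4.
move: (m.+1%:R * _) (W * (L * (d * B))) (C * W * (e + d)) (eps * W).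
move=> w1 w2 w3 w4; rewrite !ler_norml => F1 F2 /andP[? ?] /andP[? ?] /andP[? ?] /andP[? ?].
by apply/andP; split; lra.
Qed.

End OneDim.

(** * Approximation of the identity *)

Section Schwarz.
Context (R : realType).

Lemma is_derive_line k (F : 'rV[R]_k -> R) (x v : 'rV[R]_k) (s d : R) :
  is_derive (s *: v + x) v F d <-> is_derive s (1 : R) (fun t => F (t *: v + x)) d.
Proof.
have E : (fun h : R => h^-1 *: ((F \o shift (s *: v + x)) (h *: v) - F (s *: v + x))) =
    (fun h : R => h^-1 *: (((fun t => F (t *: v + x)) \o shift s) (h *: (1 : R)) -
       F (s *: v + x))).
  by apply/funext => h /=; rewrite [h *: 1]mulr1 scalerDl addrA.
by split=> -[]; rewrite /derivable /derive ?E => df dd; split; rewrite /derivable /derive ?E.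
Qed.

(** The second difference of g over a square of side h equals h^2 times either mixed derivative at
    some point of the square; let h shrink. *)
Lemma mixed_derivatives (g gs gt gst gts : R -> R -> R) :
  (forall s t, is_derive s (1 : R) (g^~ t) (gs s t)) ->
  (forall s t, is_derive t (1 : R) (g s) (gt s t)) ->
  (forall s t, is_derive t (1 : R) (gs s) (gst s t)) ->
  (forall s t, is_derive s (1 : R) (gt^~ t) (gts s t)) ->
  (forall e : R, 0 < e -> exists2 r : R, 0 < r &
    forall s t, `|s| < r -> `|t| < r -> `|gst s t - gst 0 0| <= e) ->
  (forall e : R, 0 < e -> exists2 r : R, 0 < r &
    forall s t, `|s| < r -> `|t| < r -> `|gts s t - gts 0 0| <= e) ->
  gst 0 0 = gts 0 0.
Proof.
move=> ds dt dst dts c1 c2; apply/eqP; rewrite -subr_eq0 -normr_le0.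
apply/ler_addgt0Pl => e e0; rewrite addr0.
have [r1 r10 H1] := c1 _ (divr_gt0 e0 (ltr0n _ 2)).
have [r2 r20 H2] := c2 _ (divr_gt0 e0 (ltr0n _ 2)).
pose h := Num.min r1 r2 / 2.
have r0 : 0 < Num.min r1 r2 by rewrite lt_min r10 r20.
have h0 : 0 < h by rewrite divr_gt0.
have hr1 : h < r1.
  have m1 : Num.min r1 r2 <= r1 by rewrite ge_min lexx.
  by rewrite /h; lra.
have hr2 : h < r2.
  have m2 : Num.min r1 r2 <= r2 by rewrite ge_min lexx orbT.
  by rewrite /h; lra.
have [c /andP[c0 ch] Ec] := MVT_global (ltW h0) (fun s => is_deriveB (ds s h) (ds s 0)).
have [c' /andP[c'0 c'h] Ec'] := MVT_global (ltW h0) (dst c).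
have [b /andP[b0 bh] Eb] := MVT_global (ltW h0) (fun t => is_deriveB (dt h t) (dt 0 t)).
have [b' /andP[b'0 b'h] Eb'] := MVT_global (ltW h0) (fun s => dts s b).
have E : gst c c' = gts b' b.
  move: Ec Eb; rewrite !fctE /= Ec' Eb' !subr0 => Ec Eb.
  have : gst c c' * h * h = gts b' b * h * h by rewrite -Ec -Eb; ring.
  by do 2 move/(mulIf (lt0r_neq0 h0)).
have := H1 c c'; have := H2 b' b.
rewrite (ger0_norm c0) (ger0_norm c'0) (ger0_norm b0) (ger0_norm b'0) E => K1 K2.
have {}K1 := K1 (le_lt_trans b'h hr2) (le_lt_trans bh hr2).
have {}K2 := K2 (le_lt_trans ch hr1) (le_lt_trans c'h hr1).
by move: K1 K2; rewrite !ler_norml; lra.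
Qed.

Lemma continuous_plane k (F : 'rV[R]_k -> R) (x v w : 'rV[R]_k) (e : R) :
  continuous F -> 0 < e -> exists2 r : R, 0 < r &
    forall s t : R, `|s| < r -> `|t| < r -> `|F (s *: v + (t *: w + x)) - F x| <= e.
Proof.
move=> cF e0; have /cvgrPdist_lt/(_ e e0) := cF x.
move=> /nbhs_ballP[d /= d0 H]; pose c := `|v| + `|w| + 1.
have c0 : 0 < c by rewrite /c; have := normr_ge0 v; have := normr_ge0 w; lra.
exists (d / c); first by rewrite divr_gt0.
move=> s t; rewrite !ltr_pdivlMr // => sd td.
rewrite distrC; apply/ltW/H; rewrite -ball_normE /ball_ /=.
rewrite addrA opprD addrCA subrr addr0 normrN.
apply: le_lt_trans (ler_normD _ _) _; rewrite !normrZ.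
have [st|ts] := leP `|s| `|t|.
  apply: le_lt_trans td; rewrite /c !mulrDr.
  have := ler_wpM2r (normr_ge0 v) st; have := normr_ge0 t; lra.
apply: le_lt_trans sd; rewrite /c !mulrDr.
have := ler_wpM2r (normr_ge0 w) (ltW ts); have := normr_ge0 s; lra.
Qed.

Lemma derive_comm k (F : 'rV[R]_k -> R) (v w : 'rV[R]_k) :
  (forall x, derivable F x v) -> (forall x, derivable F x w) ->
  (forall x, derivable ('D_v F) x w) -> (forall x, derivable ('D_w F) x v) ->
  continuous ('D_w ('D_v F)) -> continuous ('D_v ('D_w F)) ->
  'D_w ('D_v F) = 'D_v ('D_w F).
Proof.
move=> dv dw dvw dwv cvw cwv; apply/funext => x.
have L (G : 'rV[R]_k -> R) (u y : 'rV[R]_k) (s : R) : (forall x, derivable G x u) ->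
    is_derive s (1 : R) (fun t => G (t *: u + y)) ('D_u G (s *: u + y)).
  by move=> dG; apply/is_derive_line; exact: derivableP.
have z : 0 *: v + (0 *: w + x) = x by rewrite !scale0r !add0r.
have c (G : 'rV[R]_k -> R) : continuous G -> forall e : R, 0 < e ->
    exists2 r : R, 0 < r & forall s t : R, `|s| < r -> `|t| < r ->
    `|G (s *: v + (t *: w + x)) - G (0 *: v + (0 *: w + x))| <= e.
  by move=> cG e e0; rewrite z; exact: continuous_plane.
have A1 s t := L F v (t *: w + x) s dv.
have A4 s t := L ('D_w F) v (t *: w + x) s dwv.
have A (G : 'rV[R]_k -> R) : (forall x, derivable G x w) -> forall s t : R,
    is_derive t (1 : R) (fun t => G (s *: v + (t *: w + x))) ('D_w G (s *: v + (t *: w + x))).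
  move=> dG s t; have := L G w (s *: v + x) t dG.
  by apply: is_derive1_ext => [t'|] /=; rewrite addrCA.
rewrite -z.
exact (mixed_derivatives A1 (A F dw) (A ('D_v F) dvw) A4 (c _ cvw) (c _ cwv)).
Qed.

Lemma cderivable_Re k (f : 'rV[R]_k -> R[i]) v :
  (forall x, cderivable f x v) -> forall x, derivable (fun y => complex.Re (f y)) x v.
Proof. by move=> H x; have [] := H x. Qed.

Lemma cderivable_Im k (f : 'rV[R]_k -> R[i]) v :
  (forall x, cderivable f x v) -> forall x, derivable (fun y => complex.Im (f y)) x v.
Proof. by move=> H x; have [] := H x. Qed.

(** [smooth] speaks of derivatives along arbitrary lists of directions, the seminorms of
    multi-indices taken in a fixed order. Commutation is the bridge between the two. *)
Lemma partial_comm k (f : 'rV[R]_k -> R[i]) i j : smooth f ->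
  partial i (partial j f) = partial j (partial i f).
Proof.
move=> sf; have [_ d0] := sf [::].
have [[cri cii] _] := sf [:: j; i]; have [[crj cij] _] := sf [:: i; j].
have [_ di] := sf [:: i]; have [_ dj] := sf [:: j].
apply/funext => x; rewrite /partial.
have E1 := derive_comm (cderivable_Re (d0 i)) (cderivable_Re (d0 j))
  (cderivable_Re (di j)) (cderivable_Re (dj i)) cri crj.
have E2 := derive_comm (cderivable_Im (d0 i)) (cderivable_Im (d0 j))
  (cderivable_Im (di j)) (cderivable_Im (dj i)) cii cij.
exact (f_equal2 (@complex.Complex R) (congr1 (fun G : 'rV[R]_k -> R => G x) (esym E1))
  (congr1 (fun G : 'rV[R]_k -> R => G x) (esym E2))).
Qed.

Lemma partials_rem k (f : 'rV[R]_k -> R[i]) i s : smooth f -> i \in s ->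
  partials s f = partial i (partials (rem i s) f).
Proof.
move=> sf; elim: s => //= j s IH; rewrite inE; have [<-//|ij] := eqVneq i j.
rewrite /= => is_; rewrite (IH is_).
exact: partial_comm (smooth_partials _ sf).
Qed.

Lemma partials_perm k (f : 'rV[R]_k -> R[i]) s t : smooth f -> perm_eq s t ->
  partials s f = partials t f.
Proof.
move=> sf; elim: s t => [|i s IH] t; first by rewrite perm_sym => /perm_nilP ->.
move=> st; have it : i \in t by rewrite -(perm_mem st) mem_head.
rewrite [RHS](partials_rem sf it) /=; congr partial; apply: IH.
by rewrite -(perm_cons i) (perm_trans st) // perm_to_rem.
Qed.

Definition mi_seq k (mu : multi_index k) : seq 'I_k :=
  flatten [seq nseq (mu i) i | i <- enum 'I_k].

Lemma multi_partial_seq k (mu : multi_index k) (f : 'rV[R]_k -> R[i]) :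
  multi_partial mu f = partials (mi_seq mu) f.
Proof.
rewrite /multi_partial /mi_seq; elim: (enum 'I_k) => //= i e ->.
by rewrite /partials foldr_cat; elim: (mu i) => //= n ->.
Qed.

Lemma count_mi_seq k (mu : multi_index k) i : count_mem i (mi_seq mu) = mu i.
Proof.
rewrite /mi_seq count_flatten -map_comp sumnE big_map.
rewrite (eq_bigr (fun j => if j == i then mu i else 0)%N); last first.
  by move=> j _ /=; rewrite count_nseq /=; have [->|_] := eqVneq j i; rewrite ?mul1n ?mul0n.
by rewrite big_enum /= -big_mkcond big_pred1_eq.
Qed.

Lemma size_mi_seq k (mu : multi_index k) : size (mi_seq mu) = multi_order mu.
Proof.
rewrite /mi_seq size_flatten /shape -map_comp sumnE big_map big_enum /=.
by apply: eq_bigr => i _ /=; rewrite size_nseq.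
Qed.

Definition mi_count k (s : seq 'I_k) : multi_index k := [ffun i => count_mem i s].

Lemma multi_order_count k (s : seq 'I_k) : multi_order (mi_count s) = size s.
Proof.
rewrite -size_mi_seq; apply: perm_size; apply/allP => i _ /=.
by rewrite count_mi_seq ffunE.
Qed.

Lemma partials_multi k (f : 'rV[R]_k -> R[i]) s : smooth f ->
  partials s f = multi_partial (mi_count s) f.
Proof.
move=> sf; rewrite multi_partial_seq; apply: partials_perm => //.
by apply/allP => i _ /=; rewrite count_mi_seq ffunE.
Qed.

Definition mi_upd k (mu : multi_index k) i n : multi_index k :=
  [ffun j => if j == i then n else mu j].

Definition pt_upd k (x : 'rV[R]_k) i (t : R) : 'rV[R]_k :=
  \row_j (if j == i then t else x 0 j).

Lemma partial_multi_partial k (f : 'rV[R]_k -> R[i]) mu i : smooth f ->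
  partial i (multi_partial mu f) = multi_partial (mi_upd mu i (mu i).+1) f.
Proof.
move=> sf; rewrite !multi_partial_seq -[partial i _]/(partials (i :: _) f).
apply: partials_perm => //; apply/allP => j _ /=.
by rewrite !count_mi_seq ffunE [i == j]eq_sym; have [->|] := eqVneq j i.
Qed.

End Schwarz.

(** * Restriction to coordinate lines, and products of one-variable jets *)

Section Lines.
Context (R : realType) (k : nat).
Implicit Types (f : 'rV[R]_k -> R[i]) (mu nu : multi_index k) (x : 'rV[R]_k).

Lemma pt_upd_line x i (t : R) : pt_upd x i t = t *: delta_mx 0 i + pt_upd x i 0.
Proof.
by apply/rowP => j; rewrite !mxE eqxx /=; case: eqVneq => _; rewrite ?mulr1 ?addr0 ?mulr0 ?add0r.
Qed.

Lemma pt_upd_id x i : pt_upd x i (x 0 i) = x.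
Proof. by apply/rowP => j; rewrite mxE; case: eqVneq => [->|]. Qed.

Lemma mi_upd_id mu i : mi_upd mu i (mu i) = mu.
Proof. by apply/ffunP => j; rewrite ffunE; case: eqVneq => [->|]. Qed.

Lemma mi_upd_upd mu i n n' : mi_upd (mi_upd mu i n) i n' = mi_upd mu i n'.
Proof. by apply/ffunP => j; rewrite !ffunE; case: eqVneq. Qed.

Lemma smooth_multi_partial f mu : smooth f -> smooth (multi_partial mu f).
Proof. by move=> sf; rewrite multi_partial_seq; exact: smooth_partials. Qed.

(** [part] stands for the real or the imaginary part. Since partials commute, further derivatives in
    direction i can be absorbed into the i-th entry of [mu]. *)
Lemma jet_line (part : R[i] -> R) f mu x i :
  (forall g v y, cderivable g y v ->
     derivable (fun y : 'rV[R]_k => part (g y)) y v) ->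
  (forall g i y, part (partial i g y) =
     'D_(delta_mx 0 i) (fun y : 'rV[R]_k => part (g y)) y) ->
  smooth f -> jet (fun q t => part (multi_partial (mi_upd mu i q) f (pt_upd x i t))).
Proof.
move=> dpart Dpart sf q t.
have E := partial_multi_partial (mi_upd mu i q) i sf.
rewrite ffunE eqxx mi_upd_upd in E.
have dl := dpart _ _ _ ((smooth_multi_partial (mi_upd mu i q) sf [::]).2 i (pt_upd x i t)).
have /is_derive_line H : is_derive (t *: delta_mx 0 i + pt_upd x i 0) (delta_mx 0 i)
    (fun y => part (multi_partial (mi_upd mu i q) f y))
    (part (multi_partial (mi_upd mu i q.+1) f (pt_upd x i t))).
  by rewrite -pt_upd_line -E Dpart; exact: derivableP.
by apply: is_derive1_ext H => // s; rewrite -pt_upd_line.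
Qed.

Lemma jet_line_Re f mu x i : smooth f ->
  jet (fun q t => complex.Re (multi_partial (mi_upd mu i q) f (pt_upd x i t))).
Proof.
move=> sf; apply: (@jet_line (@complex.Re R) f mu x i _ (fun g j y => erefl) sf).
exact (fun g v y h => h.1).
Qed.

Lemma jet_line_Im f mu x i : smooth f ->
  jet (fun q t => complex.Im (multi_partial (mi_upd mu i q) f (pt_upd x i t))).
Proof.
move=> sf; apply: (@jet_line (@complex.Im R) f mu x i _ (fun g j y => erefl) sf).
exact (fun g v y h => h.2).
Qed.

Section ProductOfJets.
Variable H : 'I_k -> nat -> R -> R.
Hypothesis jH : forall i, jet (H i).

Definition prod_jet mu x : R := \prod_i H i (mu i) (x 0 i).

Lemma prod_jet_derive mu x j :
  is_derive x (delta_mx 0 j) (prod_jet mu) (prod_jet (mi_upd mu j (mu j).+1) x).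
Proof.
have P nu : (forall i, i != j -> nu i = mu i) -> forall t,
    prod_jet nu (pt_upd x j t) =
    (\prod_(i < k | i != j) H i (mu i) (x 0 i)) * H j (nu j) t.
  move=> numu t; rewrite /prod_jet (bigD1 j) //= mulrC mxE eqxx; congr (_ * _).
  by apply: eq_bigr => i ij; rewrite mxE (negPf ij) numu.
rewrite -{1}(pt_upd_id x j) pt_upd_line; apply/is_derive_line.
have -> : prod_jet (mi_upd mu j (mu j).+1) x =
    (\prod_(i < k | i != j) H i (mu i) (x 0 i)) * H j (mu j).+1 (x 0 j).
  rewrite -[X in prod_jet _ X = _](pt_upd_id x j) P; first by rewrite ffunE eqxx.
  by move=> i ij; rewrite ffunE (negPf ij).
apply: is_derive1_ext (is_deriveZ _ (jH j (mu j) (x 0 j))) => // t.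
by rewrite -pt_upd_line P.
Qed.

Lemma prod_jet_continuous mu : continuous (prod_jet mu).
Proof.
rewrite /prod_jet; elim: (index_enum _) => [|i s IH] x.
  by under eq_fun do rewrite big_nil; exact: cst_continuous.
under eq_fun do rewrite big_cons.
apply: continuousM; last exact: IH.
apply: continuous_comp; first exact: coord_continuous.
exact: jet_continuous.
Qed.

Lemma partials_prod_jet mu s :
  partials s (fun x => (prod_jet mu x)%:C) =
  fun x => (prod_jet [ffun i => (mu i + count_mem i s)%N] x)%:C.
Proof.
elim: s => [|j s IH] /=.
  suff -> : [ffun i => (mu i + 0)%N] = mu by [].
  by apply/ffunP => i; rewrite ffunE addn0.
rewrite IH; apply/funext => x.
have [_ E] := prod_jet_derive [ffun i => (mu i + count_mem i s)%N] x j.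
rewrite /partial /=.
have -> : 'D_(delta_mx 0 j) (fun=> (0 : R)) x = 0 by exact: derive_cst.
rewrite E (_ : mi_upd _ _ _ = [ffun i => (mu i + ((j == i) + count_mem i s))%N]) //.
apply/ffunP => i; rewrite !ffunE [j == i]eq_sym.
by have [->|_] := eqVneq i j; rewrite ?addnS.
Qed.

Lemma smooth_prod_jet mu : smooth (fun x => (prod_jet mu x)%:C).
Proof.
move=> s; rewrite partials_prod_jet; split=> [|i x]; split => /=.
- exact: prod_jet_continuous.
- exact: cst_continuous.
- by have [] := prod_jet_derive [ffun i => (mu i + count_mem i s)%N] x i.
- exact: derivable_cst.
Qed.

Lemma multi_partial_prod_jet mu :
  multi_partial mu (fun x => (prod_jet [ffun=> 0%N] x)%:C) =
  fun x => (prod_jet mu x)%:C.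
Proof.
rewrite multi_partial_seq partials_prod_jet.
suff -> : [ffun i => ([ffun=> 0%N] i + count_mem i (mi_seq mu))%N] = mu by [].
by apply/ffunP => i; rewrite !ffunE count_mi_seq.
Qed.

End ProductOfJets.

End Lines.

(** * Tensor powers of a one-variable approximation formula *)

Section TensorApproximation.
Context (R : realType) (k : nat) (I : finType).
Variables (nI : I -> nat) (tI : I -> R) (w : R -> nat -> I -> R) (m : nat).
Variables (r C eps lo hi : R).
Hypotheses (C0 : 0 <= C) (eps0 : 0 <= eps).
Hypothesis nIm : forall c, (nI c <= m.+2)%N.
Hypothesis wsupp : forall y p c, w y p c != 0 -> y - r <= tI c <= y.
Hypothesis wsum : forall y p, (p <= m)%N -> \sum_c `|w y p c| <= C.
Hypothesis wapprox : forall u (y W : R), jet u -> 0 <= W -> lo <= y <= hi ->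
  (forall q t, (q <= m.+2)%N -> y - r <= t <= y -> `|u q t| <= W) ->
  forall p, (p <= m)%N -> `|\sum_c w y p c * u (nI c) (tI c) - u p y| <= eps * W.

Variable phi : multi_index k -> 'rV[R]_k -> R.
Hypothesis jphi : forall i nu x, jet (fun q t => phi (mi_upd nu i q) (pt_upd x i t)).

Definition hybrid_mi (nu : multi_index k) (s : seq 'I_k) (A : {ffun 'I_k -> I}) :
  multi_index k := [ffun i => if i \in s then nI (A i) else nu i].

Definition hybrid_pt (x : 'rV[R]_k) (s : seq 'I_k) (A : {ffun 'I_k -> I}) : 'rV[R]_k :=
  \row_i (if i \in s then tI (A i) else x 0 i).

(** A choice of nodes for the coordinates in [s] alone is encoded as a total function frozen to [A0]
    elsewhere, so that every stage of the induction sums over one type. *)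
Definition agree_off (s : seq 'I_k) (A0 A : {ffun 'I_k -> I}) : bool :=
  [forall i, (i \notin s) ==> (A i == A0 i)].

(** 1 + C + ... + C^(n-1): replacing one coordinate costs [eps], and the error already made in the
    others is multiplied by the l1 norm of the weights, at most [C]. *)
Fixpoint geom (n : nat) : R := if n is n'.+1 then 1 + C * geom n' else 0.

Lemma geom_ge0 n : 0 <= geom n.
Proof. by elim: n => //= n IH; rewrite addr_ge0 // mulr_ge0. Qed.

Let HW (nu : multi_index k) (x : 'rV[R]_k) (s : seq 'I_k) (W : R) :=
  forall (nu' : multi_index k) (x' : 'rV[R]_k),
    (forall i, i \notin s -> nu' i = nu i /\ x' 0 i = x 0 i) ->
    (forall i, i \in s -> (nu' i <= m.+2)%N /\ x 0 i - r <= x' 0 i <= x 0 i) ->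
    `|phi nu' x'| <= W.

Lemma agree_off_cons i s (A0 A : {ffun 'I_k -> I}) c : i \notin s ->
  agree_off (i :: s) A0 A && (A i == c) =
  agree_off s [ffun j => if j == i then c else A0 j] A.
Proof.
move=> is_; apply/andP/forallP => [[/forallP H /eqP <-] j|H].
  apply/implyP => js; rewrite ffunE; have [->//|ji] := eqVneq j i.
  by have /implyP := H j; rewrite inE negb_or ji js => /(_ isT).
split; last by have /implyP/(_ is_) := H i; rewrite ffunE eqxx.
apply/forallP => j; apply/implyP; rewrite inE negb_or => /andP[ji js].
by have /implyP/(_ js) := H j; rewrite ffunE (negPf ji).
Qed.

(** The formula is applied in the variable i with the others frozen, then the induction hypothesis
    at each of its nodes. *)
Lemma tensor_approx_seq (s : seq 'I_k) : uniq s ->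
  forall (nu : multi_index k) (x : 'rV[R]_k) A0 (W : R), 0 <= W ->
  (forall i, i \in s -> (nu i <= m)%N) -> (forall i, i \in s -> lo <= x 0 i <= hi) ->
  HW nu x s W ->
  `|\sum_(A | agree_off s A0 A)
      (\prod_(i <- s) w (x 0 i) (nu i) (A i)) * phi (hybrid_mi nu s A) (hybrid_pt x s A)
    - phi nu x| <= eps * geom (size s) * W.
Proof.
elim: s => [_|i s IH /= /andP[is_ us]] nu x A0 W W0 num xlh HWs.
  rewrite /= mulr0 mul0r (big_pred1 A0) => [|A]; last first.
    apply/forallP/eqP => [H|-> j]; last by rewrite eqxx implybT.
    by apply/ffunP => j; have /implyP/(_ isT)/eqP := H j.
  rewrite big_nil mul1r (_ : hybrid_mi _ _ _ = nu).
    rewrite (_ : hybrid_pt _ _ _ = x) ?subrr ?normr0 //.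
    by apply/rowP => j; rewrite mxE.
  by apply/ffunP => j; rewrite ffunE.
have si : i \in i :: s by rewrite mem_head.
have ssi j : j \in s -> j \in i :: s by move=> js; rewrite inE js orbT.
have ne j : j \in s -> j != i by apply: contraTneq => ->.
pose nu' c := mi_upd nu i (nI c); pose x' c := pt_upd x i (tI c).
pose A0' c : {ffun 'I_k -> I} := [ffun j => if j == i then c else A0 j].
pose S c := \sum_(A | agree_off s (A0' c) A)
  (\prod_(j <- s) w (x' c 0 j) (nu' c j) (A j)) *
  phi (hybrid_mi (nu' c) s A) (hybrid_pt (x' c) s A).
have -> : \sum_(A | agree_off (i :: s) A0 A)
      (\prod_(j <- i :: s) w (x 0 j) (nu j) (A j)) *
      phi (hybrid_mi nu (i :: s) A) (hybrid_pt x (i :: s) A) =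
    \sum_c w (x 0 i) (nu i) c * S c.
  rewrite (partition_big (fun A : {ffun 'I_k -> I} => A i) predT) //=.
  apply: eq_bigr => c _; rewrite mulr_sumr; under eq_bigl do rewrite agree_off_cons //.
  apply: eq_bigr => A HA; rewrite big_cons -[in LHS]mulrA.
  have Ai : A i = c.
    by move/forallP/(_ i)/implyP/(_ is_)/eqP : HA => ->; rewrite ffunE eqxx.
  rewrite Ai; congr (_ * (_ * _)).
    apply: eq_big_seq => j js; have ji := ne _ js.
    by rewrite /x' /nu' mxE ffunE (negPf ji).
  congr phi.
    apply/ffunP => j; rewrite !ffunE inE; have [->|ji] := eqVneq j i => //=.
    by rewrite (negPf is_) Ai.
  apply/rowP => j; rewrite !mxE inE; have [->|ji] := eqVneq j i => //=.
  by rewrite (negPf is_) Ai.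
pose u q t := phi (mi_upd nu i q) (pt_upd x i t).
have uW q t : (q <= m.+2)%N -> x 0 i - r <= t <= x 0 i -> `|u q t| <= W.
  move=> qm xt; apply: HWs => j.
    by rewrite inE negb_or => /andP[ji js]; rewrite ffunE mxE (negPf ji).
  move=> js; rewrite ffunE mxE; have [->//|ji] := eqVneq j i.
  split; first by rewrite (leq_trans (num j js)) // leqW.
  by apply/andP; split; lra.
have := wapprox (jphi i nu x) W0 (xlh _ si) uW (num _ si).
rewrite mi_upd_id pt_upd_id => K.
have -> : \sum_c w (x 0 i) (nu i) c * S c - phi nu x =
    \sum_c w (x 0 i) (nu i) c * (S c - phi (nu' c) (x' c)) +
    (\sum_c w (x 0 i) (nu i) c * phi (nu' c) (x' c) - phi nu x).
  rewrite addrA -big_split /=; congr (_ - _); apply: eq_bigr => c _.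
  by rewrite -mulrDr subrK.
apply: le_trans (ler_normD _ _) _; rewrite /= mulrDr mulr1 mulrDl addrC.
apply: lerD => //.
apply: (@le_trans _ _ (\sum_c `|w (x 0 i) (nu i) c| * (eps * geom (size s) * W))); last first.
  rewrite -mulr_suml; apply: le_trans (ler_wpM2r _ (wsum _ (num _ si))) _.
    by rewrite !mulr_ge0 ?geom_ge0.
  by rewrite le_eqVlt; apply/orP; left; apply/eqP; ring.
apply: le_trans (ler_norm_sum _ _ _) _; apply: ler_sum => c _.
(* The bound [W] is only known near x; a nonzero weight forces the node to lie there. *)
rewrite normrM; have [->|wc] := eqVneq (w (x 0 i) (nu i) c) 0.
  by rewrite normr0 !mul0r.
rewrite ler_wpM2l //; apply: IH => //.
- by move=> j js; rewrite ffunE (negPf (ne _ js)); exact/num/ssi.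
- by move=> j js; rewrite mxE (negPf (ne _ js)); exact/xlh/ssi.
- move=> nu1 x1 off on; apply: HWs => j.
    rewrite inE negb_or => /andP[ji /off[-> ->]].
    by rewrite ffunE mxE (negPf ji).
  rewrite inE => /orP[/eqP ->|js].
    have [-> ->] := off _ is_; rewrite ffunE mxE eqxx; split; first exact: nIm.
    exact: wsupp wc.
  by have := on _ js; rewrite mxE (negPf (ne _ js)).
Qed.

Lemma tensor_approx (c0 : I) (nu : multi_index k) (x : 'rV[R]_k) (W : R) : 0 <= W ->
  (forall i, (nu i <= m)%N) -> (forall i, lo <= x 0 i <= hi) ->
  (forall (nu' : multi_index k) (x' : 'rV[R]_k), (forall i, (nu' i <= m.+2)%N) ->
    (forall i, x 0 i - r <= x' 0 i <= x 0 i) -> `|phi nu' x'| <= W) ->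
  `|\sum_(A : {ffun 'I_k -> I})
      (\prod_i w (x 0 i) (nu i) (A i)) *
      phi [ffun i => nI (A i)] (\row_i tI (A i))
    - phi nu x| <= eps * geom k * W.
Proof.
move=> W0 num xlh HWx; have ins (i : 'I_k) : i \in enum 'I_k by rewrite mem_enum.
have := @tensor_approx_seq (enum 'I_k) (enum_uniq _) nu x [ffun=> c0] W W0
  (fun i _ => num i) (fun i _ => xlh i).
have hw : HW nu x (enum 'I_k) W.
  by move=> nu' x' _ H; apply: HWx => i; have [] := H i (ins i).
move=> /(_ hw); rewrite size_enum_ord; congr (`|_ - _| <= _).
apply: eq_big => [A|A _].
  by apply/forallP => i; rewrite ins.
rewrite big_enum; congr (_ * phi _ _).
  by apply/ffunP => i; rewrite !ffunE ins.
by apply/rowP => i; rewrite !mxE ins.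
Qed.

End TensorApproximation.

(** * Lattice approximation on a cube *)

Section LocalApproximation.
Context (R : realType) (k : nat).
Implicit Types (f : 'rV[R]_k -> R[i]) (mu nu : multi_index k) (x : 'rV[R]_k).

(* In each coordinate the boolean chooses between the two kernels [K true],
   paired with the (m+1)-st derivative, and [K false], paired with the value. *)
Definition grid N := {ffun 'I_k -> 'I_N * bool}.

Definition grid_pt N (a d : R) (A : grid N) : 'rV[R]_k := \row_i (a + (A i).1%:R * d).

Definition grid_mi m N (A : grid N) : multi_index k :=
  [ffun i => if (A i).2 then m.+1 else 0%N].

Lemma normc_Re (z : R[i]) : `|complex.Re z| <= normc z.
Proof.
case: z => x y /=; rewrite -[leLHS]ger0_norm // -sqrtr_sqr ler_wsqrtr //.
by rewrite real_normK ?num_real // lerDl sqr_ge0.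
Qed.

Lemma normc_Im (z : R[i]) : `|complex.Im z| <= normc z.
Proof.
case: z => x y /=; rewrite -[leLHS]ger0_norm // -sqrtr_sqr ler_wsqrtr //.
by rewrite real_normK ?num_real // lerDr sqr_ge0.
Qed.

Lemma normc_ReIm (z : R[i]) : normc z <= `|complex.Re z| + `|complex.Im z|.
Proof.
have -> : z = (complex.Re z)%:C + 'i * (complex.Im z)%:C by rewrite -complexE.
apply: le_trans (le_normcD _ _) _; rewrite normcM !normc_real.
by case: z => x y /=; rewrite expr0n expr1n add0r sqrtr1 mul1r !mul0r !mul1r !subr0 !addr0 !add0r.
Qed.

Lemma normc_sum (I : Type) (s : seq I) (P : pred I) (F : I -> R[i]) :
  normc (\sum_(i <- s | P i) F i) <= \sum_(i <- s | P i) normc (F i).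
Proof.
elim/big_rec2: _ => [|i y1 y2 _ IH]; first by rewrite normc0.
by apply: le_trans (le_normcD _ _) _; rewrite lerD2l.
Qed.

Lemma normc_real_prod (z : R[i]) (r : R) : normc (z * r%:C) = normc z * `|r|.
Proof. by rewrite normcM normc_real. Qed.

Lemma jet_translate (K : nat -> R -> R) (c t : R) : jet K ->
  jet (fun q y => c * K q (y - t)).
Proof.
move=> jK q y; apply: (is_deriveZ c).
have dl : is_derive y (1 : R) (fun y => y - t) 1.
  apply: is_derive1_ext (is_deriveB (is_derive_id y (1 : R)) (is_derive_cst t y (1 : R))) => //.
  by rewrite subr0.
apply: is_derive1_ext (@is_derive1_comp _ (K q) _ y _ _ (jK q _) dl) => //.
by rewrite mulr1.
Qed.

(** [C] depends only on m, r and the dimension. The bound C * W on the approximant holds at every x,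
    also outside the cube where nothing is approximated; it is what controls the region at infinity.
    The factor d^k is the volume of a lattice cell. *)
Lemma local_approx m (r : R) : 0 < r <= 1 -> exists2 C : R, 0 <= C &
  forall eps rho : R, 0 < eps -> 0 < rho ->
  exists (N : nat) (a d : R) (e : grid N -> 'rV[R]_k -> R[i]),
  [/\ 0 < d <= r,
      forall A, smooth (e A) /\ forall q, exists B : R, forall mu x,
        (forall i, (mu i <= q)%N) -> normc (multi_partial mu (e A) x) <= B,
      forall A mu x,
        ((forall i, (mu i <= m)%N) -> normc (multi_partial mu (e A) x) <= C * d ^+ k) /\
        (multi_partial mu (e A) x != 0 -> forall i, 0 <= x 0 i - grid_pt a d A 0 i <= r) &
      forall f x W, smooth f -> 0 <= W ->
        (forall nu x', (forall i, (nu i <= m.+2)%N) ->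
          (forall i, x 0 i - r <= x' 0 i <= x 0 i) -> normc (multi_partial nu f x') <= W) ->
        forall mu, (forall i, (mu i <= m)%N) ->
        let S := \sum_A multi_partial (grid_mi m A) f (grid_pt a d A) *
                   multi_partial mu (e A) x in
        normc S <= C * W /\
        ((forall i, `|x 0 i| <= rho) -> normc (multi_partial mu f x - S) <= eps * W)].
Proof.
move=> r01; have /andP[r0 r1] := r01; have [C1 C10 H1] := one_dim m r01.
(* Each of the two kernels contributes C1 * (r + d), at most 2 * C1. *)
pose C2 := C1 * 4.
have C20 : 0 <= C2 by rewrite mulr_ge0.
(* The first power bounds the functions e A, the second the l1 norm of the product weights, hence
   [S]. *)
exists (C1 ^+ k + C2 ^+ k); first by rewrite addr_ge0 ?exprn_ge0.
(* Real and imaginary parts are approximated separately, whence the factor 2. *)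
move=> eps rho eps0 rho0; pose g : R := 2 * geom C2 k + 1.
have g0 : 0 < g by rewrite /g; have := geom_ge0 C20 k; lra.
have [K [jK sK KC HK]] := H1 _ (divr_gt0 eps0 g0).
(* Started at - rho - r, a lattice of length [L] runs up to rho and thus reaches from x - r to x for
   every coordinate x of modulus at most rho. The mesh is [L / N] because [one_dim] asks for N * d =
   L. *)
pose L := 2 * rho + r; have L0 : 0 < L by rewrite /L; lra.
have [d0 d00 Hd] := HK L L0; clear H1 HK.
pose d1 := Num.min d0 r; have d10 : 0 < d1 by rewrite lt_min d00.
pose N := (Num.bound (L / d1)).+1; pose d := L / N%:R.
have N0 : 0 < N%:R :> R by rewrite ltr0n.
have dp : 0 < d by rewrite divr_gt0.
have dd1 : d <= d1.
  rewrite ler_pdivrMr // mulrC -ler_pdivrMr // ltW // (lt_le_trans (archi_boundP _)) //.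
    by rewrite divr_ge0 ?ltW.
  by rewrite ler_nat leqnSn.
have [dd0 dr] : d <= d0 /\ d <= r.
  by move: dd1; rewrite le_min => /andP[].
have NL : N%:R * d = L by rewrite mulrC divfK // gt_eqF.
pose a := - rho - r.
pose nI (c : 'I_N * bool) : nat := if c.2 then m.+1 else 0%N.
pose tI (c : 'I_N * bool) : R := a + c.1%:R * d.
pose w (y : R) (p : nat) (c : 'I_N * bool) := d * K c.2 p (y - tI c).
have wb y p c : (p <= m)%N -> `|w y p c| <= C1 * d.
  by move=> pm; rewrite normrM gtr0_norm // mulrC ler_wpM2r ?(ltW dp) // KC.
have wsupp y p c : w y p c != 0 -> y - r <= tI c <= y.
  apply: contraNT; rewrite negb_and -!ltNge => /orP H; rewrite /w sK ?mulr0 //.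
  by case: H => h; [right|left]; lra.
have wsum y p : (p <= m)%N -> \sum_c `|w y p c| <= C2.
  move=> pm; rewrite (eq_bigr (fun c => `|w y p (c.1, c.2)|)); last by move=> [].
  rewrite -(pair_bigA _ (fun l b => `|w y p (l, b)|)) /=.
  apply: (@le_trans _ _ (\sum_(b : bool) C1 * 2)); last first.
    by rewrite big_bool /= /C2; lra.
  rewrite exchange_big /=; apply: ler_sum => b _.
  have := @lattice_sum_le R a d (y - r) y C1 N (fun t => K b p (y - t)) dp.
  under eq_bigr => l _ do rewrite normrM gtr0_norm //.
  have -> : y - (y - r) = r by rewrite opprB addrC subrK.
  move=> H; apply: le_trans (H _ C10 _ _) _.
  - by lra.
  - by move=> t; exact: KC.
  - by move=> t th; rewrite sK //; case: th => th; [right|left]; lra.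
  by rewrite ler_wpM2l //; lra.
have wapp u (y W : R) : jet u -> 0 <= W -> a + r <= y <= a + L ->
    (forall q t, (q <= m.+2)%N -> y - r <= t <= y -> `|u q t| <= W) ->
    forall p, (p <= m)%N ->
    `|\sum_c w y p c * u (nI c) (tI c) - u p y| <= eps / g * W.
  move=> ju W0 /andP[y1 y2] uW p pm.
  have dd : 0 < d <= d0 by rewrite dp dd0.
  have ay : a <= y - r by lra.
  have := Hd d N a y W u dd NL ju W0 ay y2 uW p pm.
  congr (`|_ - _| <= _).
  rewrite [RHS](eq_bigr (fun c => w y p (c.1, c.2) * u (nI (c.1, c.2)) (tI (c.1, c.2)))).
    rewrite -(pair_bigA _ (fun l b => w y p (l, b) * u (nI (l, b)) (tI (l, b)))) /=.
    apply: eq_bigr => l _; rewrite big_bool /w /nI /tI /=; ring.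
  by move=> [].
clear Hd; pose H (A : grid N) (i : 'I_k) q y := w y q (A i).
have jH A i : jet (H A i) by exact: jet_translate.
exists N, a, d, (fun A x => (prod_jet (H A) [ffun=> 0%N] x)%:C).
have nIm c : (nI c <= m.+2)%N by rewrite /nI; case: (c.2); rewrite // leqW.
have eps' : 0 <= eps / g by rewrite divr_ge0 ?ltW.
split.
- by rewrite dp dr.
- move=> A; split=> [|q]; first exact: smooth_prod_jet.
  have [B1 B10 HB1] := supported_bounded q.+1 (jK true) (sK true).
  have [B2 B20 HB2] := supported_bounded q.+1 (jK false) (sK false).
  exists (\prod_(i < k) (d * (B1 + B2))) => mu x muq.
  rewrite multi_partial_prod_jet // normc_real normr_prod.
  apply: ler_prod => i _; rewrite normr_ge0 /= normrM gtr0_norm // ler_wpM2l ?(ltW dp) //.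
  case: (A i).2; last by rewrite (le_trans (HB2 _ _ _)) ?ltnS ?lerDr.
  by rewrite (le_trans (HB1 _ _ _)) ?ltnS ?lerDl.
- move=> A mu x; rewrite multi_partial_prod_jet // normc_real; split=> [mum|].
    rewrite normr_prod; apply: (@le_trans _ _ (\prod_(i < k) (C1 * d))).
      apply: ler_prod => i _; rewrite normr_ge0 /=; exact: wb.
    rewrite prodr_const card_ord exprMn ler_wpM2r ?exprn_ge0 ?(ltW dp) //.
    by rewrite lerDl exprn_ge0.
  move=> nz i; rewrite mxE.
  have : w (x 0 i) (mu i) (A i) != 0.
    apply: contraNneq nz => z; rewrite /prod_jet (bigD1 i) //=.
    by rewrite [H A i _ _]z mul0r.
  by move/wsupp => /andP[? ?]; apply/andP; rewrite -/(tI (A i)); split; lra.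
move=> f x W sf W0 fW mu mum S.
have S_E : S = \sum_(A : grid N) multi_partial (grid_mi m A) f (grid_pt a d A) *
     (\prod_i w (x 0 i) (mu i) (A i))%:C.
  by apply: eq_bigr => A _; rewrite multi_partial_prod_jet.
have nz (A : grid N) : (\prod_i w (x 0 i) (mu i) (A i))%:C != 0 ->
    normc (multi_partial (grid_mi m A) f (grid_pt a d A)) <= W.
  move=> nzA; apply: fW => i; first by rewrite ffunE; exact: (nIm (A i)).
  rewrite mxE; apply: (wsupp _ (mu i) (A i)); apply: contraNneq nzA => z.
  by rewrite (bigD1 i) //= z mul0r.
split.
  rewrite S_E; apply: le_trans (normc_sum _ _ _) _.
  apply: (@le_trans _ _ (\sum_(A : grid N) (\prod_i `|w (x 0 i) (mu i) (A i)|) * W)).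
    apply: ler_sum => A _; rewrite normc_real_prod mulrC normr_prod.
    have [z|nzA] := eqVneq ((\prod_i w (x 0 i) (mu i) (A i))%:C) 0.
      have : normc ((\prod_i w (x 0 i) (mu i) (A i))%:C) = 0 by rewrite z normc0.
      by rewrite normc_real normr_prod => ->; rewrite !mul0r.
    by rewrite ler_wpM2l ?prodr_ge0 // nz.
  rewrite -mulr_suml ler_wpM2r // -(bigA_distr_bigA (fun i c => `|w (x 0 i) (mu i) c|)) /=.
  apply: (@le_trans _ _ (\prod_(i < k) C2)).
    by apply: ler_prod => i _; rewrite sumr_ge0 //= wsum.
  by rewrite prodr_const card_ord lerDr exprn_ge0.
move=> xrho.
have xlh i : a + r <= x 0 i <= a + L.
  by have := xrho i; rewrite ler_norml /a /L => /andP[? ?]; apply/andP; split; lra.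
have TA (part : R[i] -> R) :
    (forall nu' x' i, jet (fun q t => part (multi_partial (mi_upd nu' i q) f (pt_upd x' i t)))) ->
    (forall z, `|part z| <= normc z) ->
    `|\sum_(A : grid N) (\prod_i w (x 0 i) (mu i) (A i)) *
       part (multi_partial (grid_mi m A) f (grid_pt a d A)) - part (multi_partial mu f x)|
     <= eps / g * geom C2 k * W.
  move=> jp pn; have T := (@tensor_approx R k _ nI tI w m r C2 (eps / g) (a + r) (a + L)
    C20 eps' nIm wsupp wsum wapp (fun nu y => part (multi_partial nu f y))
    (fun i nu y => jp nu y i) (ord0, true) mu x W W0 mum xlh).
  exact: T (fun nu' x' nm' xx' => le_trans (pn _) (fW nu' x' nm' xx')).
have TR := TA (@complex.Re R) (fun nu' x' i => jet_line_Re nu' x' i sf) normc_Re.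
have TI := TA (@complex.Im R) (fun nu' x' i => jet_line_Im nu' x' i sf) normc_Im.
have ReS : complex.Re S = \sum_(A : grid N) (\prod_i w (x 0 i) (mu i) (A i)) *
       complex.Re (multi_partial (grid_mi m A) f (grid_pt a d A)).
  rewrite S_E raddf_sum /=; apply: eq_bigr => A _.
  by case: (multi_partial _ _ _) => p q /=; rewrite mulr0 subr0 mulrC.
have ImS : complex.Im S = \sum_(A : grid N) (\prod_i w (x 0 i) (mu i) (A i)) *
       complex.Im (multi_partial (grid_mi m A) f (grid_pt a d A)).
  rewrite S_E raddf_sum /=; apply: eq_bigr => A _.
  by case: (multi_partial _ _ _) => p q /=; rewrite mulr0 add0r mulrC.
apply: le_trans (normc_ReIm _) _.
rewrite -ReS distrC in TR; rewrite -ImS distrC in TI.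
have ReB (u v : R[i]) : complex.Re (u - v) = complex.Re u - complex.Re v by case: u v => ? ? [].
have ImB (u v : R[i]) : complex.Im (u - v) = complex.Im u - complex.Im v by case: u v => ? ? [].
rewrite ReB ImB; apply: le_trans (lerD TR TI) _.
rewrite -mulrDl ler_wpM2r //.
have -> : eps / g * geom C2 k + eps / g * geom C2 k = eps / g * (g - 1).
  by rewrite /g addrK; ring.
by rewrite mulrBr mulr1 divfK ?gt_eqF // gerDl oppr_le0.
Qed.

End LocalApproximation.

(** * Lower sums of a summable function *)

Lemma disjoint_lower_sum (dsp : measure_display) (T : measurableType dsp) (R : realType)
    (mu : {measure set T -> \bar R}) (J : finType) (B : J -> set T) (v : R)
    (l : J -> R) (L : T -> R) :
  (forall t, measurable (B t)) -> (forall t, mu (B t) = v%:E) ->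
  (forall t t' z, B t z -> B t' z -> t = t') ->
  mu.-integrable setT (EFin \o L) -> (forall z, 0 <= L z) ->
  (forall t, 0 <= l t) -> (forall t z, B t z -> l t <= L z) ->
  (\sum_t (v * l t)%:E <= \int[mu]_x `|(L x)%:E|)%E.
Proof.
move=> mB muB dB /integrableP[mL fL] L0 l0 lL.
(* The simple function with value [l t] on [B t] lies below [L] because the sets are disjoint. *)
pose f (t : J) (z : T) : \bar R := (l t * \1_(B t) z)%:E.
have mf t : measurable_fun setT (f t).
  apply/measurable_EFinP; apply: measurable_funM; first exact: measurable_cst.
  exact: measurable_indic.
have f0 t z : setT z -> (0 <= f t z)%E.
  by move=> _; rewrite lee_fin mulr_ge0 // indicE.
have -> : (\sum_t (v * l t)%:E = \int[mu]_z \sum_t f t z)%E.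
  rewrite ge0_integral_sum //; apply: eq_bigr => t _.
  rewrite /f (integralZl_indic _ (fun=> B t)) //; last by move/lt_geF; rewrite l0.
  by rewrite integral_indic // setIT muB -EFinM mulrC.
apply: ge0_le_integral => //.
- by move=> z _; apply: sume_ge0 => t _; exact: f0.
- exact: emeasurable_sum.
- by apply: measurableT_comp.
- move=> z _ /=; rewrite sumEFin lee_fin ger0_norm //.
  have [[t zt]|nz] := pselect (exists t, B t z).
    rewrite (bigD1 t) //= big1 => [|t' tt']; rewrite indicE.
      by rewrite mem_set // mulr1 addr0; exact: lL.
    rewrite memNset ?mulr0 // => zt'; move/eqP: tt'; apply.
    exact: dB zt' zt.
  rewrite big1 // => t _; rewrite indicE memNset ?mulr0 // => zt.
  by apply: nz; exists t.
Qed.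

Section LowerSums.
Context (R : realType) (k : nat).

Definition cell N (a d : R) (t : {ffun 'I_k -> 'I_N}) : set 'rV[R]_k :=
  [set z | forall i, a + (t i)%:R * d <= z 0 i < a + (t i)%:R * d + d].

Lemma cell_uniq N a (d : R) (t t' : {ffun 'I_k -> 'I_N}) z : 0 < d ->
  cell a d t z -> cell a d t' z -> t = t'.
Proof.
move=> d0 zt zt'; apply/ffunP => i; apply/val_inj/eqP.
have /andP[h1 h2] := zt i; have /andP[h3 h4] := zt' i.
have H (p q : nat) : a + p%:R * d <= z 0 i -> z 0 i < a + q%:R * d + d -> (p <= q)%N.
  by move=> h h'; rewrite -ltnS -(ltr_nat R) -(ltr_pM2r d0) -natr1 mulrDl mul1r; lra.
by rewrite eqn_leq !H.
Qed.

Let box N (a d : R) (t : {ffun 'I_k -> 'I_N}) : set (lebesgueType R k) :=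
  [set z | forall i, `[a + (t i)%:R * d, a + (t i)%:R * d + d[%classic (tnth z i)].

Let box_measure N a (d : R) (t : {ffun 'I_k -> 'I_N}) : 0 < d ->
  measurable (box a d t) /\ @Defs.lebesgue_measureN R k (box a d t) = (d ^+ k)%:E.
Proof.
move=> d0.
have [mA EA] := @borel_lebesgue_box R k
  (fun i => `[a + (t i)%:R * d, a + (t i)%:R * d + d[%classic : set (measurableTypeR R))
  (fun i => measurable_itv _).
split.
  by apply: sub_caratheodory; apply: sub_sigma_algebra; exact: mA.
rewrite /Defs.lebesgue_measureN /completed_measure_extension /= measurable_mu_extE //.
rewrite [LHS]EA.
rewrite (eq_bigr (fun=> d%:E)) => [|i _].
  by rewrite prodEFin prodr_const card_ord.
rewrite lebesgue_measure_itv /= lte_fin ltrDl d0 -EFinD; congr (_%:E).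
by rewrite addrAC subrr add0r.
Qed.

(** The constant is the integral of [L], the same for every lattice. *)
Lemma lower_sum_bound (L : 'rV[R]_k -> {nonneg R}) :
  summable_fun (fun x => (L x)%:num) ->
  exists2 C : R, 0 <= C & forall N a (d : R) (l : {ffun 'I_k -> 'I_N} -> R), 0 < d ->
    (forall t, 0 <= l t) -> (forall t z, cell a d t z -> l t <= (L z)%:num) ->
    \sum_t d ^+ k * l t <= C.
Proof.
move=> sL; have /integrableP[_] := sL.
set I := (\int[_]_(x in _) _)%E => fL.
have I0 : (0 <= I)%E by exact: integral_ge0.
have If : I \is a fin_num by rewrite ge0_fin_numE.
exists (fine I); first exact: fine_ge0.
move=> N a d l d0 l0 lL; rewrite -lee_fin fineK // -sumEFin.
have boxcell t z : box a d t z -> cell a d t (rV_of_tuple z).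
  by move=> zt i; have := zt i; rewrite mxE /= in_itv.
apply: (disjoint_lower_sum (fun t => (box_measure a t d0).1)
  (fun t => (box_measure a t d0).2) _ sL) => //.
  move=> t t' z /boxcell zt /boxcell zt'; exact: cell_uniq d0 zt zt'.
by move=> t z /boxcell; exact: lL.
Qed.

End LowerSums.

(** * The approximation property of K(M) *)

Section WeightedApproximation.
Context (R : realType) (k : nat) (Gamma : Type).
Variable M : Gamma -> 'rV[R]_k -> {nonneg R}.
Hypotheses (dfM : defining_family M) (M1 : condition_I M) (M2 : condition_II M).

Lemma rV_normP (x : 'rV[R]_k) (c : R) : 0 <= c ->
  `|x| <= c <-> forall i, `|x 0 i| <= c.
Proof.
move=> c0; rewrite -[`|x|]/(mx_norm x) mx_normrE; split=> [|H].
  by move=> H i; apply: le_trans H; exact: (le_bigmax_cond _ (fun ij => `|x ij.1 ij.2|) (j := (0, i))).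
by apply: bigmax_le => // -[i j] _ /=; rewrite ord1.
Qed.

Lemma coord_le_norm (x : 'rV[R]_k) i : `|x 0 i| <= `|x|.
Proof. by have /(rV_normP _ (normr_ge0 _)) := lexx `|x|; exact. Qed.

(** Condition (II) moves from x to z, (I) produces the factor L(z), (II) moves on from z to t, and
    directedness merges the two final weights into [g']. The point z is left free so that L(z) can
    be replaced by its infimum over a cell. *)
Lemma weight_chain g : exists g' (L : 'rV[R]_k -> {nonneg R}) (r C : R),
  [/\ 0 < r <= 1 /\ 0 <= C, summable_fun (fun x => (L x)%:num),
    forall e : R, 0 < e -> exists rho : R, forall x, rho < `|x| -> (L x)%:num < e,
    forall x t, `|x - t| <= r -> (M g x)%:num <= C * (M g' t)%:num &
    forall x z t, `|x - z| <= 2 * r -> `|z - t| <= r ->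
      (M g x)%:num <= C * (L z)%:num * (M g' t)%:num].
Proof.
have [g1 [B1 [nB1 [C1 C10 H1]]]] := M2 g.
have [g2 [L [sL HL L0]]] := M1 g1.
have [g3 [B3 [nB3 [C3 C30 H3]]]] := M2 g2.
have [g' [C C0 HC]] := df_directed dfM g1 g3.
have /nbhs_ballP[e1 /= e10 He1] := nB1.
have /nbhs_ballP[e3 /= e30 He3] := nB3.
pose r := Num.min 1 (Num.min e1 e3) / 3.
have m0 : 0 < Num.min 1 (Num.min e1 e3) by rewrite !lt_min ltr01 e10 e30.
have [m1 me1 me3] : [/\ Num.min 1 (Num.min e1 e3) <= 1,
    Num.min 1 (Num.min e1 e3) <= e1 & Num.min 1 (Num.min e1 e3) <= e3].
  by rewrite !ge_min !lexx !orbT.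
have [r0 r1 re1 re3] : [/\ 0 < r, r <= 1, 2 * r < e1 & 2 * r < e3].
  by rewrite /r; split; lra.
have inB B e : (ball (0 : 'rV[R]_k) e `<=` B) -> forall x t, `|x - t| < e -> B (t - x).
  by move=> sub x t xt; apply: sub; rewrite -ball_normE /ball_ /= sub0r normrN distrC.
(* The first summand serves the comparison without [L], the second the one with [L]. *)
exists g', L, r, (C1 / C + C1 * C3 / C); split=> //.
- rewrite r0 r1; split=> //; rewrite addr_ge0 // divr_ge0 ?(ltW C0) ?(ltW C10) //.
  by rewrite mulr_ge0 ?ltW.
- move=> x t xt; have := H1 x (t - x) (inB _ _ He1 x t (le_lt_trans xt _)).
  rewrite addrC subrK => /(_ _)/le_trans; apply; first lra.
  rewrite mulrDl ler_wpDr //.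
    by rewrite mulr_ge0 // divr_ge0 ?(ltW C0) // mulr_ge0 ?ltW.
  rewrite -[C1 / C * _]mulrA ler_pM2l // ler_pdivlMl //.
  by apply: le_trans (HC t); rewrite ler_pM2l // lerDl.
- move=> x z t xz zt.
  have := H1 x (z - x) (inB _ _ He1 x z (le_lt_trans xz re1)).
  have := H3 z (t - z) (inB _ _ He3 z t (le_lt_trans zt _)).
  rewrite ![_ + (_ - _)]addrC !subrK => /(_ _) h3 h1.
  have {}h3 : (M g2 z)%:num <= C3 * (M g3 t)%:num by apply: h3; lra.
  apply: (le_trans h1); apply: (@le_trans _ _ (C1 * ((L z)%:num * (C3 * (M g3 t)%:num)))).
    rewrite ler_pM2l //; apply: (le_trans (HL z)); exact: ler_wpM2l.
  rewrite !mulrDl ler_wpDl //.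
    by rewrite !mulr_ge0 // ?invr_ge0 ltW.
  have -> : C1 * ((L z)%:num * (C3 * (M g3 t)%:num)) =
    C1 * C3 * (L z)%:num * (M g3 t)%:num by ring.
  have -> : C1 * C3 / C * (L z)%:num * (M g' t)%:num =
    C1 * C3 * (L z)%:num * (C^-1 * (M g' t)%:num) by ring.
  apply: ler_wpM2l; first by rewrite mulr_ge0 // mulr_ge0 // ltW.
  rewrite ler_pdivlMl //; apply: le_trans (HC t); rewrite ler_pM2l // lerDr //.
Qed.

Lemma sum_grid N (F : {ffun 'I_k -> 'I_N} -> R) :
  \sum_(A : grid k N) F [ffun i => (A i).1] = 2 ^+ k * \sum_t F t.
Proof.
rewrite (reindex (fun p : {ffun 'I_k -> 'I_N} * {ffun 'I_k -> bool} =>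
  [ffun i => (p.1 i, p.2 i)] : grid k N)) /=; last first.
  exists (fun A : grid k N => ([ffun i => (A i).1], [ffun i => (A i).2])) => [[t b] _|A _] /=.
    by congr (_, _); apply/ffunP => i; rewrite !ffunE.
  by apply/ffunP => i; rewrite !ffunE; case: (A i).
rewrite (eq_bigr (fun p => F p.1)) => [|[t b] _ /=]; last first.
  by congr F; apply/ffunP => i; rewrite !ffunE.
rewrite -(pair_bigA _ (fun t (b : {ffun 'I_k -> bool}) => F t)) /= mulr_sumr.
apply: eq_bigr => t _; rewrite sumr_const card_ffun card_bool card_ord.
by rewrite -[LHS]mulr_natl natrX.
Qed.

Lemma multi_order_le (mu : multi_index k) m i : (multi_order mu <= m)%N -> (mu i <= m)%N.
Proof. by move=> /(leq_trans _); apply; rewrite /multi_order (bigD1 i) //= leq_addr. Qed.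

Lemma multi_order_bound (mu : multi_index k) m : (forall i, (mu i <= m)%N) ->
  (multi_order mu <= k * m)%N.
Proof.
move=> mum; apply: (@leq_trans (\sum_(i < k) m)); first exact: leq_sum.
by rewrite sum_nat_const card_ord.
Qed.

Lemma K_member (e : 'rV[R]_k -> R[i]) (t : 'rV[R]_k) (r : R) : 0 <= r -> smooth e ->
  (forall q, exists B : R, forall (mu : multi_index k) x,
     (forall i, (mu i <= q)%N) -> normc (multi_partial mu e x) <= B) ->
  (forall (mu : multi_index k) x, multi_partial mu e x != 0 -> `|x - t| <= r) ->
  e \in K_pred M.
Proof.
move=> r0 se be ne; apply/K_predP; split=> // g m.
have [B HB] := be m.
have bA : bounded_set [set x : 'rV[R]_k | `|x - t| <= r].
  exists (`|t| + r); split; first exact: num_real.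
  move=> c tc x /= xt; apply/ltW/le_lt_trans/tc.
  by rewrite -(subrK t x); apply: le_trans (ler_normD _ _) _; lra.
have [c c0 Hc] := pinfty_ex_gt0 (df_bounded dfM g bA).
exists (c * B) => _ [x [mu [mum ->]]].
have nB : 0 <= B by apply: le_trans (normc_ge0 _) (HB mu x _) => i; exact: multi_order_le.
have [z|nz] := eqVneq (multi_partial mu e x) 0.
  by rewrite z normc0 mulr0 mulr_ge0 // ltW.
apply: ler_pM => //; first exact: normc_ge0.
  by have /= := Hc x (ne _ _ nz); rewrite ger0_norm.
by apply: HB => i; exact: multi_order_le.
Qed.

(* [C] does not depend on [eps]: [\sum_A kap A] is a lower sum of the summable
   function of condition (I). *)
Lemma K_approx g m : exists g' m' (C : R), 0 <= C /\ forall eps : R, 0 < eps ->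
  exists (J : finType) (nu : J -> multi_index k) (t : J -> 'rV[R]_k) (e : J -> K_fun M),
  [/\ forall A, (multi_order (nu A) <= m')%N,
      exists2 kap : J -> R, \sum_A kap A <= C & forall A, 0 <= kap A /\
        K_norm (g, m) (e A) <= kap A * (M g' (t A))%:num &
      forall f (V : R), smooth f -> 0 <= V ->
        (forall x nu, (multi_order nu <= m')%N ->
          (M g' x)%:num * normc (multi_partial nu f x) <= V) ->
        forall x mu, (multi_order mu <= m)%N ->
          (M g x)%:num * normc (multi_partial mu f x -
            \sum_A multi_partial (nu A) f (t A) * multi_partial mu (e A) x) <= eps * V].
Proof.
have [g' [L [r [C [[r01 C0] sL L0 near chain]]]]] := weight_chain g.
have /andP[r0 r1] := r01.
have [Cl Cl0 HCl] := local_approx k m r01.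
have [I I0 HI] := lower_sum_bound sL.
(* Up to m+2 derivatives occur in each of the k variables. The power of 2 counts the kernel choices
   at one lattice point, and [I] bounds the lower sums of [L]. *)
exists g', (k * m.+2)%N, (2 ^+ k * (Cl * C * I)); split.
  by rewrite !mulr_ge0 // exprn_ge0.
move=> eps eps0.
(* Far away the derivative of f contributes C * eps1 and the approximant Cl * C * eps1. *)
pose eps1 := eps / ((Cl + 1) * C + 1).
have cp : 0 < (Cl + 1) * C + 1 by rewrite ltr_wpDl // mulr_ge0 // addr_ge0.
have eps10 : 0 < eps1 by rewrite divr_gt0.
have eps1E : eps1 * ((Cl + 1) * C + 1) = eps by rewrite divfK // gt_eqF.
have [rho Hrho] := L0 _ eps10.
(* Outside this radius all points within r of x still have norm above [rho], where [L] is below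
   [eps1]. *)
pose rho' := `|rho| + r + 1.
have rho'0 : 0 < rho' by rewrite /rho'; have := normr_ge0 rho; lra.
have eps20 : 0 < eps / (C + 1) by rewrite divr_gt0 // ltr_wpDl.
have [N [a [d [e [/andP[d0 dr] se be He]]]]] := HCl _ _ eps20 rho'0.
have near_pt A mu x : multi_partial mu (e A) x != 0 -> `|x - grid_pt a d A| <= r.
  move=> nz; apply/rV_normP; first exact: ltW.
  move=> i; have /andP[h1 h2] := (be A mu x).2 nz i.
  by rewrite !mxE in h1 h2 *; rewrite ger0_norm.
pose eK A := KFun (K_member (ltW r0) (se A).1 (se A).2 (near_pt A)).
exists (grid k N : finType), (grid_mi m (N := N)), (grid_pt a d), eK; split.
- by move=> A; apply: multi_order_bound => i; rewrite ffunE; case: ifP.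
- pose Lset (t : {ffun 'I_k -> 'I_N}) := [set (L z)%:num | z in cell a d t].
  have Lne t : Lset t !=set0.
    exists ((L (\row_i (a + (t i)%:R * d)))%:num); exists (\row_i (a + (t i)%:R * d)) => //.
    by move=> i; rewrite mxE lexx ltrDl.
  have Llb t : lbound (Lset t) 0 by move=> _ [z _ <-].
  have infL0 t : 0 <= inf (Lset t) by exact: lb_le_inf.
  have infL t z : cell a d t z -> inf (Lset t) <= (L z)%:num.
    by move=> zt; apply: ge_inf; [exists 0; exact: Llb|exists z].
  exists (fun A : grid k N => Cl * C * (d ^+ k * inf (Lset [ffun i => (A i).1]))).
    rewrite (sum_grid (fun t => Cl * C * (d ^+ k * inf (Lset t)))) -mulr_sumr.
    rewrite ler_pM2l ?exprn_gt0 // ler_wpM2l ?mulr_ge0 //.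
    exact: (HI N a d (fun t => inf (Lset t)) d0 infL0 infL).
  move=> A; have ge0 : 0 <= Cl * C * (d ^+ k * inf (Lset [ffun i => (A i).1])).
    by rewrite !mulr_ge0 // exprn_ge0 // ltW.
  split=> //; apply: K_norm_le => x mu mum.
  have [z|nz] := eqVneq (multi_partial mu (eK A) x) 0.
    by rewrite z normc0 mulr0 mulr_ge0.
  have b1 := (be A mu x).1 (fun i => multi_order_le i mum).
  have Mx : (M g x)%:num <= C * inf (Lset [ffun i => (A i).1]) * (M g' (grid_pt a d A))%:num.
    have xt := near_pt A mu x nz.
    have ch z : cell a d [ffun i => (A i).1] z ->
        (M g x)%:num <= C * (L z)%:num * (M g' (grid_pt a d A))%:num.
      move=> zc; have zt : `|z - grid_pt a d A| <= r.
        apply/rV_normP; first exact: ltW.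
        move=> i; have /andP[] := zc i; rewrite ffunE => h1 h2.
        by rewrite !mxE ger0_norm; lra.
      apply: chain => //.
      rewrite -(subrK (grid_pt a d A) x) -addrA; apply: le_trans (ler_normD _ _) _.
      by rewrite distrC in zt; lra.
    (* Passing from every z of the cell to the infimum of [L] divides by this factor, so its
       vanishing is treated apart. *)
    rewrite mulrAC; have [CM|CM] := leP (C * (M g' (grid_pt a d A))%:num) 0.
      have [_ [z zc _]] := Lne [ffun i => (A i).1].
      have CM0 : C * (M g' (grid_pt a d A))%:num = 0.
        by apply/eqP; rewrite eq_le CM mulr_ge0.
      by rewrite CM0 mul0r; apply: le_trans (ch z zc) _; rewrite mulrAC CM0 mul0r.
    rewrite -ler_pdivrMl //; apply: lb_le_inf => // _ [z zc <-].
    by rewrite ler_pdivrMl // mulrAC; exact: ch.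
  apply: le_trans (ler_pM _ (normc_ge0 _) Mx b1) _ => //.
  by rewrite le_eqVlt; apply/orP; left; apply/eqP; ring.
move=> f V sf V0 fV x mu mum.
have mui i := multi_order_le i mum.
have [Mx0|Mx0] := eqVneq (M g x)%:num 0; first by rewrite Mx0 mul0r mulr_ge0 // ltW.
have Mxp : 0 < (M g x)%:num by rewrite lt_neqAle eq_sym Mx0 /=.
have xr (x' : 'rV[R]_k) : (forall i, x 0 i - r <= x' 0 i <= x 0 i) -> `|x - x'| <= r.
  move=> xx'; apply/rV_normP; first exact: ltW.
  by move=> i; have /andP[h1 h2] := xx' i; rewrite !mxE ger0_norm; lra.
(* [local_approx] is unweighted, and its bound [W] may depend on x: it is taken as c * V / M_g(x),
   so that multiplying by M_g(x) restores the weighted estimate. *)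
have key (c : R) : 0 <= c -> (forall x' : 'rV[R]_k, `|x - x'| <= r ->
      (M g x)%:num <= c * (M g' x')%:num) ->
    forall (nu : multi_index k) (x' : 'rV[R]_k), (forall i, (nu i <= m.+2)%N) ->
    (forall i, x 0 i - r <= x' 0 i <= x 0 i) ->
    normc (multi_partial nu f x') <= c * V / (M g x)%:num.
  move=> c0 Hc nu x' num xx'; rewrite ler_pdivlMr // mulrC.
  apply: le_trans (ler_wpM2r (normc_ge0 _) (Hc _ (xr _ xx'))) _.
  by rewrite -mulrA ler_wpM2l //; apply: fV; exact: multi_order_bound.
(* In the cube the approximation is accurate; outside, the derivative of f and the approximant are
   each small by the decay of [L]. *)
have [xrho|xrho] := leP `|x| rho'.
  have k1 := key C C0 (fun x' xx' => near x x' xx').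
  have W0 : 0 <= C * V / (M g x)%:num by rewrite divr_ge0 // mulr_ge0.
  have [_ /(_ (fun i => le_trans (coord_le_norm x i) xrho)) H] := He f x _ sf W0 k1 mu mui.
  rewrite mulrC -ler_pdivlMr //; apply: (le_trans H).
  rewrite mulrA ler_pM2r ?invr_gt0 // mulrA ler_wpM2r //.
  rewrite mulrAC -mulrA ler_piMr ?(ltW eps0) // ler_pdivrMr ?ltr_wpDl // mul1r lerDl //.
have Ceps : 0 <= C * eps1 by rewrite mulr_ge0 // ltW.
have k2 : forall x' : 'rV[R]_k, `|x - x'| <= r -> (M g x)%:num <= C * eps1 * (M g' x')%:num.
  move=> x' xx'; apply: le_trans (chain x x' x' _ _) _; [lra|by rewrite subrr normr0 ltW|].
  rewrite ler_wpM2r // ler_wpM2l // ltW //; apply: Hrho.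
  have : `|x| <= `|x - x'| + `|x'| by rewrite -{1}(subrK x' x) ler_normD.
  by move: xrho; rewrite /rho'; have := ler_norm rho; lra.
have k3 := key _ Ceps k2.
have W0 : 0 <= C * eps1 * V / (M g x)%:num by rewrite divr_ge0 // mulr_ge0.
have [H _] := He f x _ sf W0 k3 mu mui.
have h2 : normc (multi_partial mu f x) <= C * eps1 * V / (M g x)%:num.
  by apply: k3 => i; [rewrite (leq_trans (mui i)) // leqW|rewrite lexx andbT gerBl ltW].
rewrite mulrC -ler_pdivlMr //.
apply: le_trans (le_normcD _ _) _; rewrite normcN.
apply: le_trans (lerD h2 H) _.
rewrite -{1}[_ * V / _]mul1r -mulrDl mulrA ler_pM2r ?invr_gt0 // mulrA ler_wpM2r //.
by rewrite -[leRHS]eps1E; lra.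
Qed.

End WeightedApproximation.

(** * Completions *)

Section CompletionExtension.
Context (R : realType).
Implicit Types X E H : tvsType R[i].

Lemma tvs_add_nbhs E (x y : E) W : nbhs (x + y) W -> exists U V,
  [/\ nbhs x U, nbhs y V & forall u v, U u -> V v -> W (u + v)].
Proof.
move=> xyW; have [[U V] /= [xU yV] UV] := @add_continuous E (x, y) W xyW.
by exists U, V; split=> // u v Uu Vv; exact: (UV (u, v)).
Qed.

Lemma tvs_sub_nbhs E (x y : E) W : nbhs (x - y) W -> exists U V,
  [/\ nbhs x U, nbhs y V & forall u v, U u -> V v -> W (u - v)].
Proof.
move=> xyW; have [[U V] /= [xU yV] UV] := @sub_continuous E (x, y) W xyW.
by exists U, V; split=> // u v Uu Vv; exact: (UV (u, v)).
Qed.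

Lemma tvs_scale_nbhs E (a : R[i]) (x : E) W : nbhs (a *: x) W ->
  exists2 U, nbhs x U & forall u, U u -> W (a *: u).
Proof.
move=> axW; have [[A U] /= [aA xU] AU] := @scale_continuous R[i] E (a, x) W axW.
by exists U => // u Uu; apply: (AU (a, u)); split=> //; exact: nbhs_singleton aA.
Qed.

Lemma dense_eq (X : Type) (E H : topologicalType) (j : X -> E) (f g : E -> H) :
  dense (range j) -> hausdorff_space H -> continuous f -> continuous g ->
  (forall u, f (j u) = g (j u)) -> f = g.
Proof.
move=> dj hH cf cg fg; apply/funext => x; apply: hH => A B fA gB.
have xA : nbhs x (f @^-1` A) by exact: cf.
have xB : nbhs x (g @^-1` B) by exact: cg.
pose O := interior (f @^-1` A `&` g @^-1` B).
have xO : nbhs x O by apply: nbhs_interior; exact: filterI.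
have [y [Oy [u _ uy]]] := dj O (ex_intro _ x (nbhs_singleton xO)) (@open_interior _ _).
have [Afu Bgu] := interior_subset Oy; rewrite -uy /= in Afu Bgu.
by exists (f (j u)); split=> //; rewrite fg.
Qed.

Section Extension.
Variables (X E H : tvsType R[i]) (j : {linear X -> E}) (T : {linear X -> H}).
Hypotheses (jc : is_completion j) (cT : continuous T).
Hypotheses (hH : hausdorff_space H) (cH : tvs_complete H).

(* The T-image of the trace on X of the neighbourhood filter of x; its limit is
   the value at x of the extension. *)
Let trace (x : E) : set_system H :=
  [set A | exists2 B, nbhs x B & forall u, B (j u) -> A (T u)].

Let dense_nbhs (x : E) B : nbhs x B -> exists u, B (j u).
Proof.
move=> xB; have := completion_dense jc (O := interior B).
move=> /(_ (ex_intro _ x xB) (@open_interior _ _)).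
by move=> [y [By [u _ uy]]]; exists u; rewrite uy; exact: interior_subset By.
Qed.

Let trace_filter x : ProperFilter (trace x).
Proof.
split.
  by move=> [B xB BT]; have [u Bu] := dense_nbhs xB; exact: BT Bu.
split.
- by exists setT => //; exact: filterT.
- move=> A A' [B xB BA] [B' xB' BA']; exists (B `&` B'); first exact: filterI.
  by move=> u [Bu B'u]; split; [exact: BA|exact: BA'].
- by move=> A A' AA' [B xB BA]; exists B => // u /BA /AA'.
Qed.

Let trace_cauchy x : tvs_cauchy (trace x).
Proof.
move=> U U0; have T0U : nbhs (0 : X) (T @^-1` U) by apply: cT; rewrite linear0.
have [B0 + B0T] := (completion_embedding jc _ _).1 T0U.
rewrite linear0 -(subrr x) => /tvs_sub_nbhs[B1 [B2 [xB1 xB2 B12]]].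
exists (T @` [set u | B1 (j u) /\ B2 (j u)]).
  by exists (B1 `&` B2); [exact: filterI|move=> u Bu; exists u].
move=> _ _ [u [Bu _] <-] [v [_ Bv] <-]; rewrite -linearB; apply: B0T.
by rewrite /= linearB; exact: B12.
Qed.

Let trace_lim x : exists y : H, trace x --> y := cH (trace_filter x) (@trace_cauchy x).

Let h (x : E) : H := sval (cid (trace_lim x)).

Let hP x A : nbhs (h x) A -> exists2 B, nbhs x B & forall u, B (j u) -> A (T u).
Proof. by move=> hA; have := svalP (cid (trace_lim x)) A hA. Qed.

Let h_ext u : h (j u) = T u.
Proof.
apply: hH => A A' /hP[B uB BA] TA'.
have [B' uB' B'A'] := (completion_embedding jc u (T @^-1` A')).1 (cT TA').
have [v [Bv B'v]] := dense_nbhs (filterI uB uB').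
by exists (T v); split; [exact: BA|exact: B'A'].
Qed.

(** If the two sides differed they could be separated, but T (a u + v) comes close to both when j u
    is near x and j v near y. *)
Let h_linear : linear h.
Proof.
move=> a x y; apply: hH => A A' /hP[B xyB BA] /tvs_add_nbhs[U [V [axU yV UV]]].
have [U' xU' U'U] := tvs_scale_nbhs axU.
have [B1 xB1 B1U] := hP xU'; have [B2 yB2 B2V] := hP yV.
have [U3 [V3 [axU3 yV3 UV3]]] := tvs_add_nbhs xyB.
have [U4 xU4 U43] := tvs_scale_nbhs axU3.
have [u [B1u U4u]] := dense_nbhs (filterI xB1 xU4).
have [v [B2v V3v]] := dense_nbhs (filterI yB2 yV3).
exists (T (a *: u + v)); split.
  by apply: BA; rewrite linearP; apply: UV3 => //; exact: U43.
by rewrite linearP; apply: UV; [exact/U'U/B1U|exact: B2V].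
Qed.

(** Write h y = T u + (h y - T u) with j u close to y: the first term is controlled by h x, the
    second is small by the choice of u. *)
Let h_continuous : continuous h.
Proof.
move=> x W; rewrite -[h x]addr0 => /tvs_add_nbhs[U [V [xU V0 UV]]].
have [B xB BU] := hP xU.
have xBi := nbhs_interior xB; apply: filterS xBi => y By.
have hyV : nbhs (h y) [set z | V (h y - z)].
  have : nbhs (h y - h y) V by rewrite subrr.
  move=> /tvs_sub_nbhs[V1 [V2 [yV1 yV2 V12]]]; apply: filterS yV2 => z V2z.
  exact: V12 (nbhs_singleton yV1) V2z.
have [B' yB' B'V] := hP hyV; have [u [Bu B'u]] := dense_nbhs (filterI By yB').
rewrite /= -(subrK (T u) (h y)) addrC; apply: UV; [exact: BU|exact: B'V].
Qed.

Lemma completion_extension : exists h : {linear E -> H},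
  continuous h /\ forall u, h (j u) = T u.
Proof.
pose hl : {linear E -> H} := HB.pack h (GRing.isLinear.Build R[i] E H _ h h_linear).
by exists hl.
Qed.

End Extension.

Lemma completion_unique X E H (j : {linear X -> E}) (T : {linear X -> H}) :
  is_completion j -> is_completion T ->
  exists h : {linear E -> H}, (forall u, h (j u) = T u) /\ topological_isomorphism h.
Proof.
have cont (Y : tvsType R[i]) (i : {linear X -> Y}) : is_completion i -> continuous i.
  by move=> ic u A iA; apply/(completion_embedding ic); exists A.
move=> jc Tc.
have [h [ch hj]] := completion_extension jc (cont _ _ Tc)
  (completion_hausdorff Tc) (completion_complete Tc).
have [h' [ch' hT]] := completion_extension Tc (cont _ _ jc)
  (completion_hausdorff jc) (completion_complete jc).
have e1 : h' \o h = id.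
  apply: (dense_eq (completion_dense jc) (completion_hausdorff jc)) => [y|y|u].
  - by apply: continuous_comp; [exact: ch|exact: ch'].
  - exact: cvg_id.
  - by rewrite /= hj hT.
have e2 : h \o h' = id.
  apply: (dense_eq (completion_dense Tc) (completion_hausdorff Tc)) => [y|y|u].
  - by apply: continuous_comp; [exact: ch'|exact: ch].
  - exact: cvg_id.
  - by rewrite /= hT hj.
exists h; split=> //; split=> //; exists h'; split=> // x.
  exact: (congr1 (fun f => f x) e1).
exact: (congr1 (fun f => f x) e2).
Qed.

End CompletionExtension.

(** * K(M) is Hausdorff and complete *)

Section KSpaceComplete.
Context (R : realType).

Lemma real_cauchy_limit (T : Type) (Fl : set_system T) (u : T -> R) : ProperFilter Fl ->
  (forall e : R, 0 < e -> exists2 A, Fl A & forall f h, A f -> A h -> `|u f - u h| <= e) ->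
  exists v : R, forall e : R, 0 < e -> Fl [set f | `|u f - v| <= e].
Proof.
move=> PF H; have PuF : ProperFilter (u @ Fl) by exact: fmap_proper_filter.
have /cauchy_cvgP : cauchy (u @ Fl).
  apply/cauchyP => e e0; have [A FA HA] := H _ (divr_gt0 e0 (ltr0n _ 2)).
  have [f Af] := filter_ex FA; exists (u f).
  suff : Fl (u @^-1` ball (u f) e) by [].
  apply: filterS FA => h Ah; rewrite /preimage /= -ball_normE /ball_ /=.
  by apply: le_lt_trans (HA f h Af Ah) _; lra.
move=> /cvg_ex[v uv]; exists v => e e0.
have /cvgrPdist_le/(_ e e0) : u f @[f --> Fl] --> v by exact: uv.
by apply: filterS => f /=; rewrite distrC.
Qed.

Lemma seminormed_hausdorff (V : lmodType R[i]) (I : Type) (p : I -> seminorm V) :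
  (forall x, (forall i, p i x = 0) -> x = 0) -> hausdorff_space (seminormed p).
Proof.
move=> p0 x y xy; apply/eqP; rewrite -subr_eq0; apply/eqP; apply: p0 => i.
apply/eqP; rewrite eq_le seminorm_ge0 andbT; apply/ler_addgt0Pl => e e0; rewrite addr0.
have e2 : 0 < e / 2 by rewrite divr_gt0.
have nb (z : seminormed p) : nbhs z (seminorm_ball (p := p) [:: i] (e / 2) z).
  by apply/seminorm_nbhsP; exists [:: i], (e / 2).
have [z [/= + +]] := xy _ _ (nb x) (nb y); rewrite /seminorm_ball /= !andbT => xz yz.
rewrite -(subrK z x) -addrA; apply: le_trans (seminormD _ _ _) _.
by rewrite [p i (z - y)]seminormB; lra.
Qed.

Variables (k : nat) (Gamma : Type) (M : Gamma -> 'rV[R]_k -> {nonneg R}).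
Hypothesis posM : forall x : 'rV[R]_k, exists g, exists2 C : R, 0 < C &
  \forall x' \near x, C <= (M g x')%:num.

Lemma multi_partial0 (f : 'rV[R]_k -> R[i]) : multi_partial [ffun=> 0%N] f = f.
Proof.
rewrite multi_partial_seq /mi_seq; have -> // : flatten
  [seq nseq ([ffun=> 0%N] i : nat) i | i <- enum 'I_k] = [::].
by elim: (enum 'I_k) => //= i s ->; rewrite ffunE.
Qed.

Lemma multi_order0 : multi_order ([ffun=> 0%N] : multi_index k) = 0%N.
Proof. by rewrite /multi_order big1 // => i _; rewrite ffunE. Qed.

Lemma K_space_hausdorff : hausdorff_space (K_space M).
Proof.
apply: seminormed_hausdorff => f f0; apply: val_inj; apply/funext => x /=.
have [g [C C0 /nbhs_singleton Cg]] := posM x.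
have := @K_norm_ub R k Gamma M g 0 f x [ffun=> 0%N].
rewrite multi_order0 multi_partial0 => /(_ isT).
rewrite -[K_norm _ f]/(K_seminorm M (g, 0) f) f0 => H.
apply: eq0_normc; apply/eqP; rewrite eq_le normc_ge0 andbT.
by have := normc_ge0 (f x); move: H; nra.
Qed.

Lemma multi_partialB mu (f h : 'rV[R]_k -> R[i]) : smooth f -> smooth h ->
  multi_partial mu (f - h) = multi_partial mu f - multi_partial mu h.
Proof.
move=> sf sh; have -> : f - h = (-1) *: h + f by rewrite scaleN1r addrC.
by rewrite multi_partial_lin // scaleN1r addrC.
Qed.

Lemma partialsB s (f h : 'rV[R]_k -> R[i]) : smooth f -> smooth h ->
  partials s (f - h) = partials s f - partials s h.
Proof.
move=> sf sh; have -> : f - h = (-1) *: h + f by rewrite scaleN1r addrC.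
by rewrite partials_lin // scaleN1r addrC.
Qed.

Lemma K_valB (f h : K_fun M) :
  (f - h : K_fun M) = (f : 'rV[R]_k -> R[i]) - h :> ('rV[R]_k -> R[i]).
Proof. by []. Qed.

Lemma K_norm_ub_partials g m (f : K_fun M) x s : (size s <= m)%N ->
  (M g x)%:num * normc (partials s f x) <= K_norm (g, m) f.
Proof.
move=> sm; rewrite partials_multi; last exact: K_smooth.
by apply: K_norm_ub; rewrite multi_order_count.
Qed.

Section Limit.
Variable Fl : set_system (K_space M).
Hypotheses (PF : ProperFilter Fl) (CF : tvs_cauchy Fl).

Lemma K_cauchy g m (e : R) : 0 < e -> exists2 A : set (K_fun M), Fl A &
  forall f h, A f -> A h -> K_norm (g, m) (f - h) < e.
Proof.
move=> e0; have n0 : nbhs (0 : K_space M)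
    (seminorm_ball (p := K_seminorm M) [:: (g, m)] e 0).
  by apply/seminorm_nbhsP; exists [:: (g, m)], e.
have [A FA HA] := CF n0; exists A => // f h Af Ah.
have := HA f h Af Ah; rewrite /seminorm_ball /= andbT sub0r.
by rewrite -[_ < e]/(K_seminorm M (g, m) (- (f - h : K_fun M)) < e) seminormN.
Qed.

(** A weight bounded below near x turns the weighted Cauchy property into a locally uniform one, for
    each derivative. *)
Lemma K_cauchy_local (x : 'rV[R]_k) s (e : R) : 0 < e -> exists2 A : set (K_fun M), Fl A &
  \forall y \near x, forall f h, A f -> A h ->
    normc (partials s f y - partials s h y) <= e.
Proof.
move=> e0; have [g [C C0 Cg]] := posM x.
have [A FA HA] := K_cauchy g (size s) (mulr_gt0 C0 e0).
exists A => //; apply: filterS Cg => y Cy f h Af Ah.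
have := K_norm_ub_partials g (f - h) y (leqnn (size s)).
rewrite K_valB (partialsB s (K_smooth f) (K_smooth h)).
move=> /le_lt_trans/(_ (HA f h Af Ah)) H.
rewrite -(ler_pM2l C0); apply: ltW; apply: le_lt_trans H.
by apply: ler_wpM2r Cy; exact: normc_ge0.
Qed.

Lemma K_pointwise_limit (x : 'rV[R]_k) s : exists v : R[i], forall e : R, 0 < e ->
  Fl [set f : K_fun M | normc (partials s f x - v) <= e].
Proof.
have H (part : R[i] -> R) : (forall a b, part (a - b) = part a - part b) ->
    (forall a, `|part a| <= normc a) -> exists v : R, forall e : R, 0 < e ->
    Fl [set f : K_fun M | `|part (partials s f x) - v| <= e].
  move=> pB pn; apply: real_cauchy_limit => e e0.
  have [A FA /nbhs_singleton HA] := K_cauchy_local x s e0; exists A => // f h Af Ah.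
  by rewrite -pB; apply: le_trans (pn _) (HA _ _ Af Ah).
have [a Ha] := H (@complex.Re R) (fun a b => ltac:(by case: a b => ? ? [])) (@normc_Re R).
have [b Hb] := H (@complex.Im R) (fun a b => ltac:(by case: a b => ? ? [])) (@normc_Im R).
exists (a +i* b) => e e0; have e2 : 0 < e / 2 by rewrite divr_gt0.
apply: filterS2 (Ha _ e2) (Hb _ e2) => f /= fa fb.
apply: le_trans (normc_ReIm _) _.
move: fa fb; case: (partials s f x) => p q /=; lra.
Qed.

(** The candidate for the derivative along [s] of the limit, defined pointwise before any
    differentiability is known; [partialsG] justifies it. *)
Let G s x : R[i] := sval (cid (K_pointwise_limit x s)).

Let GP s x (e : R) : 0 < e -> Fl [set f : K_fun M | normc (partials s f x - G s x) <= e].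
Proof. exact: (svalP (cid (K_pointwise_limit x s))). Qed.

Let limit_le (A : set (K_fun M)) s x (c : R[i]) (m b : R) : Fl A -> 0 <= m ->
  (forall h, A h -> m * normc (c - partials s h x) <= b) -> m * normc (c - G s x) <= b.
Proof.
move=> FA m0 H; apply/ler_addgt0Pl => e e0.
have e1 : 0 < e / (m + 1) by rewrite divr_gt0 // ltr_wpDl.
have [h [Ah hG]] := filter_ex (filterI FA (GP s x e1)).
have := H h Ah; move: hG => /=; set n1 := normc (_ - G s x); set n2 := normc _ => h1 h2.
have : normc (c - G s x) <= n2 + n1.
  by rewrite -(subrK (partials s h x) c) -addrA; exact: le_normcD.
move=> /(ler_wpM2l m0)/le_trans; apply; rewrite mulrDr addrC lerD //.
move: h1; rewrite ler_pdivlMr ?ltr_wpDl // => h1.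
have : 0 <= n1 by exact: normc_ge0.
lra.
Qed.

Lemma G_uniform (x : 'rV[R]_k) s (e : R) : 0 < e -> exists2 A : set (K_fun M), Fl A &
  \forall y \near x, forall f, A f -> normc (partials s f y - G s y) <= e.
Proof.
move=> e0; have [A FA HA] := K_cauchy_local x s e0; exists A => //.
apply: filterS HA => y HA f Af.
rewrite -[leLHS]mul1r; apply: (limit_le FA) => // h Ah.
by rewrite mul1r; exact: HA.
Qed.

Let part_continuous (part : R[i] -> R) s :
  (forall a b, part (a - b) = part a - part b) -> (forall a, `|part a| <= normc a) ->
  (forall f : 'rV[R]_k -> R[i], ccontinuous f -> continuous (fun y => part (f y))) ->
  continuous (fun y => part (G s y)).
Proof.
move=> pB pn pc x.
apply: (@cvgrPdist_le _ _ _ (nbhs x) _ (fun y => part (G s y)) (part (G s x))).2 => e e0.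
have e3 : 0 < e / 3 by rewrite divr_gt0.
have [A FA HA] := G_uniform x s e3; have [f Af] := filter_ex FA.
have /cvgrPdist_le/(_ _ e3) Hf := pc _ (K_smooth f s).1 x.
have hx := le_trans (pn _) (nbhs_singleton HA f Af); rewrite pB in hx.
apply: filterS2 HA Hf => y /(_ f Af) hy /= hf.
have {}hy := le_trans (pn _) hy; rewrite pB in hy.
by move: hx hy hf; rewrite !ler_norml; lra.
Qed.

(** Exchange of limit and derivative: the mean value theorem bounds the increment of h - f by the
    locally uniform distance of the derivatives; h then goes to the limit with f fixed, and f is
    differentiable. *)
Let part_derive (part : R[i] -> R) s i (x : 'rV[R]_k) :
  (forall a b, part (a - b) = part a - part b) -> (forall a, `|part a| <= normc a) ->
  (forall (f : K_fun M) y, is_derive y (delta_mx 0 i) (fun y => part (partials s f y))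
     (part (partials (i :: s) f y))) ->
  is_derive x (delta_mx 0 i) (fun y => part (G s y)) (part (G (i :: s) x)).
Proof.
move=> pB pn pd; set v : 'rV[R]_k := delta_mx 0 i in pd *.
rewrite -[x in is_derive x](add0r x) -(scale0r v).
apply/is_derive_line/is_derive1P => e e0.
have e4 : 0 < e / 4 by rewrite divr_gt0.
have [A FA HA] := G_uniform x (i :: s) e4; have [f Af] := filter_ex FA.
have /nbhs_ballP[r /= r0 Hr] := HA.
have nv : 0 < `|v| + 1 by rewrite ltr_wpDl.
pose l (u : 'rV[R]_k -> R[i]) (t : R) := part (u (t *: v + x)).
have dl (h : K_fun M) t : is_derive t (1 : R) (l (partials s h)) (l (partials (i :: s) h) t).
  by apply/is_derive_line; exact: pd.
have /is_derive1P/(_ _ e4)[r' r'0 Hr'] := dl f 0.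
exists (Num.min r' (r / (`|v| + 1))); first by rewrite lt_min r'0 divr_gt0.
move=> t; rewrite lt_min => /andP[tr' tr]; rewrite add0r -!/(l _ _).
have near_seg c : `|c| <= `|t| -> ball x r (c *: v + x).
  move=> ct; rewrite -ball_normE /ball_ /= opprD addrCA subrr addr0 normrN normrZ.
  move: tr; rewrite ltr_pdivlMr // => tr.
  have := ler_wpM2r (normr_ge0 v) ct; have := normr_ge0 t; lra.
have fG c h : `|c| <= `|t| -> A h -> `|l (partials (i :: s) h) c - l (G (i :: s)) c| <= e / 4.
  by move=> ct Ah; rewrite /l -pB; apply: le_trans (pn _) (Hr _ (near_seg c ct) h Ah).
have D h : A h -> `|(l (partials s h) t - l (partials s f) t) -
     (l (partials s h) 0 - l (partials s f) 0)| <= e / 2 * `|t|.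
  move=> Ah.
  have [c ct ->] : exists2 c, `|c| <= `|t| &
     (l (partials s h) t - l (partials s f) t) - (l (partials s h) 0 - l (partials s f) 0) =
     (l (partials (i :: s) h) c - l (partials (i :: s) f) c) * t.
    have dd y := is_deriveB (dl h y) (dl f y).
    have [t0|t0] := leP 0 t.
      have [c /andP[c0 ct] E] := MVT_global t0 dd; exists c; first by rewrite !ger0_norm.
      by rewrite subr0 in E; exact: E.
    have [c /andP[ct c0] E] := MVT_global (ltW t0) dd.
    exists c; first by rewrite !ler0_norm ?lerN2 // ltW.
    by move: E; rewrite !fctE sub0r => E; lra.
  rewrite normrM ler_wpM2r //.
  by have := fG c h ct Ah; have := fG c f ct Af; rewrite !ler_norml; lra.
have DG : `|(l (G s) t - l (partials s f) t) - (l (G s) 0 - l (partials s f) 0)|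
    <= e / 2 * `|t|.
  (* Only the values at the two ends of the segment occur, so the pointwise limits suffice. *)
  apply/ler_addgt0Pl => d d0; have d2 : 0 < d / 2 by rewrite divr_gt0.
  have [h [Ah [h1 h2]]] := filter_ex (filterI FA (filterI
    (GP s (t *: v + x) d2) (GP s (0 *: v + x) d2))).
  have {}h1 := le_trans (pn _) h1; have {}h2 := le_trans (pn _) h2.
  rewrite !pB -!/(l _ _) in h1 h2; have := D h Ah.
  move: h1 h2; rewrite !ler_norml; lra.
have := Hr' t tr'; rewrite add0r => h1.
have : `|l (partials (i :: s) f) 0 * t - l (G (i :: s)) 0 * t| <= e / 4 * `|t|.
  by rewrite -mulrBl normrM ler_wpM2r //; apply: fG => //; rewrite normr0.
move: h1 DG; have -> : part (G (i :: s) x) = l (G (i :: s)) 0.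
  by rewrite /l scale0r add0r.
have := normr_ge0 t; move: (`|t|) => T T0; rewrite !ler_norml; lra.
Qed.

Let G_derive_Re s i x : is_derive x (delta_mx 0 i) (fun y => complex.Re (G s y))
  (complex.Re (G (i :: s) x)).
Proof.
apply: part_derive => [a b|a|f y]; [by case: a b => ? ? []|exact: normc_Re|].
by have [d _] := (K_smooth f s).2 i y; exact: derivableP.
Qed.

Let G_derive_Im s i x : is_derive x (delta_mx 0 i) (fun y => complex.Im (G s y))
  (complex.Im (G (i :: s) x)).
Proof.
apply: part_derive => [a b|a|f y]; [by case: a b => ? ? []|exact: normc_Im|].
by have [_ d] := (K_smooth f s).2 i y; exact: derivableP.
Qed.

Let partialsG s : partials s (G [::]) = G s.
Proof.
elim: s => //= i s ->; apply/funext => x; rewrite /partial.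
have [_ ->] := G_derive_Re s i x; have [_ ->] := G_derive_Im s i x.
by case: (G (i :: s) x).
Qed.

Let smoothG : smooth (G [::]).
Proof.
move=> s; rewrite partialsG; split.
  split; apply: part_continuous => [a b|a|f []//]; try by case: a b => ? ? [].
    exact: normc_Re.
  exact: normc_Im.
by move=> i x; split; [have [] := G_derive_Re s i x|have [] := G_derive_Im s i x].
Qed.

Let G_norm g m (e : R) : 0 < e -> exists2 A : set (K_fun M), Fl A &
  forall f, A f -> forall x mu, (multi_order mu <= m)%N ->
    (M g x)%:num * normc (multi_partial mu f x - multi_partial mu (G [::]) x) <= e.
Proof.
move=> e0; have [A FA HA] := K_cauchy g m e0; exists A => // f Af x mu mum.
rewrite (multi_partial_seq mu (G [::])) partialsG; apply: (limit_le FA) => // h Ah.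
rewrite -multi_partial_seq; apply: ltW; apply: le_lt_trans (HA f h Af Ah).
have := K_norm_ub g (f - h) x mum.
by rewrite K_valB (multi_partialB mu (K_smooth f) (K_smooth h)).
Qed.

Let G_mem : G [::] \in K_pred M.
Proof.
apply/K_predP; split=> // g m.
have [A FA HA] := G_norm g m ltr01; have [f Af] := filter_ex FA.
exists (K_norm (g, m) f + 1) => _ [x [mu [mum ->]]].
have h1 := HA f Af x mu mum; have h2 := K_norm_ub g f x mum.
apply: le_trans (lerD h2 h1); rewrite -mulrDr ler_wpM2l //.
rewrite -{1}(subrK (multi_partial mu f x) (multi_partial mu (G [::]) x)) addrC.
apply: le_trans (le_normcD _ _) _; rewrite lerD2l -normcN opprB //.
Qed.

Lemma K_limit : exists f : K_space M, Fl --> f.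
Proof.
exists (KFun G_mem : K_space M) => B /seminorm_nbhsP[s [e e0 sB]].
apply: filterS sB _; elim: s => [|[g m] s IH]; first exact: filterS filterT.
have e2 : 0 < e / 2 by rewrite divr_gt0.
have [A FA HA] := G_norm g m e2; apply: filterS2 FA IH => f Af.
rewrite /seminorm_ball /= => ->; rewrite andbT.
have -> : K_norm (g, m) (KFun G_mem - f) = K_norm (g, m) (f - KFun G_mem).
  exact: (seminormB (K_seminorm M (g, m))).
apply: (@le_lt_trans _ _ (e / 2)); last lra.
apply: K_norm_le => x mu mum.
by rewrite K_valB (multi_partialB mu (K_smooth f) smoothG); exact: HA.
Qed.

End Limit.

Lemma K_space_complete : tvs_complete (K_space M).
Proof. by move=> Fl PF CF; exact: K_limit. Qed.

End KSpaceComplete.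

(** * Tensor products of the spaces K(M) *)

Section Slices.
Context (R : realType) (k1 k2 : nat).

Section Precomposition.
Variables (k K : nat) (io : 'rV[R]_k -> 'rV[R]_K) (sg : 'I_k -> 'I_K).
Hypothesis ioE : forall i (t : R) x,
  io (t *: delta_mx 0 i + x) = t *: delta_mx 0 (sg i) + io x.
Hypothesis io_cont : continuous io.

(** Abstracts the two embeddings of a factor into the product, x to (x, y) and y to (x, y). *)
Lemma partial_precomp (h : 'rV[R]_K -> R[i]) i :
  partial i (h \o io) = partial (sg i) h \o io.
Proof.
apply/funext => x; rewrite /partial /=.
have [_ ->] := @derive_transfer R _ _ (fun y => complex.Re (h (io y)))
  (fun z => complex.Re (h z)) x (delta_mx 0 i) (io x) (delta_mx 0 (sg i))
  (fun t => congr1 (fun z => complex.Re (h z)) (ioE i t x)).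
have [_ ->] := @derive_transfer R _ _ (fun y => complex.Im (h (io y)))
  (fun z => complex.Im (h z)) x (delta_mx 0 i) (io x) (delta_mx 0 (sg i))
  (fun t => congr1 (fun z => complex.Im (h z)) (ioE i t x)).
by [].
Qed.

Lemma partials_precomp (h : 'rV[R]_K -> R[i]) s :
  partials s (h \o io) = partials (map sg s) h \o io.
Proof.
elim: s => //= i s IH.
by rewrite -[partial _ (foldr _ _ s)]/(partial i (partials s (h \o io))) IH partial_precomp.
Qed.

Lemma smooth_precomp (h : 'rV[R]_K -> R[i]) : smooth h -> smooth (h \o io).
Proof.
move=> sh s; rewrite partials_precomp; have [[cr ci] dh] := sh (map sg s).
split.
  split=> x.
    exact: (continuous_comp (io_cont (x := x)) (cr (io x))).
  exact: (continuous_comp (io_cont (x := x)) (ci (io x))).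
move=> i x; have [dr di] := dh (sg i) (io x); split.
  apply: (@derive_transfer R _ _ _ _ x (delta_mx 0 i) (io x) (delta_mx 0 (sg i)) _).1.2 dr.
  by move=> t; rewrite /= ioE.
apply: (@derive_transfer R _ _ _ _ x (delta_mx 0 i) (io x) (delta_mx 0 (sg i)) _).1.2 di.
by move=> t; rewrite /= ioE.
Qed.

End Precomposition.

Definition mi_pair (n1 : multi_index k1) (n2 : multi_index k2) : multi_index (k1 + k2) :=
  [ffun i : 'I_(k1 + k2) => match fintype.split i with inl j => n1 j | inr j => n2 j end].

Lemma mi_pair_l n1 n2 j : mi_pair n1 n2 (lshift k2 j) = n1 j.
Proof. by rewrite ffunE -[lshift k2 j]/(unsplit (inl j)) unsplitK. Qed.

Lemma mi_pair_r n1 n2 j : mi_pair n1 n2 (rshift k1 j) = n2 j.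
Proof. by rewrite ffunE -[rshift k1 j]/(unsplit (inr j)) unsplitK. Qed.

Lemma mi_pairE (mu : multi_index (k1 + k2)) :
  mi_pair [ffun j => mu (lshift k2 j)] [ffun j => mu (rshift k1 j)] = mu.
Proof.
apply/ffunP => i; case: (split_ordP i) => j ->.
  by rewrite mi_pair_l ffunE.
by rewrite mi_pair_r ffunE.
Qed.

Lemma multi_order_pair n1 n2 :
  multi_order (mi_pair n1 n2) = (multi_order n1 + multi_order n2)%N.
Proof.
rewrite /multi_order big_split_ord /=; congr (_ + _)%N; apply: eq_bigr => j _.
  by rewrite mi_pair_l.
by rewrite mi_pair_r.
Qed.

Lemma row_mx_l (y : 'rV[R]_k2) i (t : R) (x : 'rV[R]_k1) :
  row_mx (t *: delta_mx 0 i + x) y = t *: delta_mx 0 (lshift k2 i) + row_mx x y.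
Proof.
apply/rowP => j; case: (split_ordP j) => l ->; rewrite [RHS]mxE ![X in _ = X + _]mxE.
  by rewrite !row_mxEl !mxE (inj_eq (@lshift_inj _ _)).
by rewrite !row_mxEr !mxE eqxx /= eq_rlshift mulr0 add0r.
Qed.

Lemma row_mx_r (x : 'rV[R]_k1) i (t : R) (y : 'rV[R]_k2) :
  row_mx x (t *: delta_mx 0 i + y) = t *: delta_mx 0 (rshift k1 i) + row_mx x y.
Proof.
apply/rowP => j; case: (split_ordP j) => l ->; rewrite [RHS]mxE ![X in _ = X + _]mxE.
  by rewrite !row_mxEl !mxE eqxx /= eq_lrshift mulr0 add0r.
by rewrite !row_mxEr !mxE (inj_eq (@rshift_inj _ _)).
Qed.

Lemma isometry_continuous (k K : nat) (io : 'rV[R]_k -> 'rV[R]_K) :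
  (forall x x', `|io x - io x'| <= `|x - x'|) -> continuous io.
Proof.
move=> H x; apply: (@cvgrPdist_lt _ _ _ (nbhs x) _ io (io x)).2 => e e0.
apply/nbhs_ballP; exists e => // x' /=; rewrite -ball_normE /ball_ /=.
exact: le_lt_trans.
Qed.

Lemma row_mx_l_continuous (y : 'rV[R]_k2) : continuous (fun x : 'rV[R]_k1 => row_mx x y).
Proof.
apply: isometry_continuous => x x'; rewrite opp_row_mx add_row_mx subrr.
apply/rV_normP => // i; rewrite mxE; case: (fintype.split i) => j; first exact: coord_le_norm.
by rewrite mxE normr0.
Qed.

Lemma row_mx_r_continuous (x : 'rV[R]_k1) : continuous (fun y : 'rV[R]_k2 => row_mx x y).
Proof.
apply: isometry_continuous => y y'; rewrite opp_row_mx add_row_mx subrr.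
apply/rV_normP => // i; rewrite mxE; case: (fintype.split i) => j; last exact: coord_le_norm.
by rewrite mxE normr0.
Qed.

Variable h : 'rV[R]_(k1 + k2) -> R[i].
Hypothesis sh : smooth h.

Let mi0 {k} : multi_index k := [ffun=> 0%N].

Lemma smooth_slice_l n2 y :
  smooth (fun x : 'rV[R]_k1 => multi_partial (mi_pair mi0 n2) h (row_mx x y)).
Proof.
exact (@smooth_precomp _ _ (fun x => row_mx x y) (@lshift k1 k2) (row_mx_l y)
  (@row_mx_l_continuous y) _ (smooth_multi_partial (mi_pair mi0 n2) sh)).
Qed.

Lemma smooth_slice_r n1 x :
  smooth (fun y : 'rV[R]_k2 => multi_partial (mi_pair n1 mi0) h (row_mx x y)).
Proof.
exact (@smooth_precomp _ _ (fun y => row_mx x y) (@rshift k1 k2) (row_mx_r x)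
  (@row_mx_r_continuous x) _ (smooth_multi_partial (mi_pair n1 mi0) sh)).
Qed.

Let count_map_inj (k K : nat) (f : 'I_k -> 'I_K) s i : injective f ->
  count_mem (f i) (map f s) = count_mem i s.
Proof. by move=> fi; rewrite count_map; apply: eq_count => j /=; rewrite (inj_eq fi). Qed.

Lemma multi_partial_slice_l n1 n2 x y :
  multi_partial n1 (fun x => multi_partial (mi_pair mi0 n2) h (row_mx x y)) x =
  multi_partial (mi_pair n1 n2) h (row_mx x y).
Proof.
rewrite multi_partial_seq; have := @partials_precomp _ _ (fun x => row_mx x y)
  (@lshift k1 k2) (row_mx_l y) (multi_partial (mi_pair mi0 n2) h) (mi_seq n1).
move=> /(congr1 (@^~ x)) /= ->.
rewrite !multi_partial_seq /partials -foldr_cat.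
apply: (congr1 (fun f => f (row_mx x y))).
apply: partials_perm => //; apply/allP => i _ /=.
rewrite count_cat !count_mi_seq; case: (split_ordP i) => j ->.
  by rewrite !mi_pair_l ffunE addn0 count_map_inj ?count_mi_seq //; exact: lshift_inj.
rewrite !mi_pair_r count_map (@eq_count _ _ pred0) ?count_pred0 // => l /=.
by rewrite eq_lrshift.
Qed.

Lemma multi_partial_slice_r n1 n2 x y :
  multi_partial n2 (fun y => multi_partial (mi_pair n1 mi0) h (row_mx x y)) y =
  multi_partial (mi_pair n1 n2) h (row_mx x y).
Proof.
rewrite multi_partial_seq; have := @partials_precomp _ _ (fun y => row_mx x y)
  (@rshift k1 k2) (row_mx_r x) (multi_partial (mi_pair n1 mi0) h) (mi_seq n2).
move=> /(congr1 (@^~ y)) /= ->.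
rewrite !multi_partial_seq /partials -foldr_cat.
apply: (congr1 (fun f => f (row_mx x y))).
apply: partials_perm => //; apply/allP => i _ /=.
rewrite count_cat !count_mi_seq; case: (split_ordP i) => j ->; last first.
  by rewrite !mi_pair_r ffunE addn0 count_map_inj ?count_mi_seq //; exact: rshift_inj.
rewrite !mi_pair_l count_map (@eq_count _ _ pred0) ?count_pred0 // => l /=.
by rewrite eq_rlshift.
Qed.

End Slices.

(** * Reduction to a single seminorm *)

Section Seminorms.
Context (R : realType).

Lemma le_of_lin (a b c : R) : 0 <= c ->
  (forall e : R, 0 < e -> a <= b + c * e) -> a <= b.
Proof.
move=> c0 H; apply/ler_addgt0Pl => e e0.
have e1 : 0 < e / (c + 1) by rewrite divr_gt0 // ltr_wpDl.
apply: le_trans (H _ e1) _; rewrite addrC lerD2r mulrA ler_pdivrMr ?ltr_wpDl //.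
by rewrite mulrC ler_pM2l // lerDl.
Qed.

Lemma seminorm_sum (V : lmodType R[i]) (q : seminorm V) (I : Type) (r : seq I) (h : I -> V) :
  q (\sum_(i <- r) h i) <= \sum_(i <- r) q (h i).
Proof.
elim: r => [|i r IH]; first by rewrite !big_nil seminorm0.
by rewrite !big_cons; apply: le_trans (seminormD _ _ _) _; rewrite lerD2l.
Qed.

Variables (k : nat) (Gamma : Type) (M : Gamma -> 'rV[R]_k -> {nonneg R}).

Lemma K_norm_ge0 gm (f : K_fun M) : 0 <= K_norm gm f.
Proof. exact: (seminorm_ge0 (K_seminorm M gm)). Qed.

Lemma K_normZ gm (a : R[i]) (f : K_fun M) : K_norm gm (a *: f) = normc a * K_norm gm f.
Proof. exact: (seminormZ (K_seminorm M gm)). Qed.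

Lemma K_norm_le_scaled g m (f : K_fun M) (c b : R) : 0 <= c ->
  (forall x mu, (multi_order mu <= m)%N ->
    c * ((M g x)%:num * normc (multi_partial mu f x)) <= b) ->
  c * K_norm (g, m) f <= b.
Proof.
move=> c0 H; have [cp|] := ltP 0 c.
  rewrite mulrC -ler_pdivlMr //; apply: K_norm_le => x mu mum.
  by rewrite ler_pdivlMr // mulrC; exact: H.
move=> c0'; have z : c = 0 by apply/eqP; rewrite eq_le c0' c0.
have := H 0 [ffun=> 0%N]; rewrite multi_order0 z !mul0r; exact.
Qed.

Lemma K_norm_mono g1 m1 g m (c : R) (f : K_fun M) : 0 <= c -> (m1 <= m)%N ->
  (forall x, c * (M g1 x)%:num <= (M g x)%:num) ->
  c * K_norm (g1, m1) f <= K_norm (g, m) f.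
Proof.
move=> c0 mm Mc; apply: K_norm_le_scaled => // x mu mum.
rewrite mulrA; apply: le_trans (K_norm_ub g f x (leq_trans mum mm)).
by rewrite ler_wpM2r ?normc_ge0.
Qed.

Hypothesis inhM : exists g : Gamma, True.
Hypothesis dirM : forall g1 g2, exists g, exists2 C : R, 0 < C &
    forall x, C * ((M g1 x)%:num + (M g2 x)%:num) <= (M g x)%:num.

(** Directedness of the weights lets one seminorm dominate finitely many. *)
Lemma K_ball_single (s : seq (Gamma * nat)) (e : R) : 0 < e ->
  exists gm, exists2 c : R, 0 < c & forall f : K_fun M, K_norm gm f < c ->
    all (fun i => K_norm i f < e) s.
Proof.
move=> e0; elim: s => [|[g1 m1] s [[g2 m2] [c c0 H]]].
  by have [g _] := inhM; exists (g, 0%N), 1.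
have [g [C C0 HC]] := dirM g1 g2.
exists (g, maxn m1 m2), (C * Num.min e c); first by rewrite mulr_gt0 // lt_min e0.
move=> f fc; have l1 : C * K_norm (g1, m1) f <= K_norm (g, maxn m1 m2) f.
  apply: K_norm_mono; rewrite ?leq_maxl ?(ltW C0) // => x.
  by apply: le_trans (HC x); rewrite ler_pM2l // lerDl.
have l2 : C * K_norm (g2, m2) f <= K_norm (g, maxn m1 m2) f.
  apply: K_norm_mono; rewrite ?leq_maxr ?(ltW C0) // => x.
  by apply: le_trans (HC x); rewrite ler_pM2l // lerDr.
have := le_lt_trans l1 fc; have := le_lt_trans l2 fc.
rewrite !ltr_pM2l // !lt_min => /andP[_ fc2] /andP[fe1 _].
by apply/andP; split=> //; exact: H.
Qed.

End Seminorms.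

(** * Projective seminorms as bilinear estimates *)

Section TensorOfK.
Context (R : realType) (k1 k2 : nat) (Gamma Omega : Type).
Variables (M : Gamma -> 'rV[R]_k1 -> {nonneg R}) (N : Omega -> 'rV[R]_k2 -> {nonneg R}).

Local Notation F := (K_space M).
Local Notation G := (K_space N).
Local Notation H := (K_space (tensor_family M N)).
Local Notation P := (projective_tensor F G).

Definition tensor_map : tensor F G -> H := tensor_lift (K_prod M N).

Lemma tensor_map_lin : linear tensor_map.
Proof. exact: tensor_lift_linear. Qed.

Lemma tensor_map_class (s : seq (F * G)) :
  tensor_map (tensor_class s) = \sum_(p <- s) K_prod M N p.1 p.2.
Proof. exact: tensor_lift_class. Qed.

Lemma K_norm_prod g m o (f : F) (h : G) :
  K_norm ((g, o), m) (K_prod M N f h) <= K_norm (g, m) f * K_norm (o, m) h.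
Proof.
apply: K_norm_le => z mu mum.
have -> : multi_partial mu (K_prod M N f h : K_fun _) =
    prod_fun (multi_partial [ffun i => mu (lshift k2 i)] f)
             (multi_partial [ffun i => mu (rshift k1 i)] h).
  exact: (multi_partial_prod mu (K_smooth f) (K_smooth h)).
rewrite -{1}(mi_pairE mu) multi_order_pair in mum.
rewrite /prod_fun normcM /= mulrACA; apply: ler_pM.
- by rewrite mulr_ge0 // normc_ge0.
- by rewrite mulr_ge0 // normc_ge0.
- by apply: K_norm_ub; apply: leq_trans mum; rewrite leq_addr.
- by apply: K_norm_ub; apply: leq_trans mum; rewrite leq_addl.
Qed.

Lemma continuous_of_bound (q : seminorm (tensor F G)) (C : R) gm om : 0 <= C ->
  (forall f h, q (pure_tensor f h) <= C * K_norm gm f * K_norm om h) ->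
  continuous (fun fg : F * G => pure_tensor fg.1 fg.2 : seminormed (fun _ : unit => q)).
Proof.
move=> C0 qC [f0 h0] A /seminorm_nbhsP[s [e e0 sA]].
pose a := K_norm gm f0; pose b := K_norm om h0.
have a0 : 0 <= a by exact: K_norm_ge0.
have b0 : 0 <= b by exact: K_norm_ge0.
pose c := C * (a + b + 1) + 1.
have c0 : 0 < c by rewrite /c ltr_wpDl // mulr_ge0 //; lra.
pose d := Num.min 1 (e / c).
have d0 : 0 < d by rewrite lt_min ltr01 divr_gt0.
exists (seminorm_ball (p := K_seminorm M) [:: gm] d f0,
        seminorm_ball (p := K_seminorm N) [:: om] d h0).
  by split; apply/seminorm_nbhsP; [exists [:: gm], d|exists [:: om], d].
move=> [f h] [/= ff hh]; apply: sA.
have {ff} : K_norm gm (f0 - f) < d by move: ff; rewrite /seminorm_ball /= andbT.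
have {hh} : K_norm om (h0 - h) < d by move: hh; rewrite /seminorm_ball /= andbT.
set x := K_norm om _; set y := K_norm gm _ => xd yd.
have x0 : 0 <= x by exact: K_norm_ge0.
have y0 : 0 <= y by exact: K_norm_ge0.
suff qe : q (pure_tensor f0 h0 - pure_tensor f h) < e.
  by rewrite /seminorm_ball /=; elim: (s) => //= _ s' ->; rewrite andbT.
(* Each term has an increment as a factor and otherwise only the fixed [f0], [h0] or another
   increment. *)
have -> : pure_tensor f0 h0 - pure_tensor f h =
    pure_tensor (f0 - f) h0 + (pure_tensor f0 (h0 - h) - pure_tensor (f0 - f) (h0 - h)).
  by rewrite !linearBl !linearBr /= subKr addrA subrK.
apply: le_lt_trans (seminormD _ _ _) _.
apply: le_lt_trans (lerD (lexx _) (seminormD _ _ _)) _; rewrite seminormN.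
apply: le_lt_trans (lerD (qC _ _) (lerD (qC _ _) (qC _ _))) _.
have d1 : d <= 1 by rewrite ge_min lexx.
have de : d * c <= e by rewrite -ler_pdivlMr // ge_min lexx orbT.
rewrite -!mulrA -!mulrDr -/a -/b -/x -/y.
have : y * b + (a * x + y * x) <= d * (a + b + 1).
  have h1 : y * b <= d * b by rewrite ler_wpM2r // ltW.
  have h2 : a * x <= a * d by rewrite ler_wpM2l // ltW.
  have h3 : y * x <= d * 1 by apply: ler_pM => //; [exact: ltW|exact: le_trans (ltW xd) d1].
  lra.
move=> /(ler_wpM2l C0) /le_lt_trans; apply; apply: lt_le_trans de.
by rewrite /c [ltRHS]mulrDr mulr1 [in ltLHS]mulrCA ltrDl.
Qed.

(** Continuity of T: the seminorms of the target, pulled back, are among those defining the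
    projective topology. *)
Lemma pullback_seminorm i : exists q : projective_seminorm F G, forall u,
  sval q u = K_norm i (tensor_map u : K_fun _).
Proof.
pose p := K_seminorm (tensor_family M N) i.
have qD u v : p (tensor_map (u + v)) <= p (tensor_map u) + p (tensor_map v).
  have -> : tensor_map (u + v) = tensor_map u + tensor_map v.
    by have := tensor_map_lin 1 u v; rewrite !scale1r.
  exact: (seminormD p).
have qZ a u : p (tensor_map (a *: u)) = normc a * p (tensor_map u).
  have -> : tensor_map (a *: u) = a *: tensor_map u.
    have t0 : tensor_map 0 = 0 by rewrite /tensor_map linear0.
    by have := tensor_map_lin a u 0; rewrite !addr0 t0 addr0.
  exact: (seminormZ p).
pose q : seminorm (tensor F G) := Seminorm qD qZ.
case: i @p qD qZ @q => [[g o] m] p qD qZ q.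
have qc : continuous (fun fg : F * G =>
    pure_tensor fg.1 fg.2 : seminormed (fun _ : unit => q)).
  apply: (@continuous_of_bound q 1 (g, m) (o, m)) => // f h.
  rewrite mul1r; apply: le_trans (K_norm_prod g m o f h).
  rewrite -[q _]/(K_norm _ (tensor_map (pure_tensor f h))).
  by rewrite tensor_map_class big_seq1.
by exists (exist _ q qc).
Qed.

Hypotheses (dfM : defining_family M) (dfN : defining_family N).

Lemma projective_bound (q : projective_seminorm F G) :
  exists gm om, exists2 C : R, 0 <= C &
    forall (f : F) (h : G), sval q (pure_tensor f h) <= C * K_norm gm f * K_norm om h.
Proof.
have inhM : exists g : Gamma, True by have [g _] := df_positive dfM 0; exists g.
have inhN : exists g : Omega, True by have [g _] := df_positive dfN 0; exists g.
have : nbhs ((0, 0) : F * G) [set fg | sval q (pure_tensor fg.1 fg.2) < 1].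
  have := svalP q (0, 0) [set t | sval q (pure_tensor 0 0 - t) < 1].
  have -> : pure_tensor (0 : F) (0 : G) = 0 by rewrite linear0l.
  move=> H; have {H} : nbhs ((0, 0) : F * G) [set fg | sval q (0 - pure_tensor fg.1 fg.2) < 1].
    apply: H; apply/seminorm_nbhsP; exists [:: tt], 1 => // y.
    by rewrite /seminorm_ball /= andbT.
  by apply: filterS => fg /=; rewrite sub0r seminormN.
move=> [[U V] /= [/seminorm_nbhsP[s [e e0 sU]] /seminorm_nbhsP[t [d d0 tV]]] UV].
have [gm [c c0 Hc]] := K_ball_single inhM (df_directed dfM) s e0.
have [om [b b0 Hb]] := K_ball_single inhN (df_directed dfN) t d0.
have {UV Hc Hb sU tV} key f h : K_norm gm f < c -> K_norm om h < b ->
    sval q (pure_tensor f h) < 1.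
  move=> fc hb; apply: (UV (f, h)); split; [apply: sU|apply: tV].
    rewrite /seminorm_ball /=; apply: sub_all (Hc _ fc) => i.
    by rewrite (_ : K_norm i (0 - f) = K_norm i f) // sub0r; exact: (seminormN (K_seminorm M i)).
  rewrite /seminorm_ball /=; apply: sub_all (Hb _ hb) => i.
  by rewrite (_ : K_norm i (0 - h) = K_norm i h) // sub0r; exact: (seminormN (K_seminorm N i)).
exists gm, om, (c * b)^-1; first by rewrite invr_ge0 mulr_ge0 ?ltW.
move=> f h; set A := K_norm gm f; set B := K_norm om h.
have A0 : 0 <= A by exact: K_norm_ge0.
have B0 : 0 <= B by exact: K_norm_ge0.
apply: (@le_of_lin _ _ _ ((c * b)^-1 * (A + B + 1))) => [|eta eta0].
  by rewrite mulr_ge0 ?invr_ge0 ?mulr_ge0 ?(ltW c0) ?(ltW b0) //; lra.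
(* The seminorms of f and h may vanish, so f and h are normalized by A + x and B + x; the excess is
   then removed by letting [eta] tend to 0. *)
pose x := Num.min eta 1.
have x0 : 0 < x by rewrite lt_min eta0 ltr01.
have [xe x1] : x <= eta /\ x <= 1 by rewrite !ge_min !lexx orbT.
have ax : 0 < A + x by rewrite ltr_wpDl.
have bx : 0 < B + x by rewrite ltr_wpDl.
have := key ((c / (A + x))%:C *: f) ((b / (B + x))%:C *: h).
rewrite !K_normZ !normc_real !gtr0_norm ?divr_gt0 // -/A -/B.
rewrite ![_ / _ * _]mulrAC !ltr_pdivrMr // !ltr_pM2l // !ltrDl x0 => /(_ isT isT).
rewrite linearZl_LR linearZr_LR /= !seminormZ !normc_real !gtr0_norm ?divr_gt0 //.
move=> lt1; have {lt1} : c / (A + x) * (b / (B + x)) * sval q (pure_tensor f h) < 1.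
  by rewrite -mulrA.
have p0 : 0 < c / (A + x) * (b / (B + x)) by apply: mulr_gt0; exact: divr_gt0.
rewrite -(ltr_pdivlMl _ _ p0) mulr1 => /ltW /le_trans; apply.
have -> : (c / (A + x) * (b / (B + x)))^-1 = (c * b)^-1 * ((A + x) * (B + x)).
  by field; rewrite !lt0r_neq0.
rewrite -!mulrA -!mulrDr ler_pM2l ?invr_gt0 ?mulr_gt0 //.
have h1 : (A + B + x) * x <= (A + B + 1) * eta.
  by apply: ler_pM => //; [rewrite addr_ge0 ?addr_ge0 // ltW|exact: ltW|rewrite lerD2l].
clear -h1; lra.
Qed.

End TensorOfK.

Section KPartial.
Context (R : realType) (k : nat) (Gamma : Type) (M : Gamma -> 'rV[R]_k -> {nonneg R}).
Implicit Types f h : K_fun M.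

Lemma K_partialD mu f h x :
  multi_partial mu (f + h : K_fun M) x = multi_partial mu f x + multi_partial mu h x.
Proof.
have := multi_partial_lin mu 1 (K_smooth f) (K_smooth h).
by rewrite !scale1r => /(congr1 (@^~ x)).
Qed.

Lemma K_partialZ mu (a : R[i]) f x :
  multi_partial mu (a *: f : K_fun M) x = a * multi_partial mu f x.
Proof.
have := multi_partial_lin mu a (K_smooth f) (@smooth0 R k).
have [s E] := multi_partialE R mu; rewrite !E partials0 !addr0.
by move=> /(congr1 (@^~ x)).
Qed.

Lemma K_partialB mu f h x :
  multi_partial mu (f - h : K_fun M) x = multi_partial mu f x - multi_partial mu h x.
Proof. by rewrite K_partialD -scaleN1r K_partialZ mulN1r. Qed.

Lemma K_partial_sum mu (I : Type) (r : seq I) (h : I -> K_fun M) x :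
  multi_partial mu (\sum_(i <- r) h i : K_fun M) x = \sum_(i <- r) multi_partial mu (h i) x.
Proof.
elim: r => [|i r IH]; last by rewrite !big_cons K_partialD IH.
by rewrite !big_nil; have [s ->] := multi_partialE R mu; rewrite partials0.
Qed.

Lemma K_val_sum (I : Type) (r : seq I) (h : I -> K_fun M) x :
  (\sum_(i <- r) h i : K_fun M) x = \sum_(i <- r) h i x.
Proof.
rewrite -[LHS](congr1 (@^~ x) (multi_partial0 _)) K_partial_sum.
by apply: eq_bigr => i _; rewrite multi_partial0.
Qed.

End KPartial.

(** * Injectivity of T and domination of the projective seminorms *)

Section ProjectiveNorm.
Context (R : realType) (k1 k2 : nat) (Gamma Omega : Type).
Variables (M : Gamma -> 'rV[R]_k1 -> {nonneg R}) (N : Omega -> 'rV[R]_k2 -> {nonneg R}).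

Local Notation F := (K_space M).
Local Notation G := (K_space N).
Local Notation H := (K_space (tensor_family M N)).

(* If f x <> 0, evaluation at x writes h as a combination of the other second
   factors, which gives a representation with one term less. *)
Lemma pure_sum_eq0 (s : seq (F * G)) :
  \sum_(p <- s) K_prod M N p.1 p.2 = 0 -> \sum_(p <- s) pure_tensor p.1 p.2 = 0.
Proof.
have [n] := ubnP (size s); elim: n s => // n IH [|[f h] s]; first by rewrite !big_nil.
rewrite ltnS => sn; rewrite !big_cons /=; have [->|f0] := eqVneq f 0.
  by rewrite !linear0l !add0r; exact: IH.
have [x fx0] : exists x, f x != 0.
  apply: contrapT => fx; move/eqP: f0; apply; apply: val_inj; apply/funext => x /=.
  by apply/eqP; apply: contrapT => /negP; move=> ?; apply: fx; exists x.
move=> sum0; pose c (p : F * G) : R[i] := - (p.1 x / f x).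
have hE : h = \sum_(p <- s) c p *: p.2.
  apply: val_inj; apply/funext => y.
  have : (K_prod M N f h : K_fun _) (row_mx x y) +
      \sum_(p <- s) (K_prod M N p.1 p.2 : K_fun _) (row_mx x y) = 0.
    rewrite -(K_val_sum s (fun p => K_prod M N p.1 p.2 : K_fun _)).
    exact: (congr1 (fun u : H => (u : K_fun _) (row_mx x y)) sum0).
  rewrite /= /prod_fun row_mxKl row_mxKr => /eqP.
  rewrite addr_eq0 => /eqP fh; rewrite [RHS]K_val_sum.
  apply: (mulfI fx0); rewrite fh mulr_sumr -sumrN; apply: eq_bigr => p _.
  by rewrite -[RHS]/(f x * (c p * p.2 y)) /c mulrA mulrN mulrCA divff // mulr1 mulNr.
pose s' := [seq (c p *: f + p.1, p.2) | p <- s].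
(* Needed for two bilinear maps: [K_prod] to carry the hypothesis over to [s'], the pure tensor to
   bring the conclusion back. *)
have E (V : lmodType R[i]) (B : {bilinear F -> G -> V}) :
    \sum_(p <- s') B p.1 p.2 = B f h + \sum_(p <- s) B p.1 p.2.
  rewrite big_map hE linear_sumr -big_split /=; apply: eq_bigr => p _.
  by rewrite linearDl linearZl_LR linearZr_LR.
have := E _ (pure_tensor (F := F) (G := G)); rewrite /= => <-.
by apply: IH; rewrite ?size_map // (E _ (K_prod M N)).
Qed.

Hypotheses (dfM : defining_family M) (dfN : defining_family N).
Hypotheses (M1 : condition_I M) (M2 : condition_II M).

Local Notation tmap := (@tensor_map R k1 k2 Gamma Omega M N).

(** The combination of second factors is a derivative of the slice of T u at t, so its size depends
    on T u alone and not on the representation [s]. *)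
Lemma tensor_map_slice_le g o m n (s : seq (F * G)) (nu : multi_index k1) (t : 'rV[R]_k1) :
  (multi_order nu <= m)%N ->
  (M g t)%:num * K_norm (o, n) (\sum_(p <- s) multi_partial nu p.1 t *: p.2 : G) <=
    K_norm ((g, o), (m + n)%N) (tmap (tensor_class s) : K_fun _).
Proof.
move=> num; apply: K_norm_le_scaled => // y mu mun.
have mm : (multi_order (mi_pair nu mu) <= m + n)%N by rewrite multi_order_pair leq_add.
apply: le_trans (K_norm_ub (g, o) (tmap (tensor_class s) : K_fun _) (row_mx t y) mm).
rewrite /= row_mxKl row_mxKr mulrA ler_wpM2l ?mulr_ge0 // le_eqVlt; apply/orP; left.
apply/eqP; congr normc; rewrite tensor_map_class.
rewrite (K_partial_sum mu s (fun p => multi_partial nu p.1 t *: p.2 : K_fun N)).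
rewrite (K_partial_sum _ s (fun p => K_prod M N p.1 p.2 : K_fun _)).
apply: eq_bigr => p _; rewrite K_partialZ.
rewrite (multi_partial_prod _ (K_smooth p.1) (K_smooth p.2)) /prod_fun row_mxKl row_mxKr.
have -> : [ffun i => mi_pair nu mu (lshift k2 i)] = nu.
  by apply/ffunP => j; rewrite ffunE mi_pair_l.
have -> // : [ffun i => mi_pair nu mu (rshift k1 i)] = mu.
by apply/ffunP => j; rewrite ffunE mi_pair_r.
Qed.

Lemma projective_le_K_norm (q : projective_seminorm F G) :
  exists i, exists2 C : R, 0 <= C & forall u, sval q u <= C * K_norm i (tmap u : K_fun _).
Proof.
have [[g m] [on [C0 C00 qC]]] := projective_bound dfM dfN q; case: on qC => o n qC.
have [g' [m' [C [Cge0 approx]]]] := K_approx dfM M1 M2 g m.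
exists ((g', o), (m' + n)%N), (C0 * C); first exact: mulr_ge0.
elim/tensorP => s; set W := K_norm _ _.
(* This number depends on the representation and may be far larger than the seminorm of T u; it only
   multiplies [eps]. *)
pose c := C0 * \sum_(p <- s) K_norm (g', m') p.1 * K_norm (o, n) p.2.
have c0 : 0 <= c.
  by rewrite mulr_ge0 // sumr_ge0 // => p _; rewrite mulr_ge0 // K_norm_ge0.
apply: (le_of_lin c0) => eps eps0.
have [J [nu [t [e [num [kap kapC ekap] rem]]]]] := approx eps eps0.
pose S (f : F) : F := \sum_A multi_partial (nu A) f (t A) *: e A.
pose GA A : G := \sum_(p <- s) multi_partial (nu A) p.1 (t A) *: p.2.
(* Bilinearity regroups the approximants of the first factors by node, and the second factors
   collect into [GA A]. *)
have -> : tensor_class s = \sum_A pure_tensor (e A : F) (GA A) +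
    \sum_(p <- s) pure_tensor (p.1 - S p.1) p.2.
  rewrite tensor_class_sum.
  under [X in _ = _ + X]eq_bigr => p _ do rewrite linearBl.
  rewrite sumrB /= addrC -addrA -[LHS]addr0; congr (_ + _).
  apply/esym/eqP; rewrite addrC subr_eq0; apply/eqP.
  under eq_bigr => A _ do rewrite linear_sumr.
  rewrite exchange_big; apply: eq_bigr => p _.
  rewrite linear_sumlz; apply: eq_bigr => A _.
  by rewrite linearZl_LR linearZr_LR.
apply: le_trans (seminormD _ _ _) _; apply: lerD.
  apply: le_trans (seminorm_sum _ _ _) _.
  rewrite mulrAC; apply: (@le_trans _ _ (\sum_A C0 * W * kap A)).
    apply: ler_sum => A _; apply: le_trans (qC _ _) _.
    rewrite -!mulrA ler_wpM2l // mulrC; have [kap0 ek] := ekap A.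
    apply: le_trans (ler_wpM2l (K_norm_ge0 _ _) ek) _.
    rewrite mulrCA mulrC ler_wpM2r // mulrC.
    exact: tensor_map_slice_le.
  rewrite -mulr_sumr ler_wpM2l // mulr_ge0 //; exact: K_norm_ge0.
apply: le_trans (seminorm_sum _ _ _) _.
rewrite /c -mulrA mulr_suml mulr_sumr; apply: ler_sum => p _.
apply: le_trans (qC _ _) _; rewrite -!mulrA ler_wpM2l // [_ * eps]mulrC mulrA.
rewrite ler_wpM2r ?K_norm_ge0 // mulrC; apply: K_norm_le => x mu mum.
have V0 : 0 <= K_norm (g', m') p.1 by exact: K_norm_ge0.
have := rem p.1 _ (K_smooth p.1) V0 (fun x nu num => K_norm_ub _ p.1 x num) x mu mum.
congr (_ * normc _ <= _).
rewrite [RHS](K_partialB mu (p.1 : K_fun M) (S p.1)) (K_partial_sum _ _ (fun A => multi_partial (nu A) p.1 (t A) *: e A)).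
by congr (_ - _); apply: eq_bigr => A _; rewrite K_partialZ.
Qed.

End ProjectiveNorm.

(** * The tensor product as a dense topological subspace *)

Section TensorCompletion.
Context (R : realType) (k1 k2 : nat) (Gamma Omega : Type).
Variables (M : Gamma -> 'rV[R]_k1 -> {nonneg R}) (N : Omega -> 'rV[R]_k2 -> {nonneg R}).
Hypotheses (dfM : defining_family M) (dfN : defining_family N).
Hypotheses (M1 : condition_I M) (M2 : condition_II M).

Local Notation F := (K_space M).
Local Notation G := (K_space N).
Local Notation H := (K_space (tensor_family M N)).
Local Notation P := (projective_tensor F G).
Local Notation tmap := (@tensor_map R k1 k2 Gamma Omega M N).

Lemma tensor_family_directed (a b : Gamma * Omega) : exists c, exists2 C : R, 0 < C &
  forall z, C * ((tensor_family M N a z)%:num + (tensor_family M N b z)%:num) <=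
    (tensor_family M N c z)%:num.
Proof.
case: a b => [g1 o1] [g2 o2].
have [g [C C0 HC]] := df_directed dfM g1 g2; have [om [D D0 HD]] := df_directed dfN o1 o2.
exists (g, om), (C * D); first exact: mulr_gt0.
move=> z /=; set a := (M g1 _)%:num; set b := (M g2 _)%:num.
set c := (N o1 _)%:num; set d := (N o2 _)%:num.
have [a0 b0 c0 d0] : [/\ 0 <= a, 0 <= b, 0 <= c & 0 <= d] by rewrite /a /b /c /d.
apply: (@le_trans _ _ (C * (a + b) * (D * (c + d)))).
  rewrite mulrACA ler_pM2l ?mulr_gt0 // !mulrDr !mulrDl -!addrA lerD2l.
  by rewrite addrA lerDr; apply: addr_ge0; apply: mulr_ge0.
apply: ler_pM; [| |exact: HC|exact: HD].
  by rewrite mulr_ge0 ?(ltW C0) // addr_ge0.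
by rewrite mulr_ge0 ?(ltW D0) // addr_ge0.
Qed.

Lemma tensor_family_positive (z : 'rV[R]_(k1 + k2)) : exists c, exists2 C : R, 0 < C &
  \forall z' \near z, C <= (tensor_family M N c z')%:num.
Proof.
have [g [C C0 HC]] := df_positive dfM (lsubmx z).
have [om [D D0 HD]] := df_positive dfN (rsubmx z).
exists (g, om), (C * D); first exact: mulr_gt0.
have nD : \forall z' \near z, D <= (N om (rsubmx z'))%:num := continuous_rsubmx HD.
have nC : \forall z' \near z, C <= (M g (lsubmx z'))%:num := continuous_lsubmx HC.
by apply: filterS2 nC nD => z' /= h1 h2; apply: ler_pM => //; exact: ltW.
Qed.

Lemma tensor_mapB (u v : P) : tmap (u - v) = tmap u - tmap v.
Proof. by rewrite /tensor_map linearB. Qed.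

Lemma tensor_map_continuous : continuous (tmap : P -> H).
Proof.
move=> x A /seminorm_nbhsP[s [e e0 sA]].
have [r Hr] : exists r : seq (projective_seminorm F G), forall u : P,
    all (fun q : projective_seminorm F G => sval q u < e) r ->
    all (fun i => K_norm i (tmap u : K_fun _) < e) s.
  elim: (s) => [|i s' [r IH]]; first by exists [::].
  have [q qE] := pullback_seminorm M N i; exists (q :: r) => u /=.
  by rewrite qE => /andP[-> /IH].
apply/seminorm_nbhsP; exists r, e => // y xy; apply: sA.
by have := Hr _ xy; rewrite tensor_mapB.
Qed.

Lemma tensor_map_embedding (x : P) (A : set P) :
  nbhs x A <-> exists2 B, nbhs (tmap x : H) B & tmap @^-1` B `<=` A.
Proof.
split=> [/seminorm_nbhsP[s [e e0 sA]]|[B xB BA]]; last first.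
  by apply: filterS BA _; exact: tensor_map_continuous.
have [r [d d0 Hr]] : exists r, exists2 d : R, 0 < d & forall u : P,
    all (fun i => K_norm i (tmap u : K_fun _) < d) r -> all (fun q : projective_seminorm F G => sval q u < e) s.
  elim: (s) => [|q s' [r [d d0 IH]]]; first by exists [::], 1.
  have [i [C C0 qC]] := projective_le_K_norm dfM dfN M1 M2 q.
  have C1 : 0 < C + 1 by rewrite ltr_wpDl.
  exists (i :: r), (Num.min d (e / (C + 1))); first by rewrite lt_min d0 divr_gt0.
  move=> u /= /andP[]; rewrite lt_min ltr_pdivlMr // => /andP[_ ue] ur.
  apply/andP; split.
    apply: le_lt_trans (qC u) _; apply: le_lt_trans ue.
    by rewrite mulrC ler_wpM2l ?K_norm_ge0 // lerDl.
  by apply: IH; apply: sub_all ur => j; rewrite lt_min => /andP[].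
exists (seminorm_ball (p := K_seminorm (tensor_family M N)) r d (tmap x)).
  by apply/seminorm_nbhsP; exists r, d.
move=> y xy; apply: sA; apply: Hr.
by move: xy; rewrite /= /seminorm_ball /= tensor_mapB.
Qed.

Lemma tensor_map_injective : injective tmap.
Proof.
move=> u v uv; apply/eqP; rewrite -subr_eq0; apply/eqP.
have : tmap (u - v) = 0 by rewrite (tensor_mapB u v) uv subrr.
elim/tensorP: (u - v) => s; rewrite tensor_map_class tensor_class_sum.
exact: pure_sum_eq0.
Qed.

(** A weight that is positive at the fixed t can be divided out of a seminorm of h. *)
Lemma slice_K (h : H) (nu : multi_index k1) (t : 'rV[R]_k1) :
  (fun y => multi_partial (mi_pair nu [ffun=> 0%N]) h (row_mx t y)) \in K_pred N.
Proof.
apply/K_predP; split; first exact: smooth_slice_r (K_smooth h) _ _.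
move=> o n; have [g [C C0 /nbhs_singleton gC]] := df_positive dfM t.
exists (K_norm ((g, o), (multi_order nu + n)%N) h / C) => _ [y [mu [mun ->]]].
rewrite (multi_partial_slice_r (K_smooth h)) ler_pdivlMr //.
have mm : (multi_order (mi_pair nu mu) <= multi_order nu + n)%N.
  by rewrite multi_order_pair leq_add2l.
apply: le_trans (K_norm_ub (g, o) h (row_mx t y) mm).
rewrite /= row_mxKl row_mxKr mulrC mulrA ler_wpM2r ?normc_ge0 // ler_wpM2r //.
Qed.

Lemma tensor_map_dense : dense (range (tmap : P -> H)).
Proof.
move=> O [h Oh]; rewrite openE => /(_ _ Oh) /seminorm_nbhsP[s [e e0 sO]].
have inh : exists c : Gamma * Omega, True.
  by have [c _] := tensor_family_positive 0; exists c.
have [gom [c c0 Hc]] := K_ball_single inh tensor_family_directed s e0.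
case: gom Hc => -[g o] m Hc.
have [g' [m' [C [_ approx]]]] := K_approx dfM M1 M2 g m.
pose W := K_norm ((g', o), (m' + m)%N) (h : K_fun _).
have W0 : 0 <= W by exact: K_norm_ge0.
have W1 : 0 < W + 1 by rewrite ltr_wpDl.
have eps0 : 0 < c / (W + 1) by rewrite divr_gt0.
have [J [nu [t [E [num _ rem]]]]] := approx _ eps0.
pose GA A : G := KFun (slice_K h (nu A) (t A)).
pose u : P := tensor_class [seq (E A : F, GA A) | A <- index_enum J].
exists (tmap u); split; last by exists u.
apply: sO; rewrite /seminorm_ball /=; apply: Hc.
apply: (@le_lt_trans _ _ (c / (W + 1) * W)); last first.
  by rewrite mulrAC ltr_pdivrMr // ltr_pM2l // ltrDl.
apply: K_norm_le => z mu mum.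
pose x := lsubmx z; pose y := rsubmx z.
pose mu1 : multi_index k1 := [ffun j => mu (lshift k2 j)].
pose mu2 : multi_index k2 := [ffun j => mu (rshift k1 j)].
have zE : z = row_mx x y by rewrite hsubmxK.
have muE : mu = mi_pair mu1 mu2 by rewrite mi_pairE.
have ordE : multi_order mu = (multi_order mu1 + multi_order mu2)%N.
  by rewrite muE multi_order_pair.
have uE : tmap u = \sum_A K_prod M N (E A) (GA A).
  by rewrite tensor_map_class big_map.
(* Derivatives in the second variables commute with the approximation, which acts on x only: the
   error is that of approximating this slice. *)
pose f x := multi_partial (mi_pair [ffun=> 0%N] mu2) h (row_mx x y).
have -> : multi_partial mu (h - tmap u : K_fun (tensor_family M N)) z =
    multi_partial mu1 f x -
    \sum_A multi_partial (nu A) f (t A) * multi_partial mu1 (E A) x.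
  rewrite (K_partialB mu (h : K_fun (tensor_family M N)) (tmap u)) uE.
  rewrite (K_partial_sum _ _ (fun A => K_prod M N (E A) (GA A) : K_fun _)).
  rewrite {1}zE {1}muE -(multi_partial_slice_l (K_smooth h)); congr (_ - _).
  apply: eq_bigr => A _.
  rewrite (multi_partial_prod _ (K_smooth (E A)) (K_smooth (GA A))) /prod_fun mulrC.
  rewrite -/mu1 -/mu2 -/x -/y; congr (_ * _).
  by rewrite (multi_partial_slice_l (K_smooth h)) -(multi_partial_slice_r (K_smooth h)).
have [Ny0|Nyp] := leP (N o y)%:num 0.
  have -> : (tensor_family M N (g, o) z)%:num = 0.
    by rewrite /= -/y; have /eqP -> : (N o y)%:num == 0 :> R by [rewrite eq_le Ny0 /=];
      rewrite mulr0.
  by rewrite mul0r mulr_ge0 // ltW.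
(* The seminorm of the slice grows at most like the inverse of the weight at y, so multiplying by
   that weight makes the error uniform in y. *)
have V0 : 0 <= W / (N o y)%:num by rewrite divr_ge0.
have bound x' ka : (multi_order ka <= m')%N ->
    (M g' x')%:num * normc (multi_partial ka f x') <= W / (N o y)%:num.
  move=> kam; rewrite (multi_partial_slice_l (K_smooth h)) ler_pdivlMr //.
  have mm : (multi_order (mi_pair ka mu2) <= m' + m)%N.
    by rewrite multi_order_pair leq_add // (leq_trans _ mum) // ordE leq_addl.
  apply: le_trans (K_norm_ub (g', o) (h : K_fun _) (row_mx x' y) mm).
  by rewrite /= row_mxKl row_mxKr mulrAC.
have mu1m : (multi_order mu1 <= m)%N by rewrite (leq_trans _ mum) // ordE leq_addr.
have := rem f _ (smooth_slice_l (K_smooth h) mu2 y) V0 bound x mu1 mu1m.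
by rewrite mulrA ler_pdivlMr // /= -/x -/y mulrAC.
Qed.

Lemma tensor_map_completion (T : {linear P -> H}) : (T : P -> H) = tmap -> is_completion T.
Proof.
move=> TE; split.
- exact: K_space_hausdorff tensor_family_positive.
- exact: K_space_complete tensor_family_positive.
- by rewrite TE; exact: tensor_map_injective.
- by move=> x A; rewrite TE; exact: tensor_map_embedding.
- by rewrite TE; exact: tensor_map_dense.
Qed.

End TensorCompletion.

Theorem theorem11 (R : realType) (k1 k2 : nat) (Gamma Omega : Type)
    (M : Gamma -> 'rV[R]_k1 -> {nonneg R})
    (N : Omega -> 'rV[R]_k2 -> {nonneg R}) :
  defining_family M -> condition_I M -> condition_II M ->
  defining_family N -> condition_I N -> condition_II N ->
  induces_topological_isomorphism (K_prod M N).
Proof.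
move=> dfM M1 M2 dfN _ _ P T.
pose Tl : {linear P -> K_space (tensor_family M N)} :=
  HB.pack T (GRing.isLinear.Build R[i] P _ _ T (tensor_lift_linear (K_prod M N))).
have Tc : is_completion Tl by exact: tensor_map_completion.
split; first exact: tensor_map_continuous.
  by exists (K_space (tensor_family M N)), Tl.
by move=> E j jc; exact: completion_unique jc Tc.
Qed.
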